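(* Let $(\Lambda,\eta)$ be a full isothermic surface in $S^{n}$, $n\geq3$. (a) Let $\hat{\Lambda}_{1}$ and $\hat{\Lambda}_{2}$ be two Darboux transforms of $(\Lambda,\eta)$ of parameters $m_1\neq m_2$, such that there is a $w\in\mathbb{R}^{n+1,1}$ with $w\notin\Lambda_x^{\perp}$ for all $x\in\Sigma$, which never belongs to the spherical systems of $\Lambda,\hat{\Lambda}_{1}$ and of $\Lambda,\hat{\Lambda}_{2}$. If the sphere-planes of $\hat{\Lambda}_{1}$ and $\hat{\Lambda}_{2}$ associated to $w$ coincide and contain no principal direction of $\Lambda$, then $(\Lambda,\eta)$ is a special isothermic surface of type $2$, with respect to a polynomial $p(t)$ with $p_0=p(0)\in\langle w\rangle$, and such that $\hat{\Lambda}_{1}$ and $\hat{\Lambda}_{2}$ are complementary surfaces of $(\Lambda,\eta)$ with respect to $p(t)$. (b) Conversely, if $(\Lambda,\eta)$ is special isothermic of type $2$ in $E(w)$ (with respect to a polynomial $p(t)$ with $p(0)\in\langle w\rangle$), with complementary surfaces $\hat{\Lambda}_1,\hat{\Lambda}_2$ (with respect to $p(t)$), then the sphere-planes of $\hat{\Lambda}_1$ and of $\hat\Lambda_2$ associated to $w$ coincide.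
   Context: $\mathbb{R}^{n+1,1}$ denotes $\mathbb{R}^{n+2}$ with an inner product $(\cdot,\cdot)$ of signature $(n+1,1)$, $\mathcal{L}$ its light-cone, and $S^n\cong\mathbb{P}(\mathcal{L})$. $\Sigma$ is a connected smooth surface, $\underline{\mathbb{R}}^{n+1,1}=\Sigma\times\mathbb{R}^{n+1,1}$, and $\mathrm{d}$ is its trivial flat connection. A map $\Sigma\to S^n$ is identified with a null line subbundle $\Lambda\subset\underline{\mathbb{R}}^{n+1,1}$; a lift of $\Lambda$ is a never-vanishing section $F$; $\Lambda^{(1)}:=\langle F,\mathrm{d}F(T\Sigma)\rangle$; $\Lambda$ is an immersion iff $\Lambda^{(1)}$ is a subbundle of rank $3$. Identify $\bigwedge^2\mathbb{R}^{n+1,1}$ with $\mathrm{o}(\mathbb{R}^{n+1,1})$ by $(u\wedge v)w=(u,w)v-(v,w)u$. $\Lambda$ is full if its image lies in no proper subsphere $\mathbb{P}(\mathcal{L}\cap V)$, $V\subsetneq\mathbb{R}^{n+1,1}$ a linear subspace of signature $(k+1,1)$, $k<n$. An isothermic surface $(\Lambda,\eta)$ in $S^n$ is an immersion $\Lambda$ with a non-zero closed $1$-form $\eta\in\Omega^1\otimes\mathrm{o}(\mathbb{R}^{n+1,1})$ taking values in $\Lambda\wedge\Lambda^{\perp}$; then $\mathrm{d}+t\eta$ is a flat metric connection for all $t\in\mathbb{R}$. Away from a discrete set (the zeros of $\eta$) there are local conformal curvature line coordinates $(u,v)$ with $\eta=e^{-2\theta}F\wedge(-F_u\,\mathrm{d}u+F_v\,\mathrm{d}v)$,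 where $(\mathrm{d}F,\mathrm{d}F)=e^{2\theta}(\mathrm{d}u^2+\mathrm{d}v^2)$; the principal directions of $\Lambda$ are those of $\partial_u,\partial_v$. A polynomial conserved quantity of $(\Lambda,\eta)$ is a non-zero polynomial $p(t)=\sum_k p_kt^k$ with $p_k\in\Gamma(\underline{\mathbb{R}}^{n+1,1})$ such that $(\mathrm{d}+t\eta)p(t)=0$ for all $t$. $(\Lambda,\eta)$ is special isothermic of type $d$ with respect to $p(t)$ if $p(t)$ is a polynomial conserved quantity of degree $d$; for $w\neq0$ it is special isothermic of type $d$ in the space-form $E(w)=\{v\in\mathcal{L}:(v,w)=-1\}$ if moreover $p_0\in\langle w\rangle$. A Darboux transform of $(\Lambda,\eta)$ with parameter $m\in\mathbb{R}\setminus\{0\}$ is an immersed $\hat\Lambda:\Sigma\to\mathbb{P}(\mathcal{L})$ with $\hat\Lambda\cap\Lambda=\{0\}$ which is $(\mathrm{d}+m\eta)$-parallel. The complementary surfaces of $(\Lambda,\eta)$ with respect to $p(t)$ are the Darboux transforms $\hat\Lambda$ (with parameter $m$) such that $\hat\Lambda=\langle p(m)\rangle$ for some $m\in\mathbb{R}\setminus\{0\}$ with $(p(m),p(m))=0$. For a Darboux transform $\hat\Lambda$ put $V_R:=\Lambda^{(1)}\oplus\hat\Lambda$ (rank $4$). The spherical system of $\Lambda$ and $\hat\Lambda$ is $\mathcal{C}:=\Lambda\oplus\hat\Lambda\oplus V_R^{\perp}=(\Lambda^{(1)})^\perp\oplus\hat\Lambda$. The sphere-planes (congruence) of $\Lambda$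 and $\hat\Lambda$ associated to $w$ is $\mathcal{P}:=\mathcal{C}+\langle w\rangle$, defining a congruence of hyperspheres where $w\notin\mathcal{C}$. ''$\mathcal{P}$ contains no principal direction of $\Lambda$'' means $\langle F,F_u\rangle\cap\mathcal{P}=\Lambda$ and $\langle F,F_v\rangle\cap\mathcal{P}=\Lambda$ for the local conformal curvature line coordinates $(u,v)$ with $\eta=e^{-2\theta}F\wedge(-F_u\,\mathrm{d}u+F_v\,\mathrm{d}v)$ and $(\mathrm{d}F,\mathrm{d}F)=e^{2\theta}(\mathrm{d}u^2+\mathrm{d}v^2)$. *)

(* Defs.v *)
From HB Require Import structures.
From mathcomp Require Import all_boot all_order all_algebra.
From mathcomp Require Import all_classical all_reals all_analysis.
Set Implicit Arguments.
Unset Strict Implicit.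
Unset Printing Implicit Defensive.
Import Order.TTheory GRing.Theory Num.Theory.
Import numFieldNormedType.Exports.
Local Open Scope classical_set_scope.
Local Open Scope ring_scope.

Section Span.
Variables (K : fieldType) (V : vectType K).

Definition vspan (A : set V) : {vspace V} :=
  xget 0%VS [set U : {vspace V} | A `<=` [set` U] /\
    forall W : {vspace V}, A `<=` [set` W] -> (U <= W)%VS].

Lemma vspanP (A : set V) : A `<=` [set` vspan A] /\
  forall W : {vspace V}, A `<=` [set` W] -> (vspan A <= W)%VS.
Proof.
suff [U UP] : exists U : {vspace V}, A `<=` [set` U] /\
    forall W : {vspace V}, A `<=` [set` W] -> (U <= W)%VS.
  exact: (xgetPex (P := [set U : {vspace V} | A `<=` [set` U] /\
    forall W : {vspace V}, A `<=` [set` W] -> (U <= W)%VS]) 0%VS (ex_intro _ U UP)).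
have [k] := ubnP (\dim {:V}).
have : A `<=` [set` {:V}%VS] by move=> x _ /=; rewrite memvf.
move: (fullv : {vspace V}) => U; elim: k U => // k IHk U AU dimU.
have [least|] := pselect (forall W : {vspace V}, A `<=` [set` W] -> (U <= W)%VS).
  by exists U.
move=> /existsNP[W] /not_implyP[AW /negP UW].
apply: (IHk (U :&: W)%VS).
  by move=> x Ax /=; rewrite memv_cap; apply/andP; split; [exact: AU | exact: AW].
have lt_dim : (\dim (U :&: W) < \dim U)%N.
  rewrite ltn_neqAle dimvS ?capvSl// andbT; apply: contra UW => eqd.
  by apply/capv_idPl/eqP; rewrite eqEdim capvSl (eqP eqd) leqnn.
by rewrite (leq_trans lt_dim).
Qed.

End Span.

Section InnerProduct.
Variables (R : realType) (n : nat).
Local Notation V := 'rV[R]_n.+2.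
Implicit Types (G : 'M[R]_n.+2) (U : {vspace V}) (u v w : V).

Definition ip G u v : R := (u *m G *m v^T) 0 0.

Definition has_signature G U (p q : nat) : Prop :=
  exists e : (p + q).-tuple V, basis_of U e /\
    forall i j : 'I_(p + q), ip G (tnth e i) (tnth e j) =
      if i == j then (if (i < p)%N then 1 else -1) else 0.

Definition lorentzian G : Prop := G^T = G /\ has_signature G fullv n.+1 1.

Definition perp G U : {vspace V} :=
  vspan [set v | forall u, u \in U -> ip G u v = 0].

Lemma memv_perp G U v : v \in perp G U <-> forall u, u \in U -> ip G u v = 0.
Proof.
split=> [vU u uU|vU]; last first.
  exact: ((vspanP [set v | forall u, u \in U -> ip G u v = 0]).1 v vU).
pose f := linfun (mulmx (u *m G) \o trmx : V -> 'M[R]_1).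
have /subvP/(_ _ vU) : (perp G U <= lker f)%VS.
  apply: (vspanP _).2 => w /= /(_ u uU) uw; rewrite memv_ker lfunE /=.
  by apply/eqP/matrixP => i j; rewrite !ord1 [RHS]mxE.
by rewrite memv_ker lfunE /= => /eqP/matrixP/(_ 0 0); rewrite [RHS]mxE.
Qed.

(* Endomorphisms are matrices acting on row vectors, w |-> w *m M. *)
Definition wedge G u v : 'M[R]_n.+2 := G *m (u^T *m v - v^T *m u).

Lemma wedgeE G u v w : G^T = G ->
  w *m wedge G u v = ip G u w *: v - ip G v w *: u.
Proof.
move=> Gs; have ipC a b : ip G a b = ip G b a.
  rewrite /ip; transitivity ((a *m G *m b^T)^T 0 0); first by rewrite [RHS]mxE.
  by rewrite !trmx_mul trmxK Gs mulmxA.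
have aux (a b : V) : w *m G *m (a^T *m b) = ip G a w *: b.
  by rewrite mulmxA [w *m G *m a^T]mx11_scalar mul_scalar_mx (ipC a w).
by rewrite /wedge mulmxA mulmxBr !aux.
Qed.

End InnerProduct.

Section SmoothMaps.
Variables (R : realType) (X Y : normedModType R).

(* To be used on open sets only: there 'D_v f is determined by f near the
   point, whatever the values of f outside the set are. *)
Fixpoint Ck (k : nat) (U : set X) (f : X -> Y) : Prop :=
  if k is k'.+1 then
    (forall x, U x -> differentiable f x) /\ forall v, Ck k' U ('D_v f)
  else forall x, U x -> {for x, continuous f}.

Definition smooth_on (U : set X) (f : X -> Y) : Prop := forall k, Ck k U f.

End SmoothMaps.

Section Charts.
Variables (R : realType) (T : topologicalType).

(* The values of fwd outside dom, and of bwd outside fwd @` dom, are junk. *)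
Record chart := Chart {
  dom : set T;
  fwd : T -> 'rV[R]_2;
  bwd : 'rV[R]_2 -> T;
  dom_open : open dom;
  img_open : open (fwd @` dom);
  fwdK : forall x, dom x -> bwd (fwd x) = x;
  fwd_continuous : forall x, dom x -> {for x, continuous fwd};
  bwd_continuous : forall y, (fwd @` dom) y -> {for y, continuous bwd} }.

Definition smooth_transition (c c' : chart) : Prop :=
  smooth_on (fwd c @` (dom c `&` dom c')) (fwd c' \o bwd c).

Definition maximal_smooth_atlas (A : set chart) : Prop :=
  (forall x, exists2 c, A c & dom c x) /\
  forall c, A c <->
    forall c', A c' -> smooth_transition c c' /\ smooth_transition c' c.

End Charts.

Record smooth_surface (R : realType) := SmoothSurface {
  carrier :> topologicalType;
  atlas : set (chart R carrier);
  surface_hausdorff : hausdorff_space carrier;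
  surface_countable : @second_countable carrier;
  atlasP : maximal_smooth_atlas atlas }.

Arguments atlas {R} S : rename.

Section Calculus.
Variables (R : realType) (S : smooth_surface R).

Definition smooth_map (Y : normedModType R) (O : set S) (f : S -> Y) : Prop :=
  forall c, atlas S c -> smooth_on (fwd c @` (dom c `&` O)) (f \o bwd c).

(* d f_x applied to the tangent vector with components v in the chart c. *)
Definition dmap (Y : normedModType R) (c : chart R S) (f : S -> Y)
  (v : 'rV[R]_2) (x : S) : Y := 'D_v (f \o bwd c) (fwd c x).

(* Components of the coordinate vector fields of a chart. *)
Definition du : 'rV[R]_2 := delta_mx 0 0.
Definition dv : 'rV[R]_2 := delta_mx 0 1.

(* A 1-form is given by its expressions in all the charts of the atlas: eta c x v
   is its value at x on the tangent vector with components v in the chart c. *)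
Definition preform (Y : Type) : Type := chart R S -> S -> 'rV[R]_2 -> Y.

Definition one_form (Y : normedModType R) (eta : preform Y) : Prop :=
  [/\ forall c x, atlas S c -> dom c x -> forall a v1 v2,
        eta c x (a *: v1 + v2) = a *: eta c x v1 + eta c x v2,
      forall c c' x v, atlas S c -> atlas S c' -> dom c x -> dom c' x ->
        eta c x v = eta c' x (dmap c (fwd c') v x) &
      forall c v, atlas S c ->
        smooth_on (fwd c @` dom c) (fun y => eta c (bwd c y) v)].

Definition nonzero_form (Y : normedModType R) (eta : preform Y) : Prop :=
  exists c x v, [/\ atlas S c, dom c x & eta c x v != 0].

Definition closed_form (Y : normedModType R) (eta : preform Y) : Prop :=
  forall c x v1 v2, atlas S c -> dom c x ->
    dmap c (fun z => eta c z v2) v1 x = dmap c (fun z => eta c z v1) v2 x.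

End Calculus.

Section Surfaces.
Variables (R : realType) (n : nat) (G : 'M[R]_n.+2) (S : smooth_surface R).
Local Notation V := 'rV[R]_n.+2.
Local Notation bundle := (S -> {vspace 'rV[R]_n.+2}).
Local Notation form := (preform S 'M[R]_n.+2).
Implicit Types (Lam hLam E : bundle) (eta : form) (p : nat -> S -> V).

Definition subbundle (k : nat) E : Prop :=
  forall x, exists (O : set S) (s : 'I_k -> S -> V),
    [/\ open O, O x, forall i, smooth_map O (s i) &
        forall y, O y -> E y = (\sum_i <[s i y]>)%VS /\ \dim (E y) = k].

Definition local_section E (O : set S) (s : S -> V) : Prop :=
  [/\ open O, smooth_map O s & forall x, O x -> s x \in E x].

(* Maps from the surface to the projectivised light-cone. *)
Definition null_line_bundle Lam : Prop :=
  subbundle 1 Lam /\ forall x u, u \in Lam x -> ip G u u = 0.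

Definition lift Lam (O : set S) (F : S -> V) : Prop :=
  local_section Lam O F /\ forall x, O x -> F x != 0.

(* < F, dF(T Sigma) > does not depend on the lift F, nor on the chart: the span
   is taken over all of them in order not to choose. *)
Definition first_derived Lam : bundle := fun x =>
  vspan [set z | exists O F, [/\ lift Lam O F, O x &
    z = F x \/ exists c v, [/\ atlas S c, dom c x & z = dmap c F v x]]].

Definition immersion Lam : Prop :=
  null_line_bundle Lam /\ subbundle 3 (first_derived Lam).

Definition full Lam : Prop :=
  forall (U : {vspace V}) (k : nat), (k < n)%N -> has_signature G U k.+1 1 ->
    ~ forall x, (Lam x <= U)%VS.

(* As Lam is a line bundle, every element of Lam /\ Lam^perp is of the form
   f /\ z with f in Lam and z in Lam^perp. *)
Definition isothermic Lam eta : Prop :=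
  [/\ immersion Lam,
      one_form eta, nonzero_form eta, closed_form eta &
      forall c x v, atlas S c -> dom c x ->
        exists f z, [/\ f \in Lam x, z \in perp G (Lam x) &
                        eta c x v = wedge G f z]].

(* (d + t eta) s *)
Definition nabla eta (t : R) (c : chart R S) (s : S -> V) (v : 'rV[R]_2)
  (x : S) : V := dmap c s v x + t *: (s x *m eta c x v).

Definition parallel_bundle eta (t : R) E : Prop :=
  forall O s, local_section E O s ->
  forall c x v, atlas S c -> dom c x -> O x -> nabla eta t c s v x \in E x.

Definition darboux_transform Lam eta (m : R) hLam : Prop :=
  [/\ m != 0, immersion hLam,
      forall x, (hLam x :&: Lam x = 0)%VS & parallel_bundle eta m hLam].

(* Polynomials p(t) = \sum_k p_k t^k with coefficients p_k = p k. *)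
Definition poly_degree p (d : nat) : Prop :=
  (exists x, p d x != 0) /\ forall k, (d < k)%N -> forall x, p k x = 0.

Definition peval p (d : nat) (t : R) (x : S) : V :=
  \sum_(k < d.+1) t ^+ k *: p k x.

Definition conserved_quantity eta p (d : nat) : Prop :=
  [/\ poly_degree p d, forall k, smooth_map setT (p k) &
      forall t c x v, atlas S c -> dom c x ->
        nabla eta t c (peval p d t) v x = 0].

Definition special_isothermic Lam eta (d : nat) p : Prop :=
  isothermic Lam eta /\ conserved_quantity eta p d.

Definition special_isothermic_in Lam eta (d : nat) p (w : V) : Prop :=
  [/\ w != 0, special_isothermic Lam eta d p &
      forall x, p 0%N x \in <[w]>%VS].

Definition complementary Lam eta (d : nat) p hLam : Prop :=
  exists m : R, [/\ m != 0,
    forall x, ip G (peval p d m x) (peval p d m x) = 0,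
    darboux_transform Lam eta m hLam &
    forall x, hLam x = <[peval p d m x]>%VS].

Definition VR Lam hLam : bundle := fun x => (first_derived Lam x + hLam x)%VS.

Definition spherical_system Lam hLam : bundle := fun x =>
  (Lam x + hLam x + perp G (VR Lam hLam x))%VS.

Definition sphere_planes Lam hLam (w : V) : bundle := fun x =>
  (spherical_system Lam hLam x + <[w]>)%VS.

(* (u, v) are the coordinates of the chart c. They are curvature line coordinates
   when the second fundamental form, i.e. the second derivative of F modulo
   < F, F_u, F_v >, has no mixed term. *)
Definition isothermic_coordinates Lam eta (c : chart R S) (F : S -> V)
    (theta : S -> R) : Prop :=
  [/\ atlas S c, lift Lam (dom c) F &
  forall x, dom c x ->
    let Fu := dmap c F (du R) x in let Fv := dmap c F (dv R) x in
    [/\ ip G Fu Fu = expR (2 * theta x), ip G Fv Fv = expR (2 * theta x),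
        ip G Fu Fv = 0,
        dmap c (dmap c F (dv R)) (du R) x \in first_derived Lam x &
        forall a : 'rV[R]_2, eta c x a =
          expR (- 2 * theta x) *: wedge G (F x) (- a 0 0 *: Fu + a 0 1 *: Fv)]].

Definition no_principal_direction Lam eta (P : bundle) : Prop :=
  forall c F theta, isothermic_coordinates Lam eta c F theta ->
  forall x, dom c x ->
    ((<[F x]> + <[dmap c F (du R) x]>) :&: P x = Lam x)%VS /\
    ((<[F x]> + <[dmap c F (dv R) x]>) :&: P x = Lam x)%VS.

End Surfaces.

(* Main.v *)
From HB Require Import structures.
From mathcomp Require Import all_boot all_order all_algebra.
From mathcomp Require Import all_classical all_reals all_analysis.
From mathcomp Require Import ring lra zify.
Require Import Defs.
Set Implicit Arguments.
Unset Strict Implicit.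
Unset Printing Implicit Defensive.
Import Order.TTheory GRing.Theory Num.Theory.
Import numFieldNormedType.Exports.
Local Open Scope classical_set_scope.
Local Open Scope ring_scope.

(** The form [eta] is [F /\ zeta] for a lift [F] and a form [zeta], tangent along the
    first derived bundle (the Codazzi equations).  As soon as a Darboux transform exists,
    [eta] has no zero, because the transform is an immersion and the derivative of
    a lift [H] of it is [- m H eta] modulo [H].  So [eta] kills exactly the orthogonal of
    the first derived bundle ([ker_eta]), and the spherical system is that orthogonal plus
    the transform ([spherical_systemE]).  Everything happens modulo this orthogonal, called
    [N] here.

    Part (b).  In a quadratic conserved quantity [p0 + t p1 + t^2 p2] the coefficient [p2]
    is killed by [eta], hence lies in [N].  A complementary surface is spanned by [p(m)],
    which is [m p1] modulo [N] and [w]; both sphere-planes are [N + <p1, w>]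
    ([complementary_sphere_planes]).

    Part (a).  As the sphere-planes coincide, lifts [H1], [H2] of the two transforms can be
    scaled so that [H1 + H2 + beta w] lies in [N], with smooth data ([local_relation]).
    Differentiate this in conformal curvature line coordinates.  In the direction [u] the
    result, corrected by terms in [eta], is a vector of the sphere-plane orthogonal to [F]
    and to [F_v], since [F_uv] is tangent; being in the sphere-plane, which does not contain
    the principal direction [F_u], it is orthogonal to [F_u] as well, hence lies in [N].  So
    [H1], [H2] and [beta] have the same connection coefficient ([common_coefficient]):
    [dH_i = omega H_i - m_i H_i eta] and [d beta = omega beta].

    Hence [beta] vanishes everywhere or nowhere, the surface being connected.  If nowhere,
    [H_i / beta] is parallel for [d + m_i eta].  If everywhere, [u = m2 H1 + m1 H2] satisfies
    [du = omega u], so it spans a constant line; normalising [u] to be a constant vector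
    again makes the [H_i] parallel.  In both cases there are a constant [d] and global
    parallel sections [s1], [s2] of the transforms with [s1 + s2 + d w] in [N]
    ([parallel_relation]).  The quadratic polynomial [p] with [p(0)], [p(m1)], [p(m2)]
    proportional to [w], [s1], [s2] and with leading coefficient [s1 + s2 + d w] is then
    conserved ([interpolation_parallel]).

    The coordinates themselves come from the classical argument: [zeta] defines a quadratic
    differential, trace-free and without zeros, which together with the induced metric is
    diagonalised by two 1-forms; the Codazzi equations say that these are closed, and the
    Poincare lemma and the inverse function theorem in the plane turn them into the
    differentials of a chart ([isothermic_chart]). *)

(** * Calculus of maps of class C^k *)

Section Diff.
Variables (R : realType) (X Y : normedModType R).

Lemma open_near (T : topologicalType) (U : set T) x :
  open U -> U x -> \near x, U x.
Proof. by move=> Uo Ux; apply: open_nbhs_nbhs. Qed.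

Lemma near_shift0 (P : set X) x : (\near x, P x) -> \forall h \near 0, P (h + x).
Proof.
move=> Px; rewrite (near_shift x 0).
by near=> y; rewrite /= sub0r subrK; near: y.
Unshelve. all: by end_near. Qed.

Lemma diff_epsP (f : X -> Y) x (L : {linear X -> Y}) : continuous L ->
  (forall e, 0 < e ->
    \forall h \near 0, `|f (h + x) - f x - L h| <= e * `|h|) ->
  differentiable f x /\ 'd f x = L :> (X -> Y).
Proof.
move=> Lc fL; have E : f \o shift x = cst (f x) + L +o_ 0 id.
  apply/eqaddoP => e e0; near=> h.
  by rewrite /= opprD addrA; near: h; exact: fL.
have dE := diff_unique Lc E; split=> //.
by apply/diff_locallyP; rewrite dE.
Unshelve. all: by end_near. Qed.

Lemma diff_eps (f : X -> Y) x : differentiable f x -> forall e, 0 < e ->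
  \forall h \near 0, `|f (h + x) - f x - 'D_h f x| <= e * `|h|.
Proof.
move=> df e e0; have /eqaddoP/(_ _ e0) H := diff_locally df.
near=> h; rewrite (deriveE h df) -addrA -opprD.
by near: h; exact: H.
Unshelve. all: by end_near. Qed.

Lemma near_eq_diff (f g : X -> Y) x : {near x, f =1 g} ->
  differentiable f x -> differentiable g x.
Proof.
move=> fg df; suff [] : differentiable g x /\ 'd g x = 'd f x :> (X -> Y) by [].
apply: (@diff_epsP g x ('d f x)) => [|e e0]; first exact: diff_continuous.
near=> h.
rewrite -(nbhs_singleton fg) -(_ : f (h + x) = g (h + x)).
  by rewrite -deriveE//; near: h; exact: diff_eps.
by near: h; exact: near_shift0 fg.
Unshelve. all: by end_near. Qed.

Lemma derive_linear (f : X -> Y) x : differentiable f x ->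
  forall a v w, 'D_(a *: v + w) f x = a *: 'D_v f x + 'D_w f x.
Proof. by move=> df a v w; rewrite !deriveE// linearP. Qed.

Lemma derive_comp (Z : normedModType R) (f : X -> Y) (g : Y -> Z) x v :
  differentiable f x -> differentiable g (f x) ->
  'D_v (g \o f) x = 'D_('D_v f x) g (f x).
Proof.
move=> df dg; rewrite deriveE; last exact: differentiable_comp.
by rewrite diff_comp//= -!deriveE.
Qed.

End Diff.

Section Ck.
Variables (R : realType) (X : normedModType R).
Implicit Types Y Z : normedModType R.

Lemma Ck_eq Y k (U : set X) (f g : X -> Y) : open U ->
  (forall x, U x -> f x = g x) -> Ck k U f -> Ck k U g.
Proof.
move=> oU; elim: k f g => [|k IH] f g fg.
  move=> cf x Ux; rewrite /prop_for /continuous_at -(fg x Ux).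
  apply: cvg_trans (cf x Ux); apply: near_eq_cvg.
  by near=> y; apply: fg; near: y; exact: open_near.
have nfg x : U x -> {near x, f =1 g}.
  by move=> Ux; near=> y; apply: fg; near: y; exact: open_near.
move=> [df Cf]; split=> [x Ux|v].
  exact: near_eq_diff (nfg x Ux) (df x Ux).
by apply: IH (Cf v) => x Ux; exact/near_eq_derive/nfg.
Unshelve. all: by end_near. Qed.

(** Membership in C^k is a condition at each point separately, so it restricts to
    subsets and glues. *)
Lemma CkP Y k (U : set X) (f : X -> Y) :
  Ck k U f <-> forall x, U x -> Ck k [set x] f.
Proof.
elim: k f => [|k IH] f /=.
  by split=> [H x Ux y ->|H x Ux]; [exact: H | exact: (H x Ux)].
split=> [[H1 H2] x Ux|H].
  split=> [y -> |v]; first exact: H1.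
  exact: ((IH _).1 (H2 v)).
split=> [x Ux|v]; first exact: (H x Ux).1.
by apply/IH => x Ux; exact: (H x Ux).2.
Qed.

Lemma Ck_sub Y k (U V : set X) (f : X -> Y) : U `<=` V -> Ck k V f -> Ck k U f.
Proof. by move=> UV /CkP H; apply/CkP => x /UV; exact: H. Qed.

Lemma Ck_local Y k (U : set X) (f : X -> Y) :
  (forall x, U x -> exists2 V, V x & Ck k V f) -> Ck k U f.
Proof. by move=> H; apply/CkP => x /H[V Vx /CkP]; exact. Qed.

Lemma CkW Y k (U : set X) (f : X -> Y) : Ck k.+1 U f -> Ck k U f.
Proof.
elim: k f => [|k IH] f [df Df]; last by split=> // v; exact: IH.
by move=> x /df; exact: differentiable_continuous.
Qed.

Lemma Ck_cst Y k (U : set X) (a : Y) : Ck k U (fun=> a).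
Proof.
elim: k a => [|k IH] a; first by move=> x _; exact: cvg_cst.
split=> [x _|v]; first exact: differentiable_cst.
rewrite (_ : 'D_v (fun=> a) = fun=> 0)//; apply/funext => x.
exact: (derive_cst a x v).
Qed.

Lemma Ck_add Y k (U : set X) (f g : X -> Y) : open U ->
  Ck k U f -> Ck k U g -> Ck k U (fun x => f x + g x).
Proof.
move=> oU; elim: k f g => [|k IH] f g.
  by move=> cf cg x Ux; apply: cvgD; [exact: cf | exact: cg].
move=> [df Df] [dg Dg]; split=> [x Ux|v].
  by apply: differentiableD; [exact: df | exact: dg].
apply: (@Ck_eq _ _ _ (fun x => 'D_v f x + 'D_v g x)) => // [x Ux|]; last by apply: IH; [exact: Df | exact: Dg].
by rewrite -deriveD//; apply: diff_derivable; [exact: df | exact: dg].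
Qed.

Lemma differentiable_mx m n (f : X -> 'M[R]_(m, n)) x :
  (forall i j, differentiable (fun y => f y i j) x) -> differentiable f x.
Proof.
move=> df; rewrite (_ : f = \sum_(i < m) \sum_(j < n)
    (fun y => f y i j *: delta_mx i j)); last first.
  apply/funext => y; rewrite fct_sumE [LHS]matrix_sum_delta.
  by apply: eq_bigr => i _; rewrite fct_sumE.
apply: differentiable_sum => i; apply: differentiable_sum => j.
exact: differentiableZl.
Qed.

Lemma differentiable_entry m n (f : X -> 'M[R]_(m, n)) x i j :
  differentiable f x -> differentiable (fun y => f y i j) x.
Proof.
move=> df; apply: (@differentiable_comp _ _ _ _ f (fun N : 'M[R]_(m, n) => N i j)) => //.
exact: differentiable_coord.
Qed.

Lemma derive_entry m n (f : X -> 'M[R]_(m, n)) x v i j :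
  differentiable f x -> ('D_v f x) i j = 'D_v (fun y => f y i j) x.
Proof. by move=> df; rewrite derive_mx ?mxE//; exact: diff_derivable. Qed.

Lemma Ck_entry m n k (U : set X) (f : X -> 'M[R]_(m, n)) i j : open U ->
  Ck k U f -> Ck k U (fun x => f x i j).
Proof.
move=> oU; elim: k f => [|k IH] f.
  move=> cf x Ux; apply: (@continuous_comp _ _ _ f (fun N : 'M[R]_(m, n) => N i j)).
    exact: cf.
  exact: coord_continuous.
move=> [df Df]; split=> [x Ux|v]; first by apply: differentiable_entry; exact: df.
apply: (@Ck_eq _ _ _ (fun x => ('D_v f x) i j)) => // [x Ux|]; last by apply: IH; exact: Df.
by rewrite derive_entry//; exact: df.
Qed.

Lemma Ck_mx m n k (U : set X) (f : X -> 'M[R]_(m, n)) : open U ->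
  (forall i j, Ck k U (fun x => f x i j)) -> Ck k U f.
Proof.
move=> oU; elim: k f => [|k IH] f Cf.
  move=> x Ux; apply/cvgrPdist_le => /= e e0; near=> y.
  rewrite /Num.Def.normr/= mx_normrE (bigmax_le _ (ltW e0))//= => i _.
  rewrite !mxE/=; move: i; near: y; apply: filter_forall => /= i.
  exact: ((cvgrPdist_le _ _).1 (Cf i.1 i.2 x Ux)).
have df x : U x -> differentiable f x.
  by move=> Ux; apply: differentiable_mx => i j; exact: (Cf i j).1.
split=> // v; apply: IH => i j.
apply: (@Ck_eq _ _ _ ('D_v (fun y => f y i j))) => // [x Ux|].
  by rewrite derive_entry//; exact: df.
exact: (Cf i j).2.
Unshelve. all: by end_near. Qed.

Lemma Ck_mul k (U : set X) (f g : X -> R) : open U ->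
  Ck k U f -> Ck k U g -> Ck k U (fun x => f x * g x).
Proof.
move=> oU; elim: k f g => [|k IH] f g.
  by move=> cf cg x Ux; exact: (cvgM (cf x Ux) (cg x Ux)).
move=> Cf Cg; have [[df Df] [dg Dg]] := (Cf, Cg); split=> [x Ux|v].
  by apply: differentiableM; [exact: df | exact: dg].
apply: (@Ck_eq _ _ _ (fun x => f x * 'D_v g x + g x * 'D_v f x)) => // [x Ux|].
  by rewrite -[LHS]deriveM//; apply: diff_derivable; [exact: df | exact: dg].
by apply: Ck_add => //; (apply: IH; first exact: CkW); [exact: Dg|exact: Df].
Qed.

Lemma Ck_sum Y k (U : set X) (I : Type) (r : seq I) (f : I -> X -> Y) : open U ->
  (forall i, Ck k U (f i)) -> Ck k U (fun x => \sum_(i <- r) f i x).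
Proof.
move=> oU Cf; elim: r => [|i r IH].
  by apply: Ck_eq (Ck_cst k U 0) => // x _; rewrite big_nil.
apply: (@Ck_eq _ _ _ (fun x => f i x + \sum_(j <- r) f j x)) => // [x _|].
  by rewrite big_cons.
exact: Ck_add.
Qed.

Lemma Ck_mulmx m n p k (U : set X) (f : X -> 'M[R]_(m, n)) (g : X -> 'M[R]_(n, p)) :
  open U -> Ck k U f -> Ck k U g -> Ck k U (fun x => f x *m g x).
Proof.
move=> oU Cf Cg; apply: Ck_mx => // i j.
apply: (@Ck_eq _ _ _ (fun x => \sum_l (f x i l * g x l j))) => // [x _|].
  by rewrite mxE.
by apply: Ck_sum => // l; apply: Ck_mul => //; exact: Ck_entry.
Qed.

Lemma Ck_scale m n k (U : set X) (h : X -> R) (f : X -> 'M[R]_(m, n)) :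
  open U -> Ck k U h -> Ck k U f -> Ck k U (fun x => h x *: f x).
Proof.
move=> oU Ch Cf; apply: Ck_mx => // i j.
apply: (@Ck_eq _ _ _ (fun x => h x * f x i j)) => // [x _|]; first by rewrite mxE.
by apply: Ck_mul => //; exact: Ck_entry.
Qed.

Lemma Ck_opp Y k (U : set X) (f : X -> Y) : open U ->
  Ck k U f -> Ck k U (fun x => - f x).
Proof.
move=> oU; elim: k f => [|k IH] f.
  by move=> cf x Ux; apply: cvgN; exact: cf.
move=> [df Df]; split=> [x Ux|v]; first by apply: differentiableN; exact: df.
apply: (@Ck_eq _ _ _ (fun x => - 'D_v f x)) => // [x Ux|]; last by apply: IH; exact: Df.
by rewrite -deriveN//; apply: diff_derivable; exact: df.
Qed.

Lemma Ck_inv k (U : set X) (f : X -> R) : open U ->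
  (forall x, U x -> f x != 0) -> Ck k U f -> Ck k U (fun x => (f x)^-1).
Proof.
move=> oU f0; elim: k => [|k IH] Cf.
  by move=> x Ux; apply: cvgV; [exact: f0 | exact: Cf].
have [df Df] := Cf; split=> [x Ux|v].
  by apply: differentiableV; [exact: df | exact: f0].
apply: (@Ck_eq _ _ _ (fun x => - ((f x)^-1 * (f x)^-1 * 'D_v f x))) => // [x Ux|].
  rewrite [RHS](@deriveV _ _ f); [|exact: f0|by apply: diff_derivable; exact: df].
  by rewrite expr2 invfM scaleNr.
apply: Ck_opp => //; apply: Ck_mul => //; last exact: Df.
by apply: Ck_mul => //; apply: IH; exact: CkW.
Qed.

Lemma Ck_sqrt k (U : set X) (f : X -> R) : open U ->
  (forall x, U x -> 0 < f x) -> Ck k U f -> Ck k U (fun x => Num.sqrt (f x)).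
Proof.
move=> oU f0; elim: k => [|k IH] Cf.
  move=> x Ux; apply: (@continuous_comp _ _ _ f Num.sqrt); first exact: Cf.
  exact: sqrt_continuous.
have [df Df] := Cf.
have ds x : U x -> differentiable (Num.sqrt : R -> R) (f x).
  move=> Ux; apply/derivable1_diffP.
  by have [] := is_derive1_sqrt (f0 x Ux).
split=> [x Ux|v].
  by apply: (@differentiable_comp _ _ _ _ f Num.sqrt); [exact: df | exact: ds].
apply: (@Ck_eq _ _ _ (fun x => 'D_v f x * (2 * Num.sqrt (f x))^-1)) => // [x Ux|].
  rewrite [RHS](derive_comp v (df x Ux) (ds x Ux)).
  have := derive_linear (ds x Ux) ('D_v f x) 1 0.
  rewrite derive0 !addr0 derive_sqrt; last exact: f0.
  by rewrite [_ *: 1]mulr1 => ->.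
apply: Ck_mul => //; first exact: Df.
apply: Ck_inv => // [x Ux|]; first by rewrite mulf_neq0// gt_eqF// sqrtr_gt0; exact: f0.
by apply: Ck_mul => //; [exact: Ck_cst | apply: IH; exact: CkW].
Qed.

End Ck.

(** The chain rule in the plane expresses a derivative of a composition through
    the two partial derivatives; this is what makes smoothness of compositions
    an induction. *)
Section Plane.
Variables (R : realType) (X : normedModType R).
Local Notation P := 'rV[R]_2.

Lemma rV2_decomp (v : P) : v = v 0 0 *: du R + v 0 1 *: dv R.
Proof.
apply/rowP => j; rewrite !mxE; case: j => [[|[|//]] hj].
  by rewrite !eqxx/= mulr1 mulr0 addr0; congr (v _ _); exact: val_inj.
by rewrite !eqxx/= mulr0 mulr1 add0r; congr (v _ _); exact: val_inj.
Qed.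

Lemma derive_rV2 (Y : normedModType R) (f : P -> Y) x v : differentiable f x ->
  'D_v f x = v 0 0 *: 'D_(du R) f x + v 0 1 *: 'D_(dv R) f x.
Proof.
by move=> df; rewrite !deriveE// [in LHS](rV2_decomp v) linearD !linearZ.
Qed.

Lemma Ck_comp m n k (U : set X) (W : set P) (g : X -> P) (f : P -> 'M[R]_(m, n)) :
  open U -> open W -> (forall x, U x -> W (g x)) ->
  Ck k U g -> Ck k W f -> Ck k U (fun x => f (g x)).
Proof.
move=> oU oW UW; elim: k f => [|k IH] f Cg Cf.
  move=> x Ux; apply: (@continuous_comp _ _ _ g f); first exact: Cg.
  by apply: Cf; exact: UW.
have [[dg Dg] [df Df]] := (Cg, Cf).
split=> [x Ux|v].
  by apply: (@differentiable_comp _ _ _ _ g f); [exact: dg|exact/df/UW].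
apply: (@Ck_eq _ _ _ _ _ (fun x => ('D_v g x) 0 0 *: 'D_(du R) f (g x) +
    ('D_v g x) 0 1 *: 'D_(dv R) f (g x))) => // [x Ux|].
  rewrite [RHS](derive_comp v (dg x Ux) (df _ (UW _ Ux))).
  by rewrite -derive_rV2//; apply: df; exact: UW.
have Cg' := CkW Cg.
have Cgi i : Ck k U (fun x => ('D_v g x) 0 i) by apply: Ck_entry => //; exact: Dg.
apply: Ck_add => //; apply: Ck_scale => //.
  by apply: (IH ('D_(du R) f)) => //; exact: Df.
by apply: (IH ('D_(dv R) f)) => //; exact: Df.
Qed.

End Plane.

(** * Symmetry of second derivatives *)

Section Segments.
Variables (R : realType) (X : normedModType R).

Lemma differentiable_line (x v : X) (t : R) :
  differentiable (fun s : R => x + s *: v) t.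
Proof.
apply: (@differentiableD _ _ _ (cst x) (fun s : R => s *: v)) => //.
Qed.

Lemma derive_line (x v : X) (t : R) : 'D_1 (fun s : R => x + s *: v) t = v.
Proof.
rewrite (@deriveD _ _ _ (cst x) (fun s : R => s *: v)); last 2 first.
- exact: derivable_cst.
- exact: diff_derivable.
by rewrite derive_cst add0r deriveE// diff_val scale1r.
Qed.

Lemma derive_addc (x v c : X) : 'D_v (fun y : X => y + c) x = v.
Proof.
rewrite (@deriveD _ _ _ id (cst c)); [|exact: derivable_id|exact: derivable_cst].
by rewrite derive_id derive_cst addr0.
Qed.

Lemma is_derive_line (Y : normedModType R) (f : X -> Y) x v t :
  differentiable f (x + t *: v) ->
  is_derive t 1 (fun s : R => f (x + s *: v)) ('D_v f (x + t *: v)).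
Proof.
move=> df; have dl := differentiable_line x v t.
have dc := differentiable_comp dl df.
apply: DeriveDef; first exact: diff_derivable dc.
by rewrite (derive_comp (1 : R^o) dl df) derive_line.
Qed.

Lemma MVT_line (f : X -> R) (x v : X) (t : R) : 0 < t ->
  (forall s, s \in `[0, t] -> differentiable f (x + s *: v)) ->
  exists2 s, s \in `]0, t[ & f (x + t *: v) - f x = t * 'D_v f (x + s *: v).
Proof.
move=> t0 df; pose g (s : R) := f (x + s *: v).
have dg s : s \in `[0, t] -> is_derive s 1 g ('D_v f (x + s *: v)).
  by move=> st; apply: is_derive_line; exact: df.
have dg' s : s \in `]0, t[ -> is_derive s 1 g ('D_v f (x + s *: v)).
  by move=> st; apply: dg; exact: subset_itv_oo_cc st.
have cg : {within `[0, t], continuous g}.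
  by apply: derivable_within_continuous => s st; have [] := dg s st.
have [s st] := @MVT R g (fun s => 'D_v f (x + s *: v)) 0 t t0 dg' cg.
by rewrite /g scale0r addr0 subr0 mulrC => ->; exists s.
Qed.

End Segments.

(** Schwarz: the second difference of [f] over a small parallelogram is a value
    of either mixed derivative at a point of the parallelogram, so that the two
    continuous mixed derivatives agree in the limit. *)
Section Schwarz.
Variables (R : realType) (X : normedModType R).

Lemma second_difference (f : X -> R) (U : set X) x u v t : 0 < t ->
  (forall r s, r \in `[0, t] -> s \in `[0, t] -> U (x + r *: u + s *: v)) ->
  Ck 2 U f ->
  exists r s, [/\ r \in `[0, t], s \in `[0, t] &
    f (x + t *: u + t *: v) - f (x + t *: u) - f (x + t *: v) + f x =
    t * (t * 'D_v ('D_u f) (x + r *: u + s *: v))].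
Proof.
move=> t0 box [df Df].
have tt : t \in `[0, t] by rewrite in_itv/= lexx ltW.
have t00 : 0 \in `[0, t] by rewrite in_itv/= lexx ltW.
pose g y := f (y + t *: v) - f y.
have dft y : U (y + t *: v) -> U y -> differentiable g y.
  move=> Ut Uy; apply: differentiableB; last exact: df.
  apply: (@differentiable_comp _ _ _ _ (fun y => y + t *: v) f); last exact: df.
  exact: differentiableD.
have Dg y : U (y + t *: v) -> U y -> 'D_u g y = 'D_u f (y + t *: v) - 'D_u f y.
  move=> Ut Uy; have ds : differentiable (fun y => y + t *: v) y.
    exact: differentiableD.
  have dfs := differentiable_comp ds (df _ Ut).
  rewrite [LHS]deriveB; [|exact: diff_derivable|exact/diff_derivable/df].
  congr (_ - _); rewrite [LHS](derive_comp u ds (df _ Ut)).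
  by rewrite derive_addc.
have boxr r : r \in `[0, t] -> U (x + r *: u).
  by move=> rt; rewrite -[_ + _]addr0 -[X in _ + X](scale0r v); exact: box.
have [r|r rt Er] := @MVT_line _ _ g x u t t0.
  by move=> rt; apply: dft; [exact: box | exact: boxr].
have {}rt := subset_itv_oo_cc rt.
have [dfu _] := Df u.
have [s|s st Es] := @MVT_line _ _ ('D_u f) (x + r *: u) v t t0.
  by move=> st; apply: dfu; exact: box.
exists r, s; split=> //; first exact: subset_itv_oo_cc st.
rewrite -Es -Dg; [|exact: box|exact: boxr]; rewrite -Er /g.
by rewrite [LHS]addrAC opprB addrA.
Qed.

Lemma schwarz (f : X -> R) (U : set X) x u v : open U -> U x -> Ck 2 U f ->
  'D_v ('D_u f) x = 'D_u ('D_v f) x.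
Proof.
move=> oU Ux Cf; apply/eqP; rewrite -subr_eq0 -normr_le0; apply/ler_addgt0Pl => e e0.
rewrite addr0.
have [_ Df] := Cf.
have c1 : {for x, continuous ('D_v ('D_u f))} by have [_ Dfu] := Df u; exact: Dfu.
have c2 : {for x, continuous ('D_u ('D_v f))} by have [_ Dfv] := Df v; exact: Dfv.
have e2 : 0 < e / 2 by rewrite divr_gt0.
have H1 : nbhs x U := open_near oU Ux.
move/cvgrPdistC_le : c1 => /(_ _ e2) H2.
move/cvgrPdistC_le : c2 => /(_ _ e2) H3.
have [d /= d0 dP] := (nbhs_ballP _ _).1 (filterI (filterI H1 H2) H3).
pose k := `|u| + `|v| + 1; have k0 : 0 < k by rewrite ltr_wpDl// addr_ge0.
pose t := d / (2 * k); have t0 : 0 < t by rewrite divr_gt0// mulr_gt0.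
have box r s : r \in `[0, t] -> s \in `[0, t] -> ball x d (x + r *: u + s *: v).
  rewrite !in_itv/= => /andP[r0 rt] /andP[s0 st].
  rewrite -ball_normE/= opprD addrA opprD addrA subrr add0r -opprD normrN.
  apply: (@le_lt_trans _ _ (t * `|u| + t * `|v|)).
    rewrite (le_trans (ler_normD _ _))// !normrZ !ger0_norm//.
    by rewrite lerD// ler_wpM2r.
  rewrite -mulrDr (@lt_trans _ _ (t * k))//; first by rewrite ltr_pM2l// ltrDl.
  by rewrite /t invfM mulrA divfK ?gt_eqF// ltr_pdivrMr// ltr_pMr// ltr1n.
have boxU r s : r \in `[0, t] -> s \in `[0, t] -> U (x + r *: u + s *: v).
  by move=> rt st; have [[]] := dP _ (box r s rt st).
have boxU' r s : r \in `[0, t] -> s \in `[0, t] -> U (x + r *: v + s *: u).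
  by move=> rt st; rewrite addrAC; exact: boxU.
have [r [s [rt st E1]]] := second_difference t0 boxU Cf.
have [r' [s' [rt' st' E2]]] := second_difference t0 boxU' Cf.
have [[_ +] _] := dP _ (box r s rt st).
have [_] := dP _ (box s' r' st' rt').
move: E2; rewrite (addrAC x (t *: v)) (addrAC _ (- f (x + t *: v))) E1.
move=> /(mulfI (lt0r_neq0 t0))/(mulfI (lt0r_neq0 t0)) ->.
rewrite (addrAC x (s' *: u)) => {}H2 {}H1.
set a := 'D_v ('D_u f) x in H1 H2 *; set b := 'D_u ('D_v f) x in H1 H2 *.
set c := 'D_u _ _ in H1 H2.
clearbody a b c.
rewrite (_ : a - b = (c - b) - (c - a)); last by ring.
by rewrite (le_trans (ler_normB _ _))// [e]splitr lerD.
Qed.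

End Schwarz.

Lemma schwarz_mx (R : realType) (X : normedModType R) m n
  (f : X -> 'M[R]_(m, n)) (U : set X) x u v : open U -> U x -> Ck 2 U f ->
  'D_v ('D_u f) x = 'D_u ('D_v f) x.
Proof.
move=> oU Ux Cf; have [df Df] := Cf.
apply/matrixP => i j; have [[dfu _] [dfv _]] := (Df u, Df v).
have E w y : U y -> ('D_w f y) i j = 'D_w (fun z => f z i j) y.
  by move=> Uy; rewrite derive_entry//; exact: df.
have E2 w w' : ('D_w ('D_w' f) x) i j = 'D_w ('D_w' (fun z => f z i j)) x.
  have [dfw _] := Df w'; have dx := dfw x Ux.
  apply: etrans (derive_entry w i j dx) _.
  apply: near_eq_derive; apply: filterS (open_near oU Ux) => y Uy; exact: E.
apply: etrans (E2 v u) _; apply: etrans _ (esym (E2 u v)).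
exact: schwarz oU Ux (Ck_entry i j oU Cf).
Qed.

(** * The Poincare lemma in the plane *)

Section Primitive.
Variable R : realType.

Lemma primitive (f : R -> R) (a b c : R) : a < c < b ->
  (forall x, x \in `[a, b] -> {for x, continuous f}) ->
  exists F : R -> R, F c = 0 /\ forall x, x \in `]a, b[ -> is_derive x 1 F (f x).
Proof.
move=> /andP[ac cb] cf; have intf : lebesgue_measure.-integrable `[a, b] (EFin \o f).
  apply: continuous_compact_integrable; first exact: segment_compact.
  by apply: continuous_in_subspaceT => x /[!inE] xab; exact: cf.
pose F x := (\int[lebesgue_measure]_(t in `[a, x]) f t).
exists (fun x => F x - F c); split; first by rewrite subrr.
move=> x /[dup] xab; rewrite in_itv/= => /andP[ax xb].
have [dF FE] := continuous_FTC1_closed xb intf ax (cf x (subset_itv_oo_cc xab)).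
rewrite -[f x]subr0; apply: is_deriveB.
by apply: DeriveDef; [exact: dF | rewrite -derive1E].
Qed.

Lemma MVT_between (f df : R -> R) (a b : R) :
  (forall x, (a <= x <= b) || (b <= x <= a) -> is_derive x 1 f (df x)) ->
  exists2 c, (a <= c <= b) || (b <= c <= a) & f b - f a = df c * (b - a).
Proof.
move=> dff.
have aux (u v : R) : u <= v ->
    (forall x, u <= x <= v -> is_derive x 1 f (df x)) ->
    exists2 c, u <= c <= v & f v - f u = df c * (v - u).
  move=> uv duv; have d1 (x : R) : x \in `]u, v[ -> is_derive x 1 f (df x).
    by rewrite in_itv/= => /andP[ux xv]; apply: duv; rewrite !ltW.
  have cuv : {within `[u, v], continuous f}.
    by apply: derivable_within_continuous => x xuv; have [] := duv x xuv.
  have [c cuv' E] := MVT_segment uv d1 cuv.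
  by exists c => //; move: cuv'; rewrite in_itv.
have [ab|/ltW ba] := leP a b.
  have [x axb|c acb E] := aux a b ab; first by apply: dff; rewrite axb.
  by exists c => //; rewrite acb.
have [x axb|c acb E] := aux b a ba; first by apply: dff; rewrite axb orbT.
by exists c; [rewrite acb orbT | rewrite -opprB E -mulrN opprB].
Qed.

End Primitive.

Lemma dist_between (R : realDomainType) (p q s z w : R) :
  `|s - z| < w -> `|p - z| < w -> (s <= q <= p) || (p <= q <= s) -> `|q - z| < w.
Proof.
rewrite !ltr_norml => /andP[? ?] /andP[? ?] /orP[]/andP[? ?]; apply/andP; split; lra.
Qed.

Lemma dist_between_le (R : realDomainType) (x h s : R) :
  (x <= s <= x + h) || (x + h <= s <= x) -> `|s - x| <= `|h|.
Proof.
by have [h0|h0] := ger0P h; rewrite ler_norml => /orP[] /andP[s1 s2]; apply/andP; split; lra.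
Qed.

(** Integrating [a] along the horizontal line through the centre and then [b]
    vertically gives a potential [u].  That [u] has horizontal derivative [a]
    needs a derivative under the integral sign; here it follows from the mean
    value theorem, the remainder being controlled by the bound [M] on the second
    derivative [e] of [b]. *)
Section PoincareBox.
Variables (R : realType) (x0 y0 r M : R) (a b c e : R -> R -> R).
Hypothesis r0 : 0 < r.
Let box x y := `|x - x0| <= r /\ `|y - y0| <= r.
Hypothesis dxb : forall x y, box x y -> is_derive x 1 (b^~ y) (c x y).
Hypothesis dxc : forall x y, box x y -> is_derive x 1 (c^~ y) (e x y).
Hypothesis dya : forall x y, box x y -> is_derive y 1 (a x) (c x y).
Hypothesis eM : forall x y, box x y -> `|e x y| <= M.
Hypothesis cxa : forall x, `|x - x0| <= r -> {for x, continuous (a^~ y0)}.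
Hypothesis cyb : forall x y, box x y -> {for y, continuous (b x)}.
Hypothesis cb : forall x y, box x y -> forall eps, 0 < eps ->
  exists2 d, 0 < d & forall x' y', `|x' - x| < d -> `|y' - y| < d ->
    `|b x' y' - b x y| <= eps.

Lemma poincare_box : exists u : R -> R -> R, forall x y,
  `|x - x0| < r -> `|y - y0| < r -> forall eps, 0 < eps ->
  exists2 d, 0 < d & forall h k, `|h| < d -> `|k| < d ->
    `|u (x + h) (y + k) - u x y - (h * a x y + k * b x y)| <=
    eps * Num.max `|h| `|k|.
Proof.
have M0 : 0 <= M.
  by apply: le_trans (eM (x := x0) (y := y0) _); rewrite // /box !subrr normr0 !ltW.
have inI z w : (z \in `[w - r, w + r]) = (`|z - w| <= r).
  by rewrite in_itv/= ler_distl.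
have inIo z w : (z \in `]w - r, w + r[) = (`|z - w| < r).
  by rewrite in_itv/= ltr_distl.
have mid z : z - r < z < z + r by rewrite ltrBlDr ltrDl r0.
have [A [_ dA]] : exists F : R -> R, F x0 = 0 /\
    forall x, x \in `]x0 - r, x0 + r[ -> is_derive x 1 F (a x y0).
  by apply: primitive (mid x0) _ => x; rewrite inI; exact: cxa.
have exB x : exists F : R -> R, F y0 = 0 /\
    (`|x - x0| <= r -> forall y, `|y - y0| < r -> is_derive y 1 F (b x y)).
  have [xr|xr] := leP `|x - x0| r; last by exists (fun=> 0); split.
  have [y|F [F0 dF]] := primitive (f := b x) (mid y0).
    by rewrite inI => yr; exact: cyb.
  by exists F; split=> // _ y yr; apply: dF; rewrite inIo.
have [B BP] := choice exB; have B0 x : B x y0 = 0 := (BP x).1.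
have dB x y : `|x - x0| <= r -> `|y - y0| < r -> is_derive y 1 (B x) (b x y).
  by move=> xr yr; exact: (BP x).2.
exists (fun x y => A x + B x y) => x y xr yr eps eps0.
have e3 : 0 < eps / 3 by rewrite divr_gt0.
have y0r : `|y0 - y0| < r by rewrite subrr normr0.
have [d1 d10 H1] : exists2 d, 0 < d & forall h, `|h| < d ->
    `|A (x + h) - A x - h * a x y0| <= eps / 3 * `|h|.
  have dAx : is_derive x 1 A (a x y0) by apply: dA; rewrite inIo.
  have /diff_eps/(_ _ e3)/nbhs_ballP[d /= d0 dP] : differentiable A x.
    by apply/derivable1_diffP; have [] := dAx.
  exists d => // h hd; have /= := dP h.
  rewrite -ball_normE/= sub0r normrN => /(_ hd).
  have := derive_linear (f := A) (x := x) _ h 1 0.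
  rewrite derive0 !addr0 [_ *: 1]mulr1 => ->; last first.
    by apply/derivable1_diffP; have [] := dAx.
  by rewrite (@derive_val _ _ _ _ _ _ _ dAx) [h + x]addrC.
have [d3 d30 H3] := cb (conj (ltW xr) (ltW yr)) e3.
pose K := M * r + 1; have K0 : 0 < K by rewrite ltr_wpDl// mulr_ge0// ltW.
pose d := Num.min (Num.min d1 d3)
  (Num.min (eps / 3 / K) (Num.min (r - `|x - x0|) (r - `|y - y0|))).
exists d; first by rewrite !lt_min d10 d30 !divr_gt0//= !subr_gt0 xr yr.
move=> h k; rewrite !lt_min => /andP[/andP[hd1 hd3] /and3P[hdK hx _]].
move=> /andP[/andP[kd1 kd3] /and3P[_ _ ky]].
have xhr : `|x + h - x0| < r.
  rewrite addrAC (le_lt_trans (ler_normD _ _))//.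
  by rewrite -ltrBrDl.
have ykr : `|y + k - y0| < r.
  rewrite addrAC (le_lt_trans (ler_normD _ _))//.
  by rewrite -ltrBrDl.
have seg := @dist_between R.
(* the vertical increment *)
have T3 : `|B (x + h) (y + k) - B (x + h) y - k * b x y| <= eps / 3 * `|k|.
  have [q qP ->] := @MVT_between R (B (x + h)) (b (x + h)) y (y + k)
    (fun q qP => dB _ _ (ltW xhr) (seg _ _ _ _ _ yr ykr qP)).
  rewrite (_ : y + k - y = k); last by ring.
  rewrite [b (x + h) q * k]mulrC -mulrBr normrM mulrC ler_wpM2r//.
  apply: H3; first by rewrite addrAC subrr add0r.
  by apply: (seg (y + k) q y) => //; rewrite ?subrr ?normr0// addrAC subrr add0r.
(* the horizontal increment of the vertical part *)
pose phi q := B (x + h) q - B x q - h * (a x q - a x y0).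
have dphi q : `|q - y0| < r ->
    is_derive q 1 phi (b (x + h) q - b x q - h * (c x q - 0)).
  move=> qr; have hB1 := dB _ _ (ltW xhr) qr; have hB2 := dB _ _ (ltW xr) qr.
  have ha := dya (conj (ltW xr) (ltW qr)).
  apply: is_deriveB; apply: is_deriveZ.
have T2 : `|B (x + h) y - B x y - h * (a x y - a x y0)| <= eps / 3 * `|h|.
  have phi0 : phi y0 = 0 by rewrite /phi !B0 !subrr mulr0 subr0.
  have [q qP] := @MVT_between R phi _ y0 y
    (fun q qP => dphi q (seg _ _ _ _ _ y0r yr qP)).
  have qr := seg _ _ _ _ _ y0r yr qP.
  rewrite phi0 subr0 -/(phi y) => ->.
  have [s sP ->] := @MVT_between R (b^~ q) (c^~ q) x (x + h)
    (fun s sP => dxb (conj (ltW (seg _ _ _ _ _ xr xhr sP)) (ltW qr))).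
  have sr := seg _ _ _ _ _ xr xhr sP.
  rewrite (_ : x + h - x = h); last by ring.
  rewrite subr0 [c s q * h]mulrC -mulrBr.
  have [t tP ->] := @MVT_between R (c^~ q) (e^~ q) x s
    (fun t tP => dxc (conj (ltW (seg _ _ _ _ _ xr sr tP)) (ltW qr))).
  have tr := seg _ _ _ _ _ xr sr tP.
  have sh : `|s - x| <= `|h| := dist_between_le sP.
  rewrite !normrM.
  apply: (@le_trans _ _ (`|h| * (M * `|h|) * r)).
    rewrite ler_pM// ?mulr_ge0// ?(ltW yr)// ler_wpM2l// ler_pM// eM//.
    by split; exact: ltW.
  rewrite -mulrA mulrC ler_wpM2r// mulrAC (@le_trans _ _ (K * `|h|))//.
    by rewrite ler_wpM2r// lerDl.
  by rewrite mulrC -ler_pdivlMr// ltW.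
have -> : A (x + h) + B (x + h) (y + k) - (A x + B x y) - (h * a x y + k * b x y) =
  (A (x + h) - A x - h * a x y0) + (B (x + h) y - B x y - h * (a x y - a x y0)) +
  (B (x + h) (y + k) - B (x + h) y - k * b x y) by ring.
set mx := Num.max _ _.
have hm : `|h| <= mx by rewrite le_max lexx.
have km : `|k| <= mx by rewrite le_max lexx orbT.
rewrite (_ : eps = eps / 3 + eps / 3 + eps / 3); last by field.
rewrite !mulrDl; apply: le_trans (ler_normD _ _) _; apply: lerD.
  apply: le_trans (ler_normD _ _) _; apply: lerD.
  by apply: le_trans (H1 h hd1) _; rewrite ler_wpM2l// ltW.
  by apply: le_trans T2 _; rewrite ler_wpM2l// ltW.
by apply: le_trans T3 _; rewrite ler_wpM2l// ltW.
Qed.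

End PoincareBox.

Section PlanePoints.
Variable R : realType.
Local Notation P := 'rV[R]_2.

(** The order of the summands makes [pt] in its first argument, and up to commutativity
    in its second, a line in the form required by [is_derive_line]. *)
Definition pt (x y : R) : P := y *: dv R + x *: du R.

Lemma ptE0 x y : pt x y 0 0 = x.
Proof. by rewrite !mxE !eqxx/= mulr0 mulr1 add0r. Qed.

Lemma ptE1 x y : pt x y 0 1 = y.
Proof. by rewrite !mxE !eqxx/= mulr0 mulr1 addr0. Qed.

Lemma pt_eta (p : P) : pt (p 0 0) (p 0 1) = p.
Proof. by rewrite /pt addrC -rV2_decomp. Qed.

Lemma rV2_norm_lt (p : P) e : 0 < e -> (`|p| < e) = (`|p 0 0| < e) && (`|p 0 1| < e).
Proof.
move=> e0; rewrite [X in X < _]/Num.Def.normr/= mx_normrE; apply/idP/andP.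
  by move=> /bigmax_ltP[_ H]; split; exact: (H (0, _)).
move=> [H0 H1]; apply/bigmax_ltP; split=> // -[i j] _ /=; rewrite ord1.
case: j => [[|[|//]] hj]; first by rewrite (_ : Ordinal hj = 0)//; exact: val_inj.
by rewrite (_ : Ordinal hj = 1)//; exact: val_inj.
Qed.

Lemma rV2_norm (p : P) : `|p| = Num.max `|p 0 0| `|p 0 1|.
Proof.
have aux e : 0 < e -> (`|p| < e) = (Num.max `|p 0 0| `|p 0 1| < e).
  by move=> e0; rewrite rV2_norm_lt// gt_max.
apply/eqP; rewrite eq_le; apply/andP; split; rewrite leNgt; apply/negP => H.
  by have := H; rewrite -aux ?ltxx// (le_lt_trans _ H)// le_max normr_ge0.
by have := H; rewrite aux ?ltxx// (le_lt_trans _ H).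
Qed.

Lemma rV2_norm_le (p : P) e : (`|p| <= e) = (`|p 0 0| <= e) && (`|p 0 1| <= e).
Proof. by rewrite rV2_norm ge_max. Qed.

End PlanePoints.

Section Poincare.
Variable R : realType.
Local Notation P := 'rV[R]_2.

Lemma poincare (O : set P) p0 (a b : P -> R) : open O -> O p0 ->
  smooth_on O a -> smooth_on O b ->
  (forall p, O p -> 'D_(dv R) a p = 'D_(du R) b p) ->
  exists2 r, 0 < r & ball p0 r `<=` O /\ exists u : P -> R,
    forall p, ball p0 r p -> differentiable u p /\
      forall v, 'D_v u p = v 0 0 * a p + v 0 1 * b p.
Proof.
move=> oO Op0 sa sb ab; pose c := 'D_(du R) b; pose e := 'D_(du R) c.
have sc k : Ck k O c by have [_] := sb k.+1; exact.
have se k : Ck k O e by have [_] := sc k.+1; exact.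
have M1 : 0 < (1 : R) by [].
have ce : e p @[p --> p0] --> e p0 := se 0%N p0 Op0.
move/cvgrPdistC_le : ce => /(_ _ M1) He.
have Ho : nbhs p0 O := open_near oO Op0.
have [d /= d0 dP] := (nbhs_ballP _ _).1 (filterI Ho He).
pose M := `|e p0| + 1; pose r := d / 2; have r0 : 0 < r by rewrite divr_gt0.
have rd : r < d by rewrite /r ltr_pdivrMr// ltr_pMr// ltr1n.
pose x0 := p0 0 0; pose y0 := p0 0 1.
have inb x y s : 0 < s -> ball p0 s (pt x y) <-> `|x - x0| < s /\ `|y - y0| < s.
  move=> s0; rewrite -ball_normE/= rV2_norm_lt//.
  rewrite (_ : (p0 - pt x y) 0 0 = x0 - x); last by rewrite mxE mxE ptE0.
  rewrite (_ : (p0 - pt x y) 0 1 = y0 - y); last by rewrite mxE mxE ptE1.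
  by rewrite distrC (distrC y0); split=> [/andP|[-> ->]].
have boxO x y : `|x - x0| <= r /\ `|y - y0| <= r -> O (pt x y) /\ `|e (pt x y)| <= M.
  move=> [xr yr]; have /dP[Oxy exy] : ball p0 d (pt x y).
    by apply/inb => //; split; apply: le_lt_trans rd.
  split=> //; rewrite -[e _](subrK (e p0)) (le_trans (ler_normD _ _))//.
  by rewrite /M addrC lerD2l.
have dxP (f : P -> R) x y : differentiable f (pt x y) ->
    is_derive x 1 (fun x => f (pt x y)) ('D_(du R) f (pt x y)).
  exact: is_derive_line.
have dyP (f : P -> R) x y : differentiable f (pt x y) ->
    is_derive y 1 (fun y => f (pt x y)) ('D_(dv R) f (pt x y)).
  have ptC s : pt x s = x *: du R + s *: dv R by rewrite /pt addrC.
  rewrite (_ : (fun y => _) = fun s => f (x *: du R + s *: dv R)); last first.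
    by apply/funext => s; rewrite ptC.
  rewrite ptC; exact: is_derive_line.
have [da _] := sa 1%N; have [db _] := sb 1%N; have [dc _] := sc 1%N.
have ptC x y : {for x, continuous (fun x => pt x y)}.
  apply: differentiable_continuous; exact: differentiable_line.
have [x y xy|x y xy|x y xy|x y xy|x xr|x y xy|x y xy eps eps0|u uP] :=
  @poincare_box R x0 y0 r M (fun x y => a (pt x y)) (fun x y => b (pt x y))
    (fun x y => c (pt x y)) (fun x y => e (pt x y)) r0.
- by apply: dxP; apply: db; have [] := boxO _ _ xy.
- by apply: dxP; apply: dc; have [] := boxO _ _ xy.
- have [Oxy _] := boxO _ _ xy; have <- : 'D_(dv R) a (pt x y) = c (pt x y) := ab _ Oxy.
  exact: (dyP a x y (da _ Oxy)).
- by have [] := boxO _ _ xy.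
- have [|Oxy _] := boxO x y0; first by rewrite subrr normr0 (ltW r0).
  have [+ _] := dxP _ _ _ (da _ Oxy).
  by move=> /derivable1_diffP/differentiable_continuous.
- have [Oxy _] := boxO _ _ xy; have [+ _] := dyP _ _ _ (db _ Oxy).
  by move=> /derivable1_diffP/differentiable_continuous.
- have [Oxy _] := boxO _ _ xy.
  have cb : b p @[p --> pt x y] --> b (pt x y) := sb 0%N _ Oxy.
  move/cvgrPdistC_le : cb => /(_ _ eps0)/nbhs_ballP[t /= t0 tP].
  exists t => // x' y' xt yt; apply: tP; rewrite -ball_normE/= rV2_norm_lt//.
  rewrite (_ : (pt x y - pt x' y') 0 0 = x - x'); last by rewrite mxE ptE0 mxE ptE0.
  rewrite (_ : (pt x y - pt x' y') 0 1 = y - y'); last by rewrite mxE ptE1 mxE ptE1.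
  by rewrite distrC xt distrC yt.
exists r => //; split.
  move=> p; rewrite -(pt_eta p) => /inb-/(_ r0)[xr yr].
  by have [] := boxO (p 0 0) (p 0 1); rewrite ?(ltW xr) ?(ltW yr).
exists (fun p => u (p 0 0) (p 0 1)) => p; rewrite -(pt_eta p) => /inb-/(_ r0)[xr yr].
rewrite {}pt_eta.
have Llin : linear (fun h : P => h 0 0 * a p + h 0 1 * b p : R^o).
  by move=> k h h'; rewrite !mxE; rewrite /GRing.scale/=; ring.
pose Lm := GRing.isLinear.Build _ _ _ _ (fun h : P => h 0 0 * a p + h 0 1 * b p : R^o) Llin.
pose L : {linear P -> R^o} := HB.pack (fun h : P => h 0 0 * a p + h 0 1 * b p : R^o) Lm.
have Lc : continuous L.
  move=> h; exact: (cvgD (cvgM (@coord_continuous _ _ _ 0 0 h) (cvg_cst (a p)))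
    (cvgM (@coord_continuous _ _ _ 0 1 h) (cvg_cst (b p)))).
have [|du dE] := @diff_epsP R P R^o (fun p => u (p 0 0) (p 0 1)) p L Lc.
  move=> eps eps0; have [t t0 tP] := uP _ _ xr yr eps eps0.
  apply/nbhs_ballP; exists t => //= h; rewrite -ball_normE/= sub0r normrN.
  rewrite rV2_norm_lt// => /andP[h0 h1]; have := tP _ _ h0 h1.
  by rewrite pt_eta !mxE -rV2_norm addrC [p 0 1 + _]addrC.
by split=> // v; rewrite deriveE// dE.
Qed.

End Poincare.

(** * The inverse function theorem in the plane *)

Section InverseFunction.
Variable R : realType.
Local Notation P := 'rV[R]_2.

Lemma mulmxr_continuous m n p (A : 'M[R]_(n, p)) :
  continuous (mulmxr A : 'M[R]_(m, n) -> 'M[R]_(m, p)).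
Proof.
have C : Ck 0 setT (fun x : 'M[R]_(m, n) => x *m A).
  apply: Ck_mulmx; [exact: openT | by move=> x _; exact: cvg_id | exact: Ck_cst].
by move=> x; exact: (C x I).
Qed.

Lemma derive_mulmxr (X : normedModType R) m n p (A : 'M[R]_(n, p)) (f : X -> 'M[R]_(m, n)) x v :
  differentiable f x -> 'D_v (fun y => f y *m A) x = 'D_v f x *m A.
Proof.
move=> df; have dA := linear_differentiable (f x) (@mulmxr_continuous m n p A).
by apply: etrans (derive_comp v df dA) _; rewrite deriveE// diff_lin//; exact: mulmxr_continuous.
Qed.

Lemma rV2_entry_le n (v : 'rV[R]_n) i : `|v 0 i| <= `|v|.
Proof. by rewrite [leRHS]/Num.Def.normr/= mx_normrE; exact: (le_bigmax _ _ (0, i)). Qed.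

Lemma rV2_eq (v w : P) : v 0 0 = w 0 0 -> v 0 1 = w 0 1 -> v = w.
Proof. by move=> e0 e1; rewrite -(pt_eta v) -(pt_eta w) e0 e1. Qed.

(** The explicit solution shows that the derivative of a local inverse is as smooth as the
    inverse itself. *)
Lemma rV2_cramer (a b c v : P) (D := a 0 0 * b 0 1 - a 0 1 * b 0 0) :
  (forall w : P, w 0 0 *: a + w 0 1 *: b = 0 -> w = 0) ->
  c 0 0 *: a + c 0 1 *: b = v ->
  D != 0 /\ c = pt ((v 0 0 * b 0 1 - v 0 1 * b 0 0) / D)
                   ((a 0 0 * v 0 1 - a 0 1 * v 0 0) / D).
Proof.
move=> inj <-; have comb x y i : (x *: a + y *: b) 0 i = x * a 0 i + y * b 0 i.
  by rewrite !mxE.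
have D0 : D != 0.
  apply/eqP => D0; have w1 : pt (b 0 1) (- a 0 1) = 0.
    apply: inj; rewrite ptE0 ptE1; apply: rV2_eq; rewrite comb [RHS]mxE; last by ring.
    by rewrite -D0 /D; ring.
  have w0 : pt (b 0 0) (- a 0 0) = 0.
    apply: inj; rewrite ptE0 ptE1; apply: rV2_eq; rewrite comb [RHS]mxE; first by ring.
    by rewrite -[RHS]oppr0 -D0 /D; ring.
  have a0 : a = 0.
    apply: rV2_eq; rewrite [RHS]mxE; apply: oppr_inj; rewrite oppr0.
      by rewrite -(ptE1 (b 0 0) (- a 0 0)) w0 mxE.
    by rewrite -(ptE1 (b 0 1) (- a 0 1)) w1 mxE.
  have /rowP/(_ 0) : du R = 0.
    by apply: inj; rewrite a0 scaler0 add0r !mxE /= scale0r.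
  by rewrite !mxE !eqxx/= => /eqP; rewrite oner_eq0.
split=> //; apply: rV2_eq; rewrite ?ptE0 ?ptE1 !comb; apply: (mulIf D0);
  rewrite divfK// /D; ring.
Qed.

Section LocalInverse.
Variables (O : set P) (phi : P -> P) (p0 : P).
Hypotheses (oO : open O) (Op0 : O p0) (sphi : smooth_on O phi).
Hypothesis inj0 : forall v, 'D_v phi p0 = 0 -> v = 0.

Let dphi p : O p -> differentiable phi p.
Proof. by move=> Op; have [H _] := sphi 1; exact: H. Qed.

Let J := jacobian phi p0.
Let K := invmx J.

Let Junit : J \in unitmx.
Proof.
rewrite -row_free_unit; apply: inj_row_free => v vJ; apply: inj0.
by rewrite deriveEjacobian//; exact: dphi.
Qed.

Let g p := phi p *m K.

Let dg p : O p -> differentiable g p.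
Proof.
move=> Op; have [H _] := Ck_mulmx (k := 1) oO (sphi 1) (Ck_cst _ _ K); exact: H.
Qed.

Let Dg p v : O p -> 'D_v g p = 'D_v phi p *m K.
Proof. by move=> Op; apply: derive_mulmxr; exact: dphi. Qed.

(** Close to [p0] the map [g], which is [phi] followed by the inverse of its
    derivative at [p0], differs from the identity by a contraction. *)
Let near_id : exists r, [/\ 0 < r, ball p0 r `<=` O &
  forall p v, ball p0 r p -> `|'D_v g p - v| <= `|v| / 2].
Proof.
have e4 : 0 < 4^-1 :> R by rewrite invr_gt0.
have cD v : {for p0, continuous ('D_v g)}.
  have [_ H] := Ck_mulmx (k := 1) oO (sphi 1) (Ck_cst _ _ K); exact: (H v).
have D0 v : 'D_v g p0 = v.
  rewrite Dg// deriveEjacobian; last exact: dphi.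
  by rewrite -/J mulmxK.
have H1 : nbhs p0 O := open_near oO Op0.
have cu : 'D_(du R) g p @[p --> p0] --> 'D_(du R) g p0 := cD _.
have cv : 'D_(dv R) g p @[p --> p0] --> 'D_(dv R) g p0 := cD _.
move/cvgrPdistC_le : cu => /(_ _ e4); rewrite D0 => H2.
move/cvgrPdistC_le : cv => /(_ _ e4); rewrite D0 => H3.
have [r /= r0 rP] := (nbhs_ballP _ _).1 (filterI (filterI H1 H2) H3).
exists r; split=> // [p /rP[[]]//|p v /rP[[Op Hu] Hv]].
rewrite (derive_rV2 _ (dg Op)) [X in _ - X](rV2_decomp v).
set a := 'D_(du R) g p in Hu *; set b := 'D_(dv R) g p in Hv *.
rewrite (_ : _ - _ = v 0 0 *: (a - du R) + v 0 1 *: (b - dv R)); last first.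
  by rewrite !scalerBr opprD addrACA.
have [v0 v1] : `|v 0 0| <= `|v| /\ `|v 0 1| <= `|v|.
  by apply/andP; rewrite -rV2_norm_le.
apply: le_trans (ler_normD _ _) _; rewrite !normrZ.
rewrite (_ : `|v| / 2 = `|v| * 4^-1 + `|v| * 4^-1); last by field.
by apply: lerD; apply: ler_pM.
Qed.

Section Ball.
Variable r : R.
Hypotheses (r0 : 0 < r) (WO : ball p0 r `<=` O).
Hypothesis gid : forall p v, ball p0 r p -> `|'D_v g p - v| <= `|v| / 2.
Local Notation W := (ball p0 r).

Let ball_segment p q s : W p -> W q -> s \in `[0, 1] -> W (q + s *: (p - q)).
Proof.
rewrite -ball_normE/= in_itv/= => Wp Wq /andP[s0 s1].
rewrite (_ : p0 - _ = (1 - s) *: (p0 - q) + s *: (p0 - p)); last first.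
  by apply/rowP => i; rewrite !mxE; ring.
apply: le_lt_trans (ler_normD _ _) _; rewrite !normrZ !ger0_norm ?subr_ge0//.
have [->|sn0] := eqVneq s 0; first by rewrite subr0 mul0r addr0 mul1r.
have sp : 0 < s by rewrite lt_neqAle eq_sym sn0.
rewrite (_ : r = (1 - s) * r + s * r); last by ring.
by apply: ler_ltD; [rewrite ler_wpM2l ?subr_ge0// ltW | rewrite ltr_pM2l].
Qed.

Let lip p q : W p -> W q -> `|(g p - p) - (g q - q)| <= `|p - q| / 2.
Proof.
move=> Wp Wq; rewrite rV2_norm_le.
have aux i : `|((g p - p) - (g q - q)) 0 i| <= `|p - q| / 2.
  pose f y := (g y - y) 0 i.
  have df y : W y -> differentiable f y.
    move=> /WO Oy; apply: differentiable_entry; apply: differentiableB => //.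
    exact: dg.
  have [s|s s01 E] := @MVT_line R P f q (p - q) 1 ltr01.
    by move=> s01; apply: df; exact: ball_segment.
  move: E; rewrite scale1r [q + (p - q)]addrC subrK mul1r => E.
  rewrite [X in `|X|](_ : _ = f p - f q); last by rewrite /f mxE [X in _ + X]mxE.
  rewrite E; set c := q + _.
  have Wc : W c by apply: ball_segment => //; exact: subset_itv_oo_cc s01.
  have dgc : differentiable (fun y => g y - y) c.
    by apply: differentiableB => //; apply: dg; exact: WO.
  rewrite /f -derive_entry//.
  have -> : 'D_(p - q) (fun y => g y - y) c = 'D_(p - q) g c - (p - q).
    rewrite [LHS](@deriveB _ _ _ g id).
    - by rewrite derive_id.
    - by apply: diff_derivable; apply: dg; exact: WO.
    - exact: derivable_id.
  apply: le_trans (gid (p - q) Wc).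
  exact: rV2_entry_le.
by rewrite !aux.
Qed.

Let expand p q : W p -> W q -> `|p - q| <= 2 * `|g p - g q|.
Proof.
move=> Wp Wq; have := lip Wp Wq.
rewrite (_ : g p - p - _ = (g p - g q) - (p - q)); last first.
  by apply/rowP => i; rewrite !mxE; ring.
move=> H; have : `|p - q| <= `|g p - g q| + `|p - q| / 2.
  rewrite -{1}(subKr (g p - g q) (p - q)) (le_trans (ler_normB _ _))//.
  by rewrite lerD2l.
lra.
Qed.

Let ginj p q : W p -> W q -> g p = g q -> p = q.
Proof.
move=> Wp Wq gpq; have := expand Wp Wq; rewrite gpq subrr normr0 mulr0.
by rewrite normr_le0 subr_eq0 => /eqP.
Qed.

(** Surjectivity onto a neighbourhood: the fixed point of [p - g p + z]. *)
Let gopen p : W p -> exists2 e, 0 < e & forall z, `|z - g p| < e -> exists2 q, W q & g q = z.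
Proof.
move=> Wp; have Wo : open W by exact: ball_open.
have /nbhs_ballP[d /= d0 dW] : nbhs p W := open_near Wo Wp.
pose e := d / 2; have e0 : 0 < e by rewrite divr_gt0.
pose U := [set q : P | `|p - q| <= e].
have UW : U `<=` W.
  move=> q Uq; apply: dW; rewrite -ball_normE/= (le_lt_trans Uq)//.
  by rewrite /e ltr_pdivrMr// ltr_pMr// ltr1n.
exists (e / 2); first by rewrite divr_gt0.
move=> z zp; pose T q := q - g q + z.
have lipT q q' : U q -> U q' -> `|T q - T q'| <= 2^-1 * `|q - q'|.
  move=> /UW Wq /UW Wq'; rewrite mulrC; apply: le_trans (lip Wq Wq').
  rewrite -normrN (_ : - (T q - T q') = (g q - q) - (g q' - q'))//.
  by rewrite /T; apply/rowP => i; rewrite !mxE; ring.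
have TU : {homo T : q / U q >-> U q}.
  move=> q Uq; rewrite /U/= distrC.
  have Up : U p by rewrite /U/= subrr normr0 ltW.
  rewrite (_ : T q - p = (T q - T p) + (z - g p)); last first.
    by rewrite /T; apply/rowP => i; rewrite !mxE; ring.
  rewrite (le_trans (ler_normD _ _))// [leRHS]splitr lerD ?(ltW zp)//.
  apply: le_trans (lipT _ _ Uq Up) _; rewrite mulrC ler_pM2r ?invr_gt0//.
  by rewrite distrC; exact: Uq.
pose PC : completeNormedModType R := HB.pack_for (completeNormedModType R) P.
have q2 : 0 <= 2^-1 :> R by [].
have [q Uq Tq] : exists2 q : PC, U q & q = mkfun TU q.
  apply: (@banach_fixed_point R PC U (mkfun_fun TU)).
  - exists (NngNum q2); split=> /=; first by rewrite invf_lt1// ltr1n.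
    by move=> [x y] [/= Ux Uy]; exact: lipT.
  - exact: (@closed_closed_ball_ R P p e).
  - by exists p; rewrite /U/= subrr normr0 ltW.
exists q; first exact: UW.
have {}Tq : (q : P) - g q + z = q := esym Tq.
apply/esym/eqP; rewrite -subr_eq0; apply/eqP.
transitivity ((q : P) - g q + z - q); last by rewrite Tq subrr.
by apply/rowP => i; rewrite !mxE; ring.
Qed.

Let psi z : P := xget p0 [set p | W p /\ phi p = z].

Let phig p : phi p = g p *m J. Proof. by rewrite /g mulmxKV. Qed.

Let psiK p : W p -> psi (phi p) = p.
Proof.
move=> Wp; have [Wq E] := xgetPex (P := [set q | W q /\ phi q = phi p]) p0
  (ex_intro _ p (conj Wp erefl)).
by apply: ginj => //; rewrite /g E.
Qed.

Let img_open : open (phi @` W).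
Proof.
rewrite openE => _ [p Wp <-]; have [e e0 eP] := gopen Wp.
have cK := @mulmxr_continuous 1 2 2 K (phi p).
have /cvgrPdistC_lt/(_ _ e0) H : mulmxr K z @[z --> phi p] --> mulmxr K (phi p) by [].
apply: filterS H => z /= /eP[q Wq E]; exists q => //.
by rewrite phig E mulmxKV.
Qed.

Let psi_lip : exists2 C, 0 < C & forall z z', (phi @` W) z -> (phi @` W) z' ->
  `|psi z - psi z'| <= C * `|z - z'|.
Proof.
have [k k0 kP] := linear_lipschitz (@mulmxr_continuous 1 2 2 K).
exists (2 * k) => [|_ _ [p Wp <-] [q Wq <-]]; first by rewrite mulr_gt0.
rewrite !psiK// (le_trans (expand Wp Wq))// -mulrA ler_pM2l//.
by rewrite /g -mulmxBl; exact: kP.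
Qed.

Let injW p : W p -> forall v, 'D_v phi p = 0 -> v = 0.
Proof.
move=> Wp v v0; have := gid v Wp; rewrite Dg; last exact: WO.
rewrite v0 mul0mx sub0r normrN => H; apply/eqP; rewrite -normr_le0; lra.
Qed.

Let psi_diff z : (phi @` W) z -> differentiable psi z.
Proof.
move=> [p Wp <-]; pose Jp := jacobian phi p; have dp := dphi (WO Wp).
have Ju : Jp \in unitmx.
  rewrite -row_free_unit; apply: inj_row_free => v vJ; apply: (injW Wp).
  by rewrite deriveEjacobian.
have Lc := @mulmxr_continuous 1 2 2 (invmx Jp).
have [k k0 kP] := linear_lipschitz Lc.
have [C C0 CP] := psi_lip.
suff [] : differentiable psi (phi p) /\ 'd psi (phi p) = mulmxr (invmx Jp) :> (P -> P) by [].
apply: diff_epsP => // e e0.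
pose e' := e / (k * C); have e'0 : 0 < e' by rewrite divr_gt0// mulr_gt0.
have /nbhs_ballP[d /= d0 dP] := diff_eps dp e'0.
have dC : 0 < d / C by rewrite divr_gt0.
have H1 : \forall h \near (0 : P), (phi @` W) (h + phi p).
  by apply: near_shift0; apply: open_near => //; exists p.
have H2 : \forall h \near (0 : P), `|h| < d / C.
  by apply/nbhs_ballP; exists (d / C) => //= h; rewrite -ball_normE/= sub0r normrN.
apply: filterS2 H1 H2 => h Vh hd.
have Vp : (phi @` W) (phi p) by exists p.
have := CP _ _ Vh Vp; rewrite addrK psiK//.
have [q Wq qE] := Vh; rewrite -qE psiK// => qp.
have hE : phi q - phi p = h by rewrite qE addrK.
have := dP (q - p); rewrite -ball_normE/= sub0r normrN subrK => /(_ _)/=.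
move=> /(_ (le_lt_trans qp _)); rewrite mulrC -ltr_pdivlMr// => /(_ hd).
rewrite deriveEjacobian// hE -/Jp => H3.
rewrite (_ : _ - _ = - ((h - (q - p) *m Jp) *m invmx Jp)); last first.
  by rewrite mulmxBl mulmxK// opprB.
rewrite normrN (le_trans (kP _))// (@le_trans _ _ (k * (e' * (C * `|h|))))//.
  by rewrite ler_pM2l// (le_trans H3)// ler_pM2l.
rewrite /e' (_ : k * _ = e * `|h|)//; field.
by rewrite !gt_eqF.
Qed.

(** Cramer's rule for the derivative of the local inverse. *)
Let cramer z v : (phi @` W) z ->
  let a := 'D_(du R) phi (psi z) in let b := 'D_(dv R) phi (psi z) in
  let D := a 0 0 * b 0 1 - a 0 1 * b 0 0 in
  D != 0 /\ 'D_v psi z = pt ((v 0 0 * b 0 1 - v 0 1 * b 0 0) / D)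
                           ((a 0 0 * v 0 1 - a 0 1 * v 0 0) / D).
Proof.
move=> Vz; have [p Wp zp] := Vz; rewrite -zp psiK//= zp.
have dp := dphi (WO Wp).
have ab w : 'D_w phi p = w 0 0 *: 'D_(du R) phi p + w 0 1 *: 'D_(dv R) phi p.
  exact: derive_rV2.
apply: rV2_cramer => [w /esym|]; first by rewrite -ab => /esym; exact: injW.
have dpz : differentiable phi (psi z) by rewrite -zp psiK.
have := derive_comp v (psi_diff Vz) dpz; rewrite -{2}zp psiK// ab => <-.
rewrite -[RHS](derive_id z v); apply: near_eq_derive.
apply: filterS (open_near img_open Vz) => _ [q Wq <-].
by rewrite /= psiK.
Qed.

Lemma local_inverse : exists U psi,
  [/\ [/\ open U, U p0 & U `<=` O], open (phi @` U),
    forall p, U p -> psi (phi p) = p & smooth_on (phi @` U) psi].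
Proof.
exists W, psi; split=> //.
  by split=> //; [exact: ball_open | exact: ballxx].
have Wo : open W by exact: ball_open.
have VW z : (phi @` W) z -> W (psi z) by move=> [p Wp <-]; rewrite psiK.
elim=> [|k IH].
  by move=> z Vz; apply: differentiable_continuous; exact: psi_diff.
split=> [z|v]; first exact: psi_diff.
have Ca w i : Ck k W (fun p => ('D_w phi p) 0 i).
  by apply: Ck_entry => //; apply: Ck_sub WO _; have [_] := sphi k.+1; exact.
pose D p := 'D_(du R) phi p 0 0 * 'D_(dv R) phi p 0 1 -
            'D_(du R) phi p 0 1 * 'D_(dv R) phi p 0 0.
pose A p := ('D_(dv R) phi p 0 1 * v 0 0 - 'D_(dv R) phi p 0 0 * v 0 1) / D p.
pose B p := ('D_(du R) phi p 0 0 * v 0 1 - 'D_(du R) phi p 0 1 * v 0 0) / D p.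
have CD : Ck k W (fun p => (D p)^-1).
  apply: Ck_inv => //.
    move=> p Wp; have [|+ _] := @cramer (phi p) 0; first by exists p.
    by rewrite psiK.
  by apply: Ck_add => //; [|apply: Ck_opp => //]; apply: Ck_mul.
have Cc w c i : Ck k W (fun p => 'D_w phi p 0 i * c).
  by apply: Ck_mul => //; exact: Ck_cst.
have CA : Ck k W A.
  by apply: Ck_mul => //; apply: Ck_add => //; apply: Ck_opp.
have CB : Ck k W B.
  by apply: Ck_mul => //; apply: Ck_add => //; apply: Ck_opp.
apply: (@Ck_eq _ _ _ _ _ (fun z => pt (A (psi z)) (B (psi z)))) => // [z Vz|].
  have [_ ->] := cramer v Vz; congr (pt (_ / _) _).
  by rewrite mulrC; congr (_ - _); rewrite mulrC.
apply: (Ck_comp (f := fun p => pt (A p) (B p)) img_open Wo VW IH).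
by apply: Ck_add => //; apply: Ck_scale => //; exact: Ck_cst.
Qed.

End Ball.

Lemma inverse_function : exists U psi,
  [/\ [/\ open U, U p0 & U `<=` O], open (phi @` U),
    forall p, U p -> psi (phi p) = p & smooth_on (phi @` U) psi].
Proof. by have [r [r0 WO gid]] := near_id; exact: local_inverse r0 WO gid. Qed.

End LocalInverse.
End InverseFunction.

(** * Light-like frames in Lorentzian space *)

Lemma memv_sum3P (K : fieldType) (V : vectType K) (a b c z : V) :
  reflect (exists x y t, z = x *: a + y *: b + t *: c) (z \in <[a]> + <[b]> + <[c]>)%VS.
Proof.
apply: (iffP memv_addP) => [[ab /memv_addP[_ /vlineP[x ->] [_ /vlineP[y ->] ->]] [_ /vlineP[t ->] ->]]|].
  by exists x, y, t.
move=> [x [y [t ->]]]; exists (x *: a + y *: b); last first.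
  by exists (t *: c) => //; exact/memvZ/memv_line.
by apply: memv_add; exact/memvZ/memv_line.
Qed.

Lemma dimv3_free (K : fieldType) (V : vectType K) (a b c : V) :
  \dim (<[a]> + <[b]> + <[c]>)%VS = 3 ->
  forall x y t, x *: a + y *: b + t *: c = 0 -> [/\ x = 0, y = 0 & t = 0].
Proof.
move=> d3; have /freeP fr : free [tuple a; b; c].
  by rewrite /free/= !span_cons span_nil addv0 addvA d3.
move=> x y t E; have := fr (fun i => nth 0 [:: x; y; t] i).
rewrite !big_ord_recl big_ord0/= addr0 addrA => /(_ E) H.
by have := (H 0, H 1, H (inord 2)); rewrite inordK//= => -[[]].
Qed.

Section Ip.
Variables (R : realType) (n : nat) (G : 'M[R]_n.+2).
Local Notation V := 'rV[R]_n.+2.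
Implicit Types u v w z : V.

Lemma ipDl u v w : ip G (u + v) w = ip G u w + ip G v w.
Proof. by rewrite /ip !mulmxDl mxE. Qed.

Lemma ipDr u v w : ip G w (u + v) = ip G w u + ip G w v.
Proof. by rewrite /ip linearD mulmxDr mxE. Qed.

Lemma ipZl a u w : ip G (a *: u) w = a * ip G u w.
Proof. by rewrite /ip -!scalemxAl mxE. Qed.

Lemma ipZr a u w : ip G w (a *: u) = a * ip G w u.
Proof. by rewrite /ip linearZ -scalemxAr mxE. Qed.

Lemma ip0l w : ip G 0 w = 0. Proof. by rewrite /ip !mul0mx mxE. Qed.

Lemma ip0r w : ip G w 0 = 0. Proof. by rewrite /ip linear0 mulmx0 mxE. Qed.

Lemma ipNl u w : ip G (- u) w = - ip G u w.
Proof. by rewrite -scaleN1r ipZl mulN1r. Qed.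

Lemma ipNr u w : ip G w (- u) = - ip G w u.
Proof. by rewrite -scaleN1r ipZr mulN1r. Qed.

Lemma ip_suml I (r : seq I) (P : pred I) (F : I -> V) w :
  ip G (\sum_(i <- r | P i) F i) w = \sum_(i <- r | P i) ip G (F i) w.
Proof. by elim/big_rec2: _ => [|i x y _ <-]; rewrite ?ip0l// ipDl. Qed.

Lemma ip_sumr I (r : seq I) (P : pred I) (F : I -> V) w :
  ip G w (\sum_(i <- r | P i) F i) = \sum_(i <- r | P i) ip G w (F i).
Proof. by elim/big_rec2: _ => [|i x y _ <-]; rewrite ?ip0r// ipDr. Qed.

End Ip.

Definition ipE := (ipDl, ipDr, ipZl, ipZr, ipNl, ipNr, ip0l, ip0r).

Section Lorentz.
Variables (R : realType) (n : nat) (G : 'M[R]_n.+2).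
Hypothesis hG : lorentzian G.
Local Notation V := 'rV[R]_n.+2.
Local Notation "<< u , v >>" := (ip G u v).
Implicit Types u v w z : V.

Lemma ipC u v : <<u, v>> = <<v, u>>.
Proof.
rewrite /ip; transitivity ((u *m G *m v^T)^T 0 0); first by rewrite [RHS]mxE.
by rewrite !trmx_mul trmxK hG.1 mulmxA.
Qed.

Lemma wedge_act u v w : w *m wedge G u v = <<u, w>> *: v - <<v, w>> *: u.
Proof. exact/wedgeE/hG.1. Qed.

(** A time coordinate: on its kernel the inner product is positive definite. *)
Lemma lorentz_time : exists tau : V -> R,
  (forall a u v, tau (a *: u + v) = a * tau u + tau v) /\
  forall v, tau v = 0 -> 0 <= <<v, v>> /\ (<<v, v>> = 0 -> v = 0).
Proof.
have [_ [e [be ee]]] := hG; pose c i v : R := coord e i v.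
exists (c ord_max); split=> [a u v|v v0]; first by rewrite /c linearP.
have dv : v = \sum_i c i v *: tnth e i.
  rewrite {1}(coord_basis be (memvf v)); apply: eq_bigr => i _.
  by congr (_ *: _); rewrite (tnth_nth 0 e i).
have vv : <<v, v>> = \sum_i c i v ^+ 2.
  rewrite {1 2}dv ip_suml; apply: eq_bigr => i _.
  rewrite ip_sumr (bigD1 i)//= big1 ?addr0 => [|j ji]; last first.
    by rewrite ipZl ipZr ee eq_sym (negPf ji) !mulr0.
  rewrite ipZl ipZr ee eqxx; case: ifPn => [_|]; first by rewrite mulr1 expr2.
  rewrite -leqNgt => ni; suff -> : c i v = 0 by rewrite !mul0r expr0n.
  rewrite -v0; congr (c _ _); apply: val_inj.
  have -> : val i = n.+1 by have := ltn_ord i; move: ni => /=; lia.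
  by rewrite -[RHS]/(n + 1)%N addn1.
have p0 i : 0 <= c i v ^+ 2 by exact: sqr_ge0.
rewrite vv; split; first exact: sumr_ge0.
move=> s0; rewrite dv big1// => i _.
have /eqP := (psumr_eq0P (fun i _ => p0 i) s0) i isT.
by rewrite sqrf_eq0 => /eqP ->; rewrite scale0r.
Qed.

(** Subtract from [v] the multiple of [F] with the same time coordinate: this does not
    change the square of [v], and what is left is in the positive definite kernel. *)
Lemma perp_null F v : F != 0 -> <<F, F>> = 0 -> <<F, v>> = 0 ->
  0 <= <<v, v>> /\ (<<v, v>> = 0 -> v \in <[F]>%VS).
Proof.
move=> F0 FF Fv; have [tau [tlin tpos]] := lorentz_time.
have tF : tau F != 0.
  by apply: contra F0 => /eqP /tpos[_ /(_ FF)] ->.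
pose k := tau v / tau F; pose v' := - k *: F + v.
have t0 : tau v' = 0 by rewrite /v' tlin /k mulNr divfK// addNr.
have E : <<v', v'>> = <<v, v>>.
  by rewrite /v' !ipE FF Fv ipC Fv !mulr0 !add0r.
have [p z] := tpos _ t0; rewrite -E; split=> // /z v'0.
apply/vlineP; exists k; apply/eqP; rewrite -subr_eq0 addrC -scaleNr.
by rewrite -/v' v'0.
Qed.

Lemma null_not_perp F F' : F != 0 -> <<F, F>> = 0 -> <<F', F'>> = 0 ->
  F' \notin <[F]>%VS -> <<F, F'>> != 0.
Proof.
by move=> F0 FF F'F'; apply: contra => /eqP /(perp_null F0 FF)[_]; exact.
Qed.

(** A light-like vector together with two vectors orthogonal to it: the value of a
    lift of an immersion and of its partial derivatives. *)
Definition frame F a b : Prop :=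
  [/\ <<F, F>> = 0, <<F, a>> = 0, <<F, b>> = 0 &
    forall x y t, x *: F + y *: a + t *: b = 0 -> [/\ x = 0, y = 0 & t = 0]].

Section Frame.
Variables F a b : V.
Hypothesis fr : frame F a b.

Lemma frame_neq0 : F != 0.
Proof.
have [_ _ _ free] := fr; apply/eqP => F0.
have [] := free 1 0 0; first by rewrite F0 !scale0r scaler0 !addr0.
by move/eqP; rewrite oner_eq0.
Qed.

Lemma frame_perpP z : z \in perp G (<[F]> + <[a]> + <[b]>) <->
  [/\ <<F, z>> = 0, <<a, z>> = 0 & <<b, z>> = 0].
Proof.
split=> [/memv_perp H|[H0 H1 H2]].
  split; apply: H; apply/memv_sum3P.
  - by exists 1, 0, 0; rewrite scale1r !scale0r !addr0.
  - by exists 0, 1, 0; rewrite scale1r !scale0r add0r addr0.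
  - by exists 0, 0, 1; rewrite scale1r !scale0r !add0r.
apply/memv_perp => _ /memv_sum3P[x [y [t ->]]].
by rewrite !ipE H0 H1 H2 !mulr0 !addr0.
Qed.

(** The induced metric is positive definite. *)
Lemma frame_pos y t : (y, t) != (0, 0) -> 0 < <<y *: a + t *: b, y *: a + t *: b>>.
Proof.
have [FF Fa Fb free] := fr => yt; set w := _ + _.
have Fw : <<F, w>> = 0 by rewrite /w !ipE Fa Fb !mulr0 addr0.
have [p z] := perp_null frame_neq0 FF Fw.
rewrite lt_neqAle p andbT; apply: contra yt => /eqP/esym/z/vlineP[k wk].
have [|_ -> ->] := free (- k) y t; last by rewrite eqxx.
by rewrite -addrA -/w wk scaleNr addNr.
Qed.

Lemma frame_pos1 : 0 < <<a, a>>.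
Proof.
have := @frame_pos 1 0; rewrite scale1r scale0r addr0; apply.
by rewrite xpair_eqE oner_eq0.
Qed.

Lemma frame_det : 0 < <<a, a>> * <<b, b>> - <<a, b>> ^+ 2.
Proof.
have := @frame_pos (- <<a, b>>) <<a, a>>.
rewrite xpair_eqE (gt_eqF frame_pos1) andbF => /(_ isT).
rewrite !ipE (ipC b a) => H; rewrite -(pmulr_rgt0 _ frame_pos1).
by apply: lt_le_trans H _; rewrite le_eqVlt; apply/orP; left; apply/eqP; ring.
Qed.

Lemma frame_line z : z \in (<[F]> + <[a]> + <[b]>)%VS ->
  <<a, z>> = 0 -> <<b, z>> = 0 -> z \in <[F]>%VS.
Proof.
have [FF Fa Fb free] := fr; move=> /memv_sum3P[x [y [t ->]]].
rewrite -addrA; set w := y *: _ + _.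
rewrite !(ipDr _ (x *: F)) !ipZr (ipC a F) (ipC b F) Fa Fb !mulr0 !add0r => H1 H2.
have : <<w, w>> = 0 by rewrite {1}/w ipDl !ipZl H1 H2 !mulr0 addr0.
have [[y0 t0]|/frame_pos/gt_eqF] := eqVneq (y, t) (0, 0); last by rewrite -/w => + ww; rewrite ww eqxx.
by rewrite /w y0 t0 !scale0r !addr0 memvZ// memv_line.
Qed.

Lemma frame_projection z : exists y t,
  <<a, z - (y *: a + t *: b)>> = 0 /\ <<b, z - (y *: a + t *: b)>> = 0.
Proof.
have := lt0r_neq0 frame_det; set g11 := <<a, a>>; set g12 := <<a, b>>; set g22 := <<b, b>>.
move=> D0; exists ((g22 * <<a, z>> - g12 * <<b, z>>) / (g11 * g22 - g12 ^+ 2)).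
exists ((g11 * <<b, z>> - g12 * <<a, z>>) / (g11 * g22 - g12 ^+ 2)).
by rewrite !ipE (ipC b a) -/g11 -/g12 -/g22; split; field.
Qed.

(** The component of [z] orthogonal to [a] and [b] is orthogonal to [z], hence to itself, and
    to [F]: it is a multiple of [F]. *)
Lemma frame_perp_perp z : <<F, z>> = 0 ->
  (forall y, y \in perp G (<[F]> + <[a]> + <[b]>) -> <<y, z>> = 0) ->
  z \in (<[F]> + <[a]> + <[b]>)%VS.
Proof.
have [FF Fa Fb free] := fr => Fz zperp; have [y [t [H1 H2]]] := frame_projection z.
set z' := z - _ in H1 H2.
have Fz' : <<F, z'>> = 0 by rewrite /z' !ipE Fz Fa Fb !mulr0 addr0 subr0.
have z'z : <<z', z>> = 0 by apply: zperp; apply/frame_perpP.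
have z'z' : <<z', z'>> = 0.
  by rewrite {2}/z' ipDr ipNr ipDr !ipZr z'z (ipC z' a) (ipC z' b) H1 H2 !mulr0 addr0 subr0.
have [_ /(_ z'z')/vlineP[k z'k]] := perp_null frame_neq0 FF Fz'.
apply/memv_sum3P; exists k, y, t.
by rewrite -addrA -z'k /z' subrK.
Qed.

End Frame.

End Lorentz.

(** * Smooth maps on a surface *)

Section DeriveProducts.
Variables (R : realType) (X : normedModType R).

Lemma derive_mulmx m n p (f : X -> 'M[R]_(m, n)) (g : X -> 'M[R]_(n, p)) x v :
  differentiable f x -> differentiable g x ->
  'D_v (fun y => f y *m g y) x = 'D_v f x *m g x + f x *m 'D_v g x.
Proof.
move=> df dg.
have dfe i j : derivable (fun y => f y i j) x v.
  by apply: diff_derivable; exact: differentiable_entry.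
have dge i j : derivable (fun y => g y i j) x v.
  by apply: diff_derivable; exact: differentiable_entry.
have E i j : (fun y => (f y *m g y) i j) =
    \sum_(l < n) ((fun y => f y i l) * (fun y => g y l j)).
  by apply/funext => y; rewrite fct_sumE mxE.
have dfg i j : derivable (fun y => (f y *m g y) i j) x v.
  by rewrite E; apply: derivable_sum => l; exact: derivableM.
rewrite derive_mx; last exact/derivable_mxP.
apply/matrixP => i j; rewrite mxE E derive_sum => [|l]; last exact: derivableM.
rewrite !mxE -big_split/=; apply: eq_bigr => l _.
rewrite !derive_entry//; apply: etrans (deriveM (dfe i l) (dge l j)) _.
by rewrite addrC; congr (_ + _); exact: mulrC.
Qed.

Lemma derive_scale m n (h : X -> R) (f : X -> 'M[R]_(m, n)) x v :
  differentiable h x -> differentiable f x ->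
  'D_v (fun y => h y *: f y) x = 'D_v h x *: f x + h x *: 'D_v f x.
Proof.
move=> dh df; have dhd : derivable h x v by exact: diff_derivable.
have dfe i j : derivable (fun y => f y i j) x v.
  by apply: diff_derivable; exact: differentiable_entry.
have E i j : (fun y => (h y *: f y) i j) = h * (fun y => f y i j).
  by apply/funext => y; rewrite mxE.
have dhf i j : derivable (fun y => (h y *: f y) i j) x v.
  by rewrite E; exact: derivableM.
rewrite derive_mx; last exact/derivable_mxP.
apply/matrixP => i j; rewrite mxE E !mxE !derive_entry//.
by apply: etrans (deriveM dhd (dfe i j)) _; rewrite addrC; congr (_ + _); exact: mulrC.
Qed.

End DeriveProducts.

Section Manifold.
Variables (R : realType) (S : smooth_surface R).
Implicit Types (c : chart R S) (O : set S).

Lemma open_chart_img c O : open O -> open (fwd c @` (dom c `&` O)).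
Proof.
move=> oO; rewrite openE => _ [x [cx Ox] <-].
have bx : (fwd c @` dom c) (fwd c x) by exists x.
have cb : bwd c y @[y --> fwd c x] --> bwd c (fwd c x) := bwd_continuous bx.
have H1 : nbhs (fwd c x) (bwd c @^-1` O).
  by apply: cb; rewrite fwdK//; exact: open_near.
have H2 : nbhs (fwd c x) (fwd c @` dom c) := open_near (@img_open _ _ c) bx.
apply: filterS2 H1 H2 => z Oz [y cy yz]; exists y => //; split=> //.
by move: Oz; rewrite /= -yz fwdK.
Qed.

Lemma chart_img_sub c O : O `<=` dom c -> fwd c @` (dom c `&` O) = fwd c @` O.
Proof. by move=> /setIidr ->. Qed.

Section Functions.
Variables (Y : normedModType R).
Implicit Types f g : S -> Y.

Lemma smooth_map_sub O O' f : O `<=` O' -> smooth_map O' f -> smooth_map O f.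
Proof.
move=> OO sf c Ac k; apply: Ck_sub (sf c Ac k).
by move=> _ [x [cx Ox] <-]; exists x => //; split=> //; exact: OO.
Qed.

Lemma smooth_map_local O f :
  (forall x, O x -> exists2 O', O' x & smooth_map O' f) -> smooth_map O f.
Proof.
move=> H c Ac k; apply: Ck_local => _ [x [cx Ox] <-].
have [W Wx sf] := H x Ox; exists (fwd c @` (dom c `&` W)); first by exists x.
exact: sf.
Qed.

Lemma smooth_map_eq O f g : open O -> (forall x, O x -> f x = g x) ->
  smooth_map O f -> smooth_map O g.
Proof.
move=> oO fg sf c Ac k; apply: Ck_eq (sf c Ac k); first exact: open_chart_img.
by move=> _ [x [cx Ox] <-]; rewrite /= fwdK//; exact: fg.
Qed.

Lemma smooth_map_cst O (a : Y) : smooth_map O (fun=> a).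
Proof. by move=> c Ac k; exact: Ck_cst. Qed.

Lemma smooth_mapD O f g : open O ->
  smooth_map O f -> smooth_map O g -> smooth_map O (fun x => f x + g x).
Proof.
by move=> oO sf sg c Ac k; apply: (Ck_add (open_chart_img oO)); [exact: sf|exact: sg].
Qed.

Lemma smooth_mapN O f : open O -> smooth_map O f -> smooth_map O (fun x => - f x).
Proof. by move=> oO sf c Ac k; apply: (Ck_opp (open_chart_img oO)); exact: sf. Qed.

Lemma smooth_map_diff O f c x : smooth_map O f -> atlas S c -> dom c x -> O x ->
  differentiable (f \o bwd c) (fwd c x).
Proof. by move=> sf Ac cx Ox; have [+ _] := sf c Ac 1%N; apply; exists x. Qed.

Lemma dmap_eq O f g c x v : open O -> O x -> dom c x ->
  (forall y, O y -> f y = g y) -> dmap c f v x = dmap c g v x.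
Proof.
move=> oO Ox cx fg; apply: near_eq_derive.
have xI : (fwd c @` (dom c `&` O)) (fwd c x) by exists x.
apply: filterS (open_near (open_chart_img oO) xI) => _ [y [cy Oy] <-].
by rewrite /= fwdK//; exact: fg.
Qed.

Lemma dmap_linear O f c x : smooth_map O f -> atlas S c -> dom c x -> O x ->
  forall v, dmap c f v x = v 0 0 *: dmap c f (du R) x + v 0 1 *: dmap c f (dv R) x.
Proof. by move=> sf Ac cx Ox v; apply: derive_rV2; exact: smooth_map_diff Ox. Qed.

Lemma dmap_cst c (a : Y) v x : dmap c (fun=> a) v x = 0.
Proof. exact: (derive_cst a). Qed.

Lemma dmapD O f g c x v : smooth_map O f -> smooth_map O g -> atlas S c ->
  dom c x -> O x -> dmap c (fun y => f y + g y) v x = dmap c f v x + dmap c g v x.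
Proof.
move=> sf sg Ac cx Ox.
by apply: (deriveD (f := f \o bwd c)); apply: diff_derivable;
  [exact: smooth_map_diff sf Ac cx Ox | exact: smooth_map_diff sg Ac cx Ox].
Qed.

Lemma dmapN O f c x v : smooth_map O f -> atlas S c ->
  dom c x -> O x -> dmap c (fun y => - f y) v x = - dmap c f v x.
Proof.
move=> sf Ac cx Ox.
by apply: (deriveN (f := f \o bwd c)); apply: diff_derivable;
  exact: smooth_map_diff sf Ac cx Ox.
Qed.

Lemma smooth_map_cont O f x : smooth_map O f -> open O -> O x -> {for x, continuous f}.
Proof.
move=> sf oO Ox; have [[c Ac cx] _] := ((atlasP S).1 x, I).
have cf := differentiable_continuous (smooth_map_diff sf Ac cx Ox).
have cfwd := fwd_continuous cx.
have : {for x, continuous (f \o bwd c \o fwd c)}.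
  by apply: (@continuous_comp _ _ _ (fwd c)).
rewrite /prop_for /continuous_at/= fwdK// => H.
apply: cvg_trans H; apply: near_eq_cvg.
by apply: filterS (open_near (@dom_open _ _ c) cx) => y cy; rewrite /= fwdK.
Qed.

End Functions.

Section Matrices.
Variables (m n : nat).
Implicit Types f g : S -> 'M[R]_(m, n).

(** One chart is enough, as the transition maps are smooth. *)
Lemma smooth_map_chart c O f : atlas S c -> open O -> O `<=` dom c ->
  smooth_on (fwd c @` O) (f \o bwd c) -> smooth_map O f.
Proof.
move=> Ac oO Oc sf c' Ac' k.
have [tr _] := ((atlasP S).2 c').1 Ac' c Ac.
have oI' := open_chart_img (c := c') oO.
apply: (@Ck_eq _ _ _ _ _ (fun y => (f \o bwd c) ((fwd c \o bwd c') y))) => //.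
  by move=> _ [x [cx Ox] <-]; rewrite /= fwdK// fwdK//; exact: Oc.
have oI : open (fwd c @` O) by rewrite -(chart_img_sub Oc); exact: open_chart_img.
apply: (Ck_comp oI' oI); last exact: sf.
  by move=> _ [x [cx Ox] <-]; exists x => //; rewrite /= fwdK.
apply: Ck_sub (tr k) => _ [x [cx Ox] <-].
by exists x => //; split=> //; exact: Oc.
Qed.

Lemma smooth_mapZ O (h : S -> R) f : open O ->
  smooth_map O h -> smooth_map O f -> smooth_map O (fun x => h x *: f x).
Proof.
by move=> oO sf sg c Ac k; apply: (Ck_scale (open_chart_img oO)); [exact: sf|exact: sg].
Qed.

Lemma smooth_map_entry O f i j : open O -> smooth_map O f -> smooth_map O (fun x => f x i j).
Proof. by move=> oO sf c Ac k; apply: (Ck_entry i j (open_chart_img oO)); exact: sf. Qed.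

Lemma smooth_map_mulmx p O f (g : S -> 'M[R]_(n, p)) : open O ->
  smooth_map O f -> smooth_map O g -> smooth_map O (fun x => f x *m g x).
Proof.
by move=> oO sf sg c Ac k; apply: (Ck_mulmx (open_chart_img oO)); [exact: sf|exact: sg].
Qed.

Lemma dmapZ O (h : S -> R) f c x v : smooth_map O h -> smooth_map O f ->
  atlas S c -> dom c x -> O x ->
  dmap c (fun y => h y *: f y) v x = dmap c h v x *: f x + h x *: dmap c f v x.
Proof.
move=> sh sf Ac cx Ox.
rewrite [LHS](derive_scale v (smooth_map_diff sh Ac cx Ox) (smooth_map_diff sf Ac cx Ox)).
by rewrite /= fwdK.
Qed.

Lemma dmap_mulmx p O f (g : S -> 'M[R]_(n, p)) c x v : smooth_map O f ->
  smooth_map O g -> atlas S c -> dom c x -> O x ->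
  dmap c (fun y => f y *m g y) v x = dmap c f v x *m g x + f x *m dmap c g v x.
Proof.
move=> sh sf Ac cx Ox.
rewrite [LHS](derive_mulmx v (smooth_map_diff sh Ac cx Ox) (smooth_map_diff sf Ac cx Ox)).
by rewrite /= fwdK.
Qed.

Lemma dmap_entry O f c x v i j : smooth_map O f -> atlas S c -> dom c x -> O x ->
  dmap c (fun y => f y i j) v x = (dmap c f v x) i j.
Proof.
by move=> sf Ac cx Ox; apply/esym/derive_entry; exact: smooth_map_diff sf Ac cx Ox.
Qed.

Lemma smooth_map_dmap c O f v : atlas S c -> open O ->
  smooth_map O f -> smooth_map (dom c `&` O) (dmap c f v).
Proof.
move=> Ac oO sf; apply: (smooth_map_chart Ac).
- by apply: openI => //; exact: dom_open.
- exact: subIsetl.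
move=> k; apply: (@Ck_eq _ _ _ _ _ ('D_v (f \o bwd c))).
- exact: open_chart_img.
- by move=> _ [x [cx Ox] <-]; rewrite /dmap/= fwdK.
by have [_ H] := sf c Ac k.+1; exact: H.
Qed.

Lemma dmapC O f c u v x : smooth_map O f -> open O -> atlas S c -> dom c x -> O x ->
  dmap c (dmap c f u) v x = dmap c (dmap c f v) u x.
Proof.
move=> sf oO Ac cx Ox; have xI : (fwd c @` (dom c `&` O)) (fwd c x) by exists x.
have E w w' : dmap c (dmap c f w) w' x = 'D_w' ('D_w (f \o bwd c)) (fwd c x).
  apply: near_eq_derive.
  apply: filterS (open_near (open_chart_img oO) xI) => _ [y [cy Oy] <-].
  by rewrite /dmap/= fwdK.
rewrite E; apply: etrans _ (esym (E v u)).
exact: schwarz_mx (open_chart_img oO) xI (sf c Ac 2%N).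
Qed.

Lemma dmap_change O f c c' x v : smooth_map O f -> open O ->
  atlas S c -> atlas S c' -> dom c x -> dom c' x -> O x ->
  dmap c' f v x = dmap c f (dmap c' (fwd c) v x) x.
Proof.
move=> sf oO Ac Ac' cx cx' Ox.
have [tr _] := ((atlasP S).2 c').1 Ac' c Ac.
have dt : differentiable (fwd c \o bwd c') (fwd c' x).
  by have [+ _] := tr 1%N; apply; exists x.
have df : differentiable (f \o bwd c) ((fwd c \o bwd c') (fwd c' x)).
  by rewrite /= fwdK//; exact: smooth_map_diff sf Ac cx Ox.
have E : (fwd c \o bwd c') (fwd c' x) = fwd c x by rewrite /= fwdK.
have H := derive_comp v dt df; rewrite E in H.
apply: etrans _ H; apply: near_eq_derive.
have xI : (fwd c' @` (dom c' `&` dom c)) (fwd c' x) by exists x.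
apply: filterS (open_near (open_chart_img (@dom_open _ _ c)) xI) => _ [y [cy' cy] <-].
by rewrite /= fwdK// fwdK.
Qed.

End Matrices.

Section Scalars.
Implicit Types f g : S -> R.

Lemma smooth_mapM O f g : open O ->
  smooth_map O f -> smooth_map O g -> smooth_map O (fun x => f x * g x).
Proof.
by move=> oO sf sg c Ac k; apply: (Ck_mul (open_chart_img oO)); [exact: sf|exact: sg].
Qed.

Lemma smooth_mapV O f : open O -> (forall x, O x -> f x != 0) ->
  smooth_map O f -> smooth_map O (fun x => (f x)^-1).
Proof.
move=> oO f0 sf c Ac k; apply: (Ck_inv (open_chart_img oO)); last exact: sf.
by move=> _ [x [cx Ox] <-]; rewrite /= fwdK//; exact: f0.
Qed.

Lemma smooth_map_sqrt O f : open O -> (forall x, O x -> 0 < f x) ->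
  smooth_map O f -> smooth_map O (fun x => Num.sqrt (f x)).
Proof.
move=> oO f0 sf c Ac k; apply: (Ck_sqrt (open_chart_img oO)); last exact: sf.
by move=> _ [x [cx Ox] <-]; rewrite /= fwdK//; exact: f0.
Qed.

Lemma dmapM O f g c x v : smooth_map O f -> smooth_map O g ->
  atlas S c -> dom c x -> O x ->
  dmap c (fun y => f y * g y) v x = dmap c f v x * g x + f x * dmap c g v x.
Proof.
move=> sf sg Ac cx Ox.
have df := diff_derivable (v := v) (smooth_map_diff sf Ac cx Ox).
have dg := diff_derivable (v := v) (smooth_map_diff sg Ac cx Ox).
apply: etrans (deriveM df dg) _; rewrite /= fwdK// addrC.
by congr (_ + _); exact: mulrC.
Qed.

End Scalars.

Section InnerProducts.
Variables (n : nat) (G : 'M[R]_n.+2).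
Implicit Types f g : S -> 'rV[R]_n.+2.

Let sT O f : open O -> smooth_map O f -> smooth_map O (fun x => (f x)^T).
Proof.
move=> oO sf c Ac k; apply: (Ck_mx (open_chart_img oO)) => i j.
apply: (@Ck_eq _ _ _ _ _ (fun y => (f \o bwd c) y j i)).
- exact: open_chart_img.
- by move=> y _; rewrite /= mxE.
by apply: (Ck_entry j i (open_chart_img oO)); exact: sf.
Qed.

Lemma smooth_map_ip O f g : open O ->
  smooth_map O f -> smooth_map O g -> smooth_map O (fun x => ip G (f x) (g x)).
Proof.
move=> oO sf sg; apply: (smooth_map_entry 0 0 oO (f := fun x => f x *m G *m (g x)^T)).
apply: smooth_map_mulmx => //; last exact: sT.
by apply: smooth_map_mulmx => //; exact: smooth_map_cst.
Qed.

Lemma dmap_ip O f g c x v : open O -> smooth_map O f -> smooth_map O g ->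
  atlas S c -> dom c x -> O x ->
  dmap c (fun y => ip G (f y) (g y)) v x =
  ip G (dmap c f v x) (g x) + ip G (f x) (dmap c g v x).
Proof.
move=> oO sf sg Ac cx Ox.
have sG : smooth_map O (fun y => f y *m G).
  by apply: smooth_map_mulmx => //; exact: smooth_map_cst.
have sfg : smooth_map O (fun y => f y *m G *m (g y)^T).
  by apply: smooth_map_mulmx => //; exact: sT.
rewrite [LHS](dmap_entry v 0 0 sfg Ac cx Ox).
rewrite (dmap_mulmx v sG (sT oO sg) Ac cx Ox).
rewrite (dmap_mulmx v sf (smooth_map_cst O G) Ac cx Ox) dmap_cst mulmx0 addr0.
rewrite mxE /ip; congr (_ + (_ *m _) 0 0).
apply/matrixP => i j; rewrite mxE -(dmap_entry v i j (sT oO sg) Ac cx Ox).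
rewrite -(dmap_entry v j i sg Ac cx Ox).
by congr (dmap c _ v x); apply/funext => y; rewrite mxE.
Qed.

End InnerProducts.
End Manifold.

(** * Lifts and the first derived bundle *)

Section Bundles.
Variables (R : realType) (n : nat) (G : 'M[R]_n.+2) (S : smooth_surface R).
Hypothesis hG : lorentzian G.
Local Notation V := 'rV[R]_n.+2.
Local Notation bundle := (S -> {vspace 'rV[R]_n.+2}).
Implicit Types (E : bundle) (F : S -> V) (c : chart R S) (O : set S).

Section LineBundle.
Variable E : bundle.
Hypothesis hE : null_line_bundle G E.

Lemma line_lift x : exists O F, lift E O F /\ O x.
Proof.
have [W [s [oW Wx ss sE]]] := hE.1 x; exists W, (s ord0); split=> //.
have Es y : W y -> E y = <[s ord0 y]>%VS by move=> /sE[-> _]; rewrite big_ord1.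
split; first by split=> // y Oy; rewrite Es//; exact: memv_line.
move=> y Oy; have [_] := sE y Oy; rewrite Es// dim_vline.
by case: eqP.
Qed.

Lemma lift_span O F x : lift E O F -> O x -> E x = <[F x]>%VS.
Proof.
move=> [[_ _ FE] F0] Ox; apply/esym/eqP; rewrite eqEdim -memvE FE//=.
by rewrite dim_vline F0//; have [U [s [_ Ux _ sE]]] := hE.1 x; have [_ ->] := sE x Ux.
Qed.

Lemma lift_sub O O' F : lift E O F -> open O' -> O' `<=` O -> lift E O' F.
Proof.
move=> [[oO sF FE] F0] oO' OO; split=> [|x /OO]; last exact: F0.
by split=> // [|x /OO]; [exact: smooth_map_sub sF | exact: FE].
Qed.

Lemma lift_null O F x : lift E O F -> O x -> ip G (F x) (F x) = 0.
Proof. by move=> [[_ _ FE] _] Ox; apply: hE.2 (FE x Ox). Qed.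

Lemma lift_dmap_perp O F c x v : lift E O F -> O x -> atlas S c -> dom c x ->
  ip G (F x) (dmap c F v x) = 0.
Proof.
move=> lF Ox Ac cx; have [[oO sF _] _] := lF.
have := dmap_ip G v oO sF sF Ac cx Ox.
have -> : dmap c (fun y => ip G (F y) (F y)) v x = 0.
  rewrite (dmap_eq (g := fun=> 0) v oO Ox cx) ?dmap_cst// => y Oy.
  exact: lift_null lF Oy.
rewrite [ip G (dmap _ _ _ _) _]ipC// => /eqP; rewrite eq_sym -mulr2n mulrn_eq0/=.
by move=> /eqP.
Qed.

(** Two lifts are proportional, so that the derivative of one is a combination of
    the derivative of the other and of the lift itself: the span of a lift and of
    its derivatives depends neither on the lift nor on the chart. *)
Lemma first_derivedE O F c x : lift E O F -> O x -> atlas S c -> dom c x ->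
  first_derived E x = (<[F x]> + <[dmap c F (du R) x]> + <[dmap c F (dv R) x]>)%VS.
Proof.
move=> lF Ox Ac cx; have [[oO sF FE] F0] := lF.
apply/eqP; rewrite eqEsubv; apply/andP; split; last first.
  have [H _] := vspanP [set z | exists O F, [/\ lift E O F, O x &
    z = F x \/ exists c v, [/\ atlas S c, dom c x & z = dmap c F v x]]].
  have sub3 (U : {vspace V}) f a b : f \in U -> a \in U -> b \in U ->
      (<[f]> + <[a]> + <[b]> <= U)%VS.
    by move=> fU aU bU; rewrite !subv_add -!memvE fU aU bU.
  apply: sub3; apply: H.
  - by exists O, F; split=> //; left.
  - by exists O, F; split=> //; right; exists c, (du R).
  - by exists O, F; split=> //; right; exists c, (dv R).
apply: (vspanP _).2 => z [W' [F' [lF' W'x zE]]] /=.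
have [[oW' sF' _] _] := lF'.
have inF y : O y -> W' y -> exists k, F' y = k *: F y.
  move=> Oy Wy; have [[_ _ H] _] := lF'; apply/vlineP.
  by rewrite -(lift_span lF Oy); exact: H.
case: zE => [->|[c' [v [Ac' cx' ->]]]].
  have [k ->] := inF x Ox W'x; do 2!apply: (subvP (addvSl _ _)).
  exact: memvZ (memv_line _).
rewrite (dmap_change v sF' oW' Ac Ac' cx cx' W'x); set w := dmap c' _ _ _.
have [i Fi] : exists i, F x 0 i != 0.
  apply/existsP; rewrite -negb_forall; apply/forallP => /= H; apply/negP: (F0 x Ox).
  by rewrite negbK; apply/eqP/rowP => i; rewrite [RHS]mxE; apply/eqP.
pose W := O `&` W'; have oW : open W by exact: openI.
have sFW : smooth_map W F by apply: smooth_map_sub sF => y [].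
have sFW' : smooth_map W F' by apply: smooth_map_sub sF' => y [].
have sFi := smooth_map_entry 0 i oW sFW; have sFi' := smooth_map_entry 0 i oW sFW'.
have Wx : W x by [].
have : dmap c (fun y => F y 0 i *: F' y) w x = dmap c (fun y => F' y 0 i *: F y) w x.
  apply: (dmap_eq w oW Wx cx) => y [Oy Wy].
  by have [k ->] := inF y Oy Wy; rewrite mxE !scalerA mulrC.
rewrite (dmapZ w sFi sFW' Ac cx Wx) (dmapZ w sFi' sFW Ac cx Wx).
have [k ->] := inF x Ox W'x; move: (dmap c F' w x) => z'.
rewrite (dmap_linear sF Ac cx Ox w) mxE => H.
apply/memv_sum3P; have {}H : F x 0 i *: z' = (dmap c (fun x0 => F' x0 0 i) w x - dmap c (fun x0 => F x0 0 i) w x * k) *: F x + (k * F x 0 i) *: (w 0 0 *: dmap c F (du R) x + w 0 1 *: dmap c F (dv R) x).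
  by rewrite -[LHS](addKr (dmap c (fun x0 => F x0 0 i) w x *: (k *: F x))) H scalerA scalerBl addrA; congr (_ + _); rewrite addrC.
rewrite -[z'](scalerK Fi) H.
set p := (dmap c _ w x - _); exists ((F x 0 i)^-1 * p), (k * w 0 0), (k * w 0 1).
move: p (dmap c F (du R) x) (dmap c F (dv R) x) => p a b.
rewrite scalerDr !scalerA -addrA scalerDr !scalerA; congr (_ + (_ *: _ + _ *: _)); by field.
Qed.

End LineBundle.

Lemma immersion_frame E O F c x : immersion G E -> lift E O F -> O x ->
  atlas S c -> dom c x ->
  frame G (F x) (dmap c F (du R) x) (dmap c F (dv R) x).
Proof.
move=> hE lF Ox Ac cx; split.
- exact: (lift_null hE.1 lF Ox).
- exact: (lift_dmap_perp hE.1 _ lF Ox Ac cx).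
- exact: (lift_dmap_perp hE.1 _ lF Ox Ac cx).
move=> a b d; apply: dimv3_free; rewrite -(first_derivedE hE.1 lF Ox Ac cx).
by have [U [s [_ Ux _ sE]]] := hE.2 x; have [_ ->] := sE x Ux.
Qed.

Section Form.
Variables (E : bundle) (eta : preform S 'M[R]_n.+2).
Hypothesis hiso : isothermic G E eta.
Variables (O : set S) (F : S -> V) (c : chart R S) (x : S).
Hypotheses (lF : lift E O F) (Ox : O x) (Ac : atlas S c) (cx : dom c x).

Lemma eta_wedge v : exists2 z, ip G (F x) z = 0 & eta c x v = wedge G (F x) z.
Proof.
have [[hE _] _ _ _ H] := hiso; have [f [z [fE zE ->]]] := H c x v Ac cx.
have Ex := lift_span hE lF Ox; rewrite Ex in fE zE.
have /vlineP[k ->] := fE; exists (k *: z).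
  have /memv_perp/(_ (F x) (memv_line _)) := zE.
  by rewrite ipZr => ->; rewrite mulr0.
have trZ (u : V) : (k *: u)^T = k *: u^T by rewrite linearZ.
by rewrite /wedge; congr (_ *m (_ - _)); rewrite trZ -scalemxAl -scalemxAr.
Qed.

Lemma eta_act v : exists2 z, ip G (F x) z = 0 &
  forall y, y *m eta c x v = ip G (F x) y *: z - ip G z y *: F x.
Proof.
have [z Fz ->] := eta_wedge v; exists z => // y; exact: wedge_act.
Qed.

Lemma eta_skew v y y' : ip G (y *m eta c x v) y' = - ip G y (y' *m eta c x v).
Proof.
have [z _ H] := eta_act v; rewrite !H !ipE (ipC hG y) (ipC hG y (F x)).
by rewrite opprB (mulrC (ip G (F x) y)) (mulrC (ip G z y)).
Qed.

Lemma eta_lift v : F x *m eta c x v = 0.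
Proof.
have [[hE _] _ _ _ _] := hiso; have [z Fz ->] := eta_act v.
by rewrite (lift_null hE lF Ox) (ipC hG z) Fz !scale0r subr0.
Qed.

Lemma eta_lift_perp v y : ip G (F x) (y *m eta c x v) = 0.
Proof. by apply: oppr_inj; rewrite -eta_skew eta_lift ip0l oppr0. Qed.

End Form.

Lemma smooth_eta E eta c v : isothermic G E eta -> atlas S c ->
  smooth_map (dom c) (fun y => eta c y v).
Proof.
move=> [_ [_ _ H] _ _ _] Ac; apply: (smooth_map_chart Ac (@dom_open _ _ c)) => //.
exact: H.
Qed.

Lemma eta_linear E eta c x v : isothermic G E eta -> atlas S c -> dom c x ->
  eta c x v = v 0 0 *: eta c x (du R) + v 0 1 *: eta c x (dv R).
Proof.
move=> [_ [H _ _] _ _ _] Ac cx; rewrite [in LHS](rV2_decomp v) H//.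
congr (_ + _); have := H c x Ac cx (v 0 1) (dv R) 0.
have -> : eta c x 0 = 0.
  have := H c x Ac cx 1 0 0; rewrite !scale1r addr0 => E0.
  by apply: (addrI (eta c x 0)); rewrite addr0.
by rewrite !addr0.
Qed.

End Bundles.

(** * The Codazzi equations *)

(** The algebraic content of the closedness of [eta = F /\ Z]: [a], [b] are the
    partial derivatives of [F], and [p], [q] the mixed ones of [Z]. *)
Section CodazziAlgebra.
Variables (R : realType) (n : nat) (G : 'M[R]_n.+2).
Hypothesis hG : lorentzian G.
Local Notation V := 'rV[R]_n.+2.
Local Notation "<< u , v >>" := (ip G u v).
Variables F a b z1 z2 p q : V.
Hypothesis fr : frame G F a b.
Hypothesis closed : forall w,
  <<a, w>> *: z2 + <<F, w>> *: p - (<<p, w>> *: F + <<z2, w>> *: a) =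
  <<b, w>> *: z1 + <<F, w>> *: q - (<<q, w>> *: F + <<z1, w>> *: b).

Lemma closed_perp z : <<F, z>> = 0 -> <<a, z>> = 0 -> <<b, z>> = 0 ->
  <<z1, z>> = 0 /\ <<z2, z>> = 0.
Proof.
move=> Fz az bz; have := closed z; rewrite Fz az bz !scale0r !add0r => /eqP.
rewrite -subr_eq0 => /eqP H; have [_ _ _ free] := fr.
have [|_ /eqP + ->] := free (<<q, z>> - <<p, z>>) (- <<z2, z>>) <<z1, z>>.
  rewrite -[RHS]H; move: <<p, z>> <<q, z>> <<z1, z>> <<z2, z>> => ? ? ? ?.
  by apply/rowP => i; rewrite !mxE; ring.
by rewrite oppr_eq0 => /eqP.
Qed.

(** The quadratic differential [- (Z, dF)] is trace-free. *)
Lemma closed_tracefree :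
  <<a, a>> * <<z2, b>> + <<z1, a>> * <<b, b>> = <<a, b>> * (<<z1, b>> + <<z2, a>>).
Proof.
have [FF Fa Fb _] := fr; have := congr1 (ip G ^~ b) (closed a).
rewrite /= !ipE Fa Fb (ipC hG b a) !mul0r !mulr0 !addr0 !add0r => H.
apply/eqP; rewrite -subr_eq0; apply/eqP; move/eqP: H; rewrite -subr_eq0 => /eqP <-.
ring.
Qed.

(** The quadratic differential [- (Z, dF)] is symmetric. *)
Lemma closed_symmetric w : <<F, w>> != 0 -> <<F, z1>> = 0 -> <<F, z2>> = 0 ->
  <<a, z2>> + <<F, p>> = 0 -> <<b, z1>> + <<F, q>> = 0 -> <<z2, a>> = <<z1, b>>.
Proof.
move=> Fw Fz1 Fz2 /eqP; rewrite addr_eq0 => /eqP E2 /eqP; rewrite addr_eq0 => /eqP E1.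
have [FF Fa Fb _] := fr; have := congr1 (ip G ^~ F) (closed w).
rewrite /= !ipE (ipC hG a F) (ipC hG b F) FF Fa Fb.
rewrite (ipC hG z1 F) (ipC hG z2 F) Fz1 Fz2 !mulr0 !addr0 !add0r !subr0.
move=> /(mulfI Fw); rewrite (ipC hG p) (ipC hG q) => H.
by rewrite (ipC hG z2) (ipC hG z1) E1 E2 H.
Qed.

End CodazziAlgebra.

Section Codazzi.
Variables (R : realType) (n : nat) (G : 'M[R]_n.+2) (S : smooth_surface R).
Hypothesis hG : lorentzian G.
Local Notation V := 'rV[R]_n.+2.
Variables (E : S -> {vspace V}) (eta : preform S 'M[R]_n.+2).
Hypothesis hiso : isothermic G E eta.
Variables (O : set S) (F Z1 Z2 : S -> V) (c : chart R S) (x : S).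
Hypotheses (lF : lift E O F) (Ox : O x) (Ac : atlas S c) (Oc : O `<=` dom c).
Hypotheses (sZ1 : smooth_map O Z1) (sZ2 : smooth_map O Z2).
Hypothesis etaZ1 : forall y, O y -> forall w,
  w *m eta c y (du R) = ip G (F y) w *: Z1 y - ip G (Z1 y) w *: F y.
Hypothesis etaZ2 : forall y, O y -> forall w,
  w *m eta c y (dv R) = ip G (F y) w *: Z2 y - ip G (Z2 y) w *: F y.
Local Notation Fu := (dmap c F (du R) x).
Local Notation Fv := (dmap c F (dv R) x).
Local Notation Z1v := (dmap c Z1 (dv R) x).
Local Notation Z2u := (dmap c Z2 (du R) x).

(** The equation [d eta = 0] applied to a constant vector [w], with [eta] written as a
    wedge product. *)
Lemma eta_closed w :
  ip G Fu w *: Z2 x + ip G (F x) w *: Z2u - (ip G Z2u w *: F x + ip G (Z2 x) w *: Fu) =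
  ip G Fv w *: Z1 x + ip G (F x) w *: Z1v - (ip G Z1v w *: F x + ip G (Z1 x) w *: Fv).
Proof.
have [_ _ _ hcl _] := hiso; have cx := Oc Ox; have [[oO sF _] _] := lF.
have dw a b : w *m dmap c (fun y => eta c y a) b x = dmap c (fun y => w *m eta c y a) b x.
  have sa := smooth_eta a hiso Ac.
  rewrite (dmap_mulmx b (smooth_map_cst (dom c) w) sa Ac cx cx).
  by rewrite dmap_cst mul0mx add0r.
have sc := smooth_map_cst O w.
have Dact Z v : smooth_map O Z ->
    dmap c (fun y => ip G (F y) w *: Z y - ip G (Z y) w *: F y) v x =
    ip G (dmap c F v x) w *: Z x + ip G (F x) w *: dmap c Z v x -
    (ip G (dmap c Z v x) w *: F x + ip G (Z x) w *: dmap c F v x).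
  move=> sZ; have sFw := smooth_map_ip G oO sF sc; have sZw := smooth_map_ip G oO sZ sc.
  have s1 := smooth_mapZ oO sFw sZ; have s2 := smooth_mapZ oO sZw sF.
  rewrite (dmapD v s1 (smooth_mapN oO s2) Ac cx Ox) (dmapN v s2 Ac cx Ox).
  rewrite (dmapZ v sFw sZ Ac cx Ox) (dmapZ v sZw sF Ac cx Ox).
  rewrite (dmap_ip G v oO sF sc Ac cx Ox) (dmap_ip G v oO sZ sc Ac cx Ox).
  rewrite dmap_cst; move: (dmap c F v x) (dmap c Z v x) => p q.
  by rewrite !ip0r !addr0.
have := congr1 (mulmx w) (hcl c x (du R) (dv R) Ac cx).
rewrite !dw (dmap_eq (du R) oO Ox cx (fun y Oy => etaZ2 Oy w)).
by rewrite (dmap_eq (dv R) oO Ox cx (fun y Oy => etaZ1 Oy w)) !Dact.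
Qed.

End Codazzi.

(** A Darboux transform at a point: its lift [H] is never orthogonal to [F], and
    as it is an immersion, [eta] is injective on tangent vectors. *)
Section Darboux.
Variables (R : realType) (n : nat) (G : 'M[R]_n.+2) (S : smooth_surface R).
Hypothesis hG : lorentzian G.
Local Notation V := 'rV[R]_n.+2.
Variables (E hE : S -> {vspace V}) (eta : preform S 'M[R]_n.+2) (m : R).
Hypothesis hiso : isothermic G E eta.
Hypothesis hdar : darboux_transform G E eta m hE.
Variables (O : set S) (F H : S -> V) (c : chart R S).
Hypotheses (lF : lift E O F) (lH : lift hE O H) (Ac : atlas S c) (Oc : O `<=` dom c).

Lemma darboux_ip x : O x -> ip G (F x) (H x) != 0.
Proof.
move=> Ox; have [[nE _] _ _ _ _] := hiso; have [_ [nH _] disj _] := hdar.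
apply: (null_not_perp hG (lF.2 x Ox) (lift_null nE lF Ox) (lift_null nH lH Ox)).
apply: contra (lH.2 x Ox) => HF; rewrite -memv0 -(disj x) memv_cap.
by rewrite (lift_span nE lF Ox) HF (lift_span nH lH Ox) memv_line.
Qed.

Lemma darboux_dmap x v : O x -> exists k,
  dmap c H v x = k *: H x - m *: (H x *m eta c x v).
Proof.
move=> Ox; have [_ [nH _] _ par] := hdar.
have := par O H lH.1 c x v Ac (Oc Ox) Ox; rewrite (lift_span nH lH Ox).
by move=> /vlineP[k kE]; exists k; rewrite -kE /nabla addrK.
Qed.

Lemma darboux_free x a b k : O x ->
  a *: (H x *m eta c x (du R)) + b *: (H x *m eta c x (dv R)) = k *: H x ->
  a = 0 /\ b = 0.
Proof.
move=> Ox E'; have [m0 iH _ _] := hdar.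
have [_ _ _ free] := immersion_frame hG iH lH Ox Ac (Oc Ox).
have [k1 E1] := darboux_dmap (du R) Ox; have [k2 E2] := darboux_dmap (dv R) Ox.
move: free E'; rewrite {}E1 {}E2.
move: (H x *m eta c x (du R)) (H x *m eta c x (dv R)) => p q.
move: (H x) => h free E'.
have [|_ -> ->//] := free (m * k - a * k1 - b * k2) a b.
have -> : (m * k - a * k1 - b * k2) *: h = m *: (a *: p + b *: q) - (a * k1 + b * k2) *: h.
  by rewrite E' scalerA -scalerBl; congr (_ *: _); ring.
by apply/rowP => i; rewrite !mxE; ring.
Qed.

(** The potential of [eta = F /\ zeta], which is unique up to multiples of [F], normalised
    by its orthogonality to the Darboux transform; this makes it smooth. *)
Definition zeta v x := (ip G (F x) (H x))^-1 *: (H x *m eta c x v).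

Lemma smooth_zeta v : smooth_map O (zeta v).
Proof.
have [[oO sF _] _] := lF; have [[_ sH _] _] := lH.
apply: smooth_mapZ => //.
  by apply: smooth_mapV => //; [exact: darboux_ip | exact: smooth_map_ip].
apply: smooth_map_mulmx => //; exact: smooth_map_sub Oc (smooth_eta v hiso Ac).
Qed.

Lemma zeta_lift v x : O x -> ip G (F x) (zeta v x) = 0.
Proof.
by move=> Ox; rewrite /zeta ipZr (eta_lift_perp hG hiso lF Ox Ac (Oc Ox)) mulr0.
Qed.

Lemma zeta_H v x : O x -> ip G (H x) (zeta v x) = 0.
Proof.
move=> Ox; rewrite /zeta ipZr; have := eta_skew hG hiso lF Ox Ac (Oc Ox) v (H x) (H x).
rewrite (ipC hG (_ *m _)) => /eqP; rewrite -addr_eq0 -mulr2n mulrn_eq0/= => /eqP ->.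
by rewrite mulr0.
Qed.

Lemma eta_zeta v x : O x -> forall w,
  w *m eta c x v = ip G (F x) w *: zeta v x - ip G (zeta v x) w *: F x.
Proof.
move=> Ox w; have FH := darboux_ip Ox.
have [z Fz act] := eta_act hG hiso lF Ox Ac (Oc Ox) v.
rewrite /zeta !act; move: (F x) (H x) FH => f h fh.
rewrite ipZl ipDl ipNl !ipZl scalerBr !scalerA mulVf// scale1r.
apply/rowP => i; rewrite !mxE; field.
exact: fh.
Qed.

Lemma zeta_free x a b k : O x ->
  a *: zeta (du R) x + b *: zeta (dv R) x = k *: F x -> a = 0 /\ b = 0.
Proof.
move=> Ox E'; have FH := darboux_ip Ox.
have := congr1 (ip G (H x)) E'; rewrite ipDr (ipZr _ a) (ipZr _ b) (ipZr _ k) !zeta_H// !mulr0 addr0.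
rewrite (ipC hG) => /esym/eqP; rewrite mulf_eq0 (negPf FH) orbF => /eqP k0.
apply: (darboux_free (k := 0) Ox); move: E'; rewrite k0 !scale0r /zeta.
move: (H x *m eta c x (du R)) (H x *m eta c x (dv R)) => p q.
rewrite !(scalerA _ (ip _ _ _)^-1) !(mulrC _ (ip _ _ _)^-1) -!scalerA -scalerDr.
by move=> /eqP; rewrite scaler_eq0 invr_eq0 (negPf FH)/= => /eqP.
Qed.

Section AtPoint.
Variable x : S.
Hypothesis Ox : O x.
Local Notation Fu := (dmap c F (du R) x).
Local Notation Fv := (dmap c F (dv R) x).

Lemma darboux_frame : frame G (F x) Fu Fv.
Proof. have [iE _ _ _ _] := hiso; exact: (immersion_frame hG iE lF Ox Ac (Oc Ox)). Qed.

Lemma darboux_first_derived : first_derived E x = (<[F x]> + <[Fu]> + <[Fv]>)%VS.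
Proof. have [[nE _] _ _ _ _] := hiso; exact: (first_derivedE nE lF Ox Ac (Oc Ox)). Qed.

Let closed := eta_closed hiso lF Ox Ac Oc (smooth_zeta (du R)) (smooth_zeta (dv R))
  (fun y Oy => eta_zeta (du R) Oy) (fun y Oy => eta_zeta (dv R) Oy).

Lemma zeta_first_derived v : v = du R \/ v = dv R ->
  zeta v x \in (<[F x]> + <[Fu]> + <[Fv]>)%VS.
Proof.
move=> vE; apply: (frame_perp_perp hG darboux_frame) => [|z]; first exact: zeta_lift.
move=> /(frame_perpP _ _ _ _)[Fz uz vz]; rewrite (ipC hG).
have [H1 H2] := closed_perp darboux_frame closed Fz uz vz.
by case: vE => ->.
Qed.

Lemma zeta_tracefree :
  ip G Fu Fu * ip G (zeta (dv R) x) Fv + ip G (zeta (du R) x) Fu * ip G Fv Fv =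
  ip G Fu Fv * (ip G (zeta (du R) x) Fv + ip G (zeta (dv R) x) Fu).
Proof. exact: (closed_tracefree hG darboux_frame closed). Qed.

Lemma zeta_symmetric : ip G (zeta (dv R) x) Fu = ip G (zeta (du R) x) Fv.
Proof.
have [[oO sF _] _] := lF.
have D w v : ip G (dmap c F w x) (zeta v x) + ip G (F x) (dmap c (zeta v) w x) = 0.
  rewrite -(dmap_ip G w oO sF (smooth_zeta v) Ac (Oc Ox) Ox).
  rewrite (dmap_eq (g := fun=> 0) w oO Ox (Oc Ox)) ?dmap_cst// => y Oy.
  exact: zeta_lift.
apply: (closed_symmetric hG darboux_frame closed (darboux_ip Ox)).
- exact: zeta_lift.
- exact: zeta_lift.
- exact: D.
- exact: D.
Qed.

(** The values of [zeta] are tangent, and independent modulo [F]; so they span with [F]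
    the first derived bundle, and being killed by [F /\ zeta] for all of them amounts to
    being orthogonal to that span. *)
Lemma ker_eta z : z \in perp G (first_derived E x) <->
  forall v, z *m eta c x v = 0.
Proof.
rewrite darboux_first_derived; split=> [|H0].
  move=> /(frame_perpP _ _ _ _)[Fz uz vz] v.
  have [H1 H2] := closed_perp darboux_frame closed Fz uz vz.
  rewrite (eta_linear v hiso Ac (Oc Ox)) mulmxDr -!scalemxAr !eta_zeta//.
  by rewrite Fz H1 H2 !scale0r subr0 !scaler0 addr0.
have act v : ip G (F x) z *: zeta v x - ip G (zeta v x) z *: F x = 0.
  by rewrite -eta_zeta// H0.
have z1 := zeta_first_derived (or_introl erefl).
have z2 := zeta_first_derived (or_intror erefl).
have free a b k := zeta_free (a := a) (b := b) (k := k) Ox.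
have fr := darboux_frame.
move: (act (du R)) (act (dv R)); move: (zeta (du R) x) (zeta (dv R) x) z1 z2 free.
move=> zu zv /memv_sum3P[x1 [y1 [t1 E1]]] /memv_sum3P[x2 [y2 [t2 E2]]] free Hu Hv.
move: (F x) Fu Fv fr free Hu Hv E1 E2 => f a b fr free Hu Hv E1 E2.
have fz : ip G f z = 0.
  apply/eqP/negPn/negP => fz; have [|/eqP] := free 1 0 ((ip G f z)^-1 * ip G zu z).
    move/eqP: Hu; rewrite subr_eq0 => /eqP Hu; rewrite scale1r scale0r addr0.
    by rewrite -scalerA -Hu scalerA mulVf// scale1r.
  by rewrite oner_eq0.
have f0 := frame_neq0 fr.
move: Hu Hv; rewrite fz !scale0r !sub0r => /eqP; rewrite oppr_eq0 scaler_eq0 (negPf f0) orbF.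
move=> /eqP zuz /eqP; rewrite oppr_eq0 scaler_eq0 (negPf f0) orbF => /eqP zvz.
have D0 : y1 * t2 - t1 * y2 != 0.
  apply/eqP => D0; have [|t20 /eqP] := free t2 (- t1) (t2 * x1 - t1 * x2).
    rewrite E1 E2 (_ : _ + _ = (t2 * x1 - t1 * x2) *: f + (y1 * t2 - t1 * y2) *: a).
      by rewrite D0 scale0r addr0.
    by apply/rowP => i; rewrite !mxE; ring.
  rewrite oppr_eq0 => /eqP t10.
  have [|y20 y10] := free (- y2) y1 (y1 * x2 - y2 * x1).
    rewrite E1 E2 (_ : _ + _ = (y1 * x2 - y2 * x1) *: f + (y1 * t2 - t1 * y2) *: b).
      by rewrite D0 scale0r addr0.
    by apply/rowP => i; rewrite !mxE; ring.
  have [|/eqP] := free 1 0 x1; last by rewrite oner_eq0.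
  by rewrite E1 y10 t10 !scale0r !addr0 scale1r.
move: zuz zvz; rewrite E1 E2 !ipDl !ipZl fz !mulr0 !add0r => H1 H2.
apply/(frame_perpP _ _ _ _); split=> //; apply: (mulfI D0); rewrite mulr0.
  transitivity (t2 * (y1 * ip G a z + t1 * ip G b z) - t1 * (y2 * ip G a z + t2 * ip G b z)).
    by ring.
  by rewrite H1 H2 !mulr0 subr0.
transitivity (y1 * (y2 * ip G a z + t2 * ip G b z) - y2 * (y1 * ip G a z + t1 * ip G b z)).
  by ring.
by rewrite H1 H2 !mulr0 subr0.
Qed.

End AtPoint.
End Darboux.

(** * Conformal curvature line coordinates *)

(** A positive definite form [g] and a form [q], non-zero and trace-free with
    respect to [g], are simultaneously diagonalised: with
    [l ^ 2 = - det q / det g], both [l g + q] and [l g - q] have rank one and are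
    positive. *)
Lemma tracefree_split (R : realType) (g11 g12 g22 q11 q12 q22 : R) :
  0 < g11 -> 0 < g11 * g22 - g12 ^+ 2 ->
  g11 * q22 + q11 * g22 = g12 * (q12 + q12) -> (q11 != 0) || (q12 != 0) ->
  let m := (q12 ^+ 2 - q11 * q22) / (g11 * g22 - g12 ^+ 2) in
  0 < m /\ let l := Num.sqrt m in
  [/\ (l * g11 + q11) * (l * g22 + q22) = (l * g12 + q12) ^+ 2,
      (l * g11 - q11) * (l * g22 - q22) = (l * g12 - q12) ^+ 2,
      [/\ 0 <= l * g11 + q11, 0 <= l * g22 + q22 &
        (0 < l * g11 + q11) || (0 < l * g22 + q22)] &
      [/\ 0 <= l * g11 - q11, 0 <= l * g22 - q22 &
        (0 < l * g11 - q11) || (0 < l * g22 - q22)]].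
Proof.
set D := _ - g12 ^+ 2 => g0 D0 tf q0.
have g22E : g22 = (D + g12 ^+ 2) / g11 by rewrite /D; field; exact: lt0r_neq0.
have gn0 : g11 != 0 by exact: lt0r_neq0.
have q22E : q22 = (2 * g12 * q12 - q11 * g22) / g11.
  apply: (mulfI gn0); rewrite [RHS]mulrC divfK//; lra.
have detq : (q12 ^+ 2 - q11 * q22) * g11 ^+ 2 = (g11 * q12 - g12 * q11) ^+ 2 + D * q11 ^+ 2.
  by rewrite q22E g22E; field.
have detp : 0 < q12 ^+ 2 - q11 * q22.
  rewrite -(pmulr_lgt0 _ (exprn_gt0 2 g0)) detq.
  have [q11E|q11n] := eqVneq q11 0.
    have q12n : q12 != 0 by move: q0; rewrite q11E eqxx.
    rewrite q11E !mulr0 subr0 expr0n/= mulr0 addr0 exprMn.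
    by apply: mulr_gt0; rewrite exprn_even_gt0//= lt0r_neq0.
  by rewrite ltr_wpDl ?sqr_ge0// mulr_gt0// exprn_even_gt0//=.
move=> m; have m0 : 0 < m by rewrite divr_gt0.
split=> //; set l := Num.sqrt m => /=.
have l0 : 0 < l by rewrite sqrtr_gt0.
have l2 : l ^+ 2 = m by rewrite sqr_sqrtr// ltW.
have l2D : l ^+ 2 * D = q12 ^+ 2 - q11 * q22 by rewrite l2 divfK// lt0r_neq0.
have l2D' : l ^+ 2 * (g11 * g22 - g12 ^+ 2) = q12 ^+ 2 - q11 * q22 by [].
have lg0 : 0 < l * g11 by rewrite mulr_gt0.
have g22p : 0 < g22.
  by rewrite -(pmulr_rgt0 _ g0); move: D0; rewrite /D; have := sqr_ge0 g12; lra.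
have lg22 : 0 < l * g22 by rewrite mulr_gt0.
have bound q g : 0 < g -> 0 <= (l * g) ^+ 2 - q ^+ 2 -> 0 <= l * g + q /\ 0 <= l * g - q.
  move=> gp; rewrite subr_sqr => H; have lg : 0 < l * g by rewrite mulr_gt0.
  have [qn|qp] := lerP 0 q.
    have s0 : 0 < l * g + q by rewrite ltr_pwDl.
    by split; [exact: ltW | rewrite pmulr_lge0 in H].
  have s0 : 0 < l * g - q by rewrite subr_gt0 (lt_trans qp).
  by split; [rewrite pmulr_rge0 in H | exact: ltW].
have b1 : 0 <= (l * g11) ^+ 2 - q11 ^+ 2.
  rewrite -(pmulr_lge0 _ D0).
  have -> : ((l * g11) ^+ 2 - q11 ^+ 2) * D = (g11 * q12 - g12 * q11) ^+ 2.
    have -> : ((l * g11) ^+ 2 - q11 ^+ 2) * D = (l ^+ 2 * D) * g11 ^+ 2 - q11 ^+ 2 * D.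
      ring.
    by rewrite l2D detq; ring.
  exact: sqr_ge0.
have b2 : 0 <= (l * g22) ^+ 2 - q22 ^+ 2.
  rewrite -(pmulr_lge0 _ D0).
  have -> : ((l * g22) ^+ 2 - q22 ^+ 2) * D = (g22 * q12 - g12 * q22) ^+ 2.
    have -> : ((l * g22) ^+ 2 - q22 ^+ 2) * D = (l ^+ 2 * D) * g22 ^+ 2 - q22 ^+ 2 * D.
      ring.
    rewrite l2D /D; apply/eqP; rewrite -subr_eq0; apply/eqP.
    transitivity (- (q22 * g22) * ((g11 * q22 + q11 * g22) - g12 * (q12 + q12))); first by ring.
    by rewrite tf subrr mulr0.
  exact: sqr_ge0.
have [p1 p2] := bound _ _ g0 b1; have [p3 p4] := bound _ _ g22p b2.
have e1 : (l * g11 + q11) * (l * g22 + q22) = (l * g12 + q12) ^+ 2.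
  apply/eqP; rewrite -subr_eq0; apply/eqP.
  transitivity (l ^+ 2 * (g11 * g22 - g12 ^+ 2) - (q12 ^+ 2 - q11 * q22) +
    l * (g11 * q22 + q11 * g22 - g12 * (q12 + q12))); first by ring.
  by rewrite l2D' tf !subrr mulr0 addr0.
have e2 : (l * g11 - q11) * (l * g22 - q22) = (l * g12 - q12) ^+ 2.
  apply/eqP; rewrite -subr_eq0; apply/eqP.
  transitivity (l ^+ 2 * (g11 * g22 - g12 ^+ 2) - (q12 ^+ 2 - q11 * q22) -
    l * (g11 * q22 + q11 * g22 - g12 * (q12 + q12))); first by ring.
  by rewrite l2D' tf !subrr mulr0 subr0.
(* both diagonal entries cannot vanish, for then [q] would be proportional to [g] *)
have nz k : q11 = k * g11 -> q22 = k * g22 -> q12 = k * g12 -> k != 0 -> False.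
  move=> k1 k2 k3 k0; have : 2 * k * D = 0.
    rewrite /D; transitivity (g11 * q22 + q11 * g22 - g12 * (q12 + q12)).
      by rewrite k1 k2 k3; ring.
    by rewrite tf subrr.
  by apply/eqP; rewrite !mulf_neq0// lt0r_neq0.
split=> //; split=> //; rewrite !lt_neqAle ?p1 ?p2 ?p3 ?p4 !andbT -negb_and;
  apply/negP => /andP[/eqP h1 /eqP h2].
- move: e1; rewrite -h1 mul0r => /esym/eqP; rewrite expf_eq0/= => /eqP h3.
  by apply: (nz (- l)); rewrite ?oppr_eq0 ?(lt0r_neq0 l0)//; lra.
- move: e2; rewrite -h1 mul0r => /esym/eqP; rewrite expf_eq0/= => /eqP h3.
  by apply: (nz l); rewrite ?(lt0r_neq0 l0)//; lra.
Qed.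

(** One diagonal entry is positive near the point; its square root and the off-diagonal
    entry divided by it are the coefficients of a 1-form with the given square. *)
Lemma rank1_sqrt (R : realType) (S : smooth_surface R) (O : set S) (h11 h12 h22 : S -> R) x :
  open O -> O x -> smooth_map O h11 -> smooth_map O h12 -> smooth_map O h22 ->
  (forall y, O y -> h11 y * h22 y = h12 y ^+ 2) ->
  (forall y, O y -> 0 <= h11 y) -> (forall y, O y -> 0 <= h22 y) ->
  (0 < h11 x) || (0 < h22 x) ->
  exists W (t1 t2 : S -> R), [/\ [/\ open W, W x & W `<=` O],
    smooth_map W t1, smooth_map W t2 &
    forall y, W y -> [/\ h11 y = t1 y ^+ 2, h12 y = t1 y * t2 y & h22 y = t2 y ^+ 2]].
Proof.
move=> oO; have pos (h : S -> R) : O x -> smooth_map O h -> 0 < h x ->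
    open (O `&` [set y | 0 < h y]) /\ smooth_map (O `&` [set y | 0 < h y]) h.
  move=> Ox sh hx; split; last by apply: smooth_map_sub sh => y [].
  rewrite openE => y [Oy hy].
  have ch : h z @[z --> y] --> h y := smooth_map_cont sh oO Oy.
  apply: filterI; first exact: open_near.
  exact: (cvgr_gt _ ch).
move=> Ox s11 s12 s22 det p11 p22 /orP[hx|hx].
  have [oW sW] := pos h11 Ox s11 hx; set W := _ `&` _ in oW sW.
  have WO : W `<=` O by exact: subIsetl.
  have p y : W y -> 0 < h11 y by case.
  have st := smooth_map_sqrt oW p sW.
  have st0 y : W y -> Num.sqrt (h11 y) != 0 by move=> Wy; rewrite gt_eqF// sqrtr_gt0 p.
  exists W, (fun y => Num.sqrt (h11 y)), (fun y => h12 y * (Num.sqrt (h11 y))^-1).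
  split=> //; first by apply: smooth_mapM => //; [exact: smooth_map_sub s12 | exact: smooth_mapV].
  move=> y Wy; have s2 : Num.sqrt (h11 y) ^+ 2 = h11 y by rewrite sqr_sqrtr// ltW// p.
  split=> //; first by rewrite mulrC divfK// st0.
  rewrite exprMn exprVn s2 -det; last exact: WO.
  by rewrite mulrAC mulfV ?mul1r// gt_eqF// p.
have [oW sW] := pos h22 Ox s22 hx; set W := _ `&` _ in oW sW.
have WO : W `<=` O by exact: subIsetl.
have p y : W y -> 0 < h22 y by case.
have st := smooth_map_sqrt oW p sW.
have st0 y : W y -> Num.sqrt (h22 y) != 0 by move=> Wy; rewrite gt_eqF// sqrtr_gt0 p.
exists W, (fun y => h12 y * (Num.sqrt (h22 y))^-1), (fun y => Num.sqrt (h22 y)).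
split=> //; first by apply: smooth_mapM => //; [exact: smooth_map_sub s12 | exact: smooth_mapV].
move=> y Wy; have s2 : Num.sqrt (h22 y) ^+ 2 = h22 y by rewrite sqr_sqrtr// ltW// p.
split=> //; last by rewrite divfK// st0.
rewrite exprMn exprVn s2 -det; last exact: WO.
by rewrite mulfK// gt_eqF// p.
Qed.

(** With [a], [b] the duals of a coframe [(t, s)] diagonalising the metric and the
    quadratic differential at once, [d (dF) = 0] and [d eta = 0] paired with [a]
    and [b] force [dt = ds = 0]: the coframe consists of differentials of
    coordinates. What remains of the two equations then says that the mixed second
    derivative of [F] in these coordinates is tangent. *)
Lemma coframe_closed (R : realType) (n : nat) (G : 'M[R]_n.+2) (hG : lorentzian G)
  (f a b a1 a2 b1 b2 : 'rV[R]_n.+2) (l l1 l2 t1 t2 s1 s2 t12 t21 s12 s21 k : R) :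
  0 < l -> ip G f a = 0 -> ip G f b = 0 -> ip G a b = 0 ->
  l * ip G a a = 1 -> l * ip G b b = 1 ->
  l1 * ip G a a + 2 * l * ip G a1 a = 0 -> l2 * ip G a a + 2 * l * ip G a2 a = 0 ->
  l1 * ip G b b + 2 * l * ip G b1 b = 0 -> l2 * ip G b b + 2 * l * ip G b2 b = 0 ->
  t12 *: a + t2 *: a1 + (s12 *: b + s2 *: b1) =
    t21 *: a + t1 *: a2 + (s21 *: b + s1 *: b2) ->
  l1 *: (s2 *: b - t2 *: a) + l *: ((s12 *: b + s2 *: b1) - (t12 *: a + t2 *: a1)) -
  (l2 *: (s1 *: b - t1 *: a) + l *: ((s21 *: b + s1 *: b2) - (t21 *: a + t1 *: a2)))
    = k *: f ->
  [/\ t12 = t21, s12 = s21 &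
    exists x y z, s2 *: b1 - s1 *: b2 = x *: f + y *: a + z *: b].
Proof.
move=> l0 fa fb ab aa bb da1 da2 db1 db2 H1 H2; have ln := lt0r_neq0 l0.
have ba : ip G b a = 0 by rewrite ipC.
have i1 := congr1 (ip G ^~ a) H1; have i2 := congr1 (ip G ^~ b) H1.
have j1 := congr1 (ip G ^~ a) H2; have j2 := congr1 (ip G ^~ b) H2.
move: i1 i2 j1 j2 aa bb da1 da2 db1 db2; rewrite /= !ipE ab ba fa fb.
move: (ip G a1 a) (ip G a2 a) (ip G b1 b) (ip G b2 b) (ip G a1 b) (ip G a2 b) (ip G b1 a) (ip G b2 a).
move: (ip G a a) (ip G b b) => m m' A1 A2 B1 B2 C1 C2 D1 D2 i1 i2 j1 j2 lm lm' da1 da2 db1 db2.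
have tE : t12 = t21.
  apply/eqP; rewrite -subr_eq0; apply/eqP.
  have : - 2 * (l * m) * (t12 - t21) = 0; last by rewrite lm; lra.
  have e1 := congr1 (fun z => l * z) i1; have e2 := congr1 (fun z => t2 * z) da1.
  have e3 := congr1 (fun z => t1 * z) da2; move: e1 e2 e3 j1; rewrite /=; lra.
have sE : s12 = s21.
  apply/eqP; rewrite -subr_eq0; apply/eqP.
  have : 2 * (l * m') * (s12 - s21) = 0; last by rewrite lm'; lra.
  have e1 := congr1 (fun z => l * z) i2; have e2 := congr1 (fun z => s2 * z) db1.
  have e3 := congr1 (fun z => s1 * z) db2; move: e1 e2 e3 j2; rewrite /=; lra.
split=> //; subst t12 s12.
exists ((2 * l)^-1 * k), ((2 * l)^-1 * (l1 * t2 - l2 * t1)), ((2 * l)^-1 * (l2 * s1 - l1 * s2)).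
have l20 : 2 * l != 0 by rewrite mulf_neq0// pnatr_eq0.
apply: (scalerI l20); rewrite !scalerDr !scalerA !mulrA !mulfV// !mul1r -H2.
apply/rowP => i; have := congr1 (fun v : 'rV[R]_n.+2 => l * v 0 i) H1; rewrite !mxE; lra.
Qed.

(** The frame dual to a coframe [(t, s)] diagonalising the metric and the quadratic
    differential. *)
Lemma dual_frame (R : realType) (n : nat) (G : 'M[R]_n.+2) (hG : lorentzian G)
  (f u v z1 z2 : 'rV[R]_n.+2) (l t1 t2 s1 s2 : R)
  (D := t1 * s2 - t2 * s1) (a := D^-1 *: (s2 *: u - s1 *: v))
  (b := D^-1 *: (t1 *: v - t2 *: u)) : frame G f u v -> 0 < l ->
  l * ip G u u = t1 ^+ 2 + s1 ^+ 2 -> l * ip G u v = t1 * t2 + s1 * s2 ->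
  l * ip G v v = t2 ^+ 2 + s2 ^+ 2 ->
  z1 \in (<[f]> + <[u]> + <[v]>)%VS -> z2 \in (<[f]> + <[u]> + <[v]>)%VS ->
  ip G z1 u = s1 ^+ 2 - t1 ^+ 2 -> ip G z1 v = s1 * s2 - t1 * t2 ->
  ip G z2 u = s1 * s2 - t1 * t2 -> ip G z2 v = s2 ^+ 2 - t2 ^+ 2 ->
  D != 0 /\ [/\ u = t1 *: a + s1 *: b, v = t2 *: a + s2 *: b,
    [/\ l * ip G a a = 1, l * ip G b b = 1, ip G a b = 0, ip G f a = 0 & ip G f b = 0],
    z1 - l *: (s1 *: b - t1 *: a) \in <[f]>%VS &
    z2 - l *: (s2 *: b - t2 *: a) \in <[f]>%VS].
Proof.
move=> fr l0 uu uv vv z1T z2T z1u z1v z2u z2v; have ln := lt0r_neq0 l0.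
have [ff fu fv _] := fr.
have D0 : D != 0.
  rewrite -sqrf_eq0; suff -> : D ^+ 2 = l ^+ 2 * (ip G u u * ip G v v - ip G u v ^+ 2).
    by rewrite mulf_neq0 ?expf_neq0// lt0r_neq0// (frame_det hG fr).
  transitivity ((l * ip G u u) * (l * ip G v v) - (l * ip G u v) ^+ 2); last by ring.
  by rewrite uu uv vv /D; ring.
have uE : u = t1 *: a + s1 *: b.
  rewrite /a /b /D; apply/rowP => i; rewrite !mxE.
  by move: (D0); rewrite /D => D0'; field.
have vE : v = t2 *: a + s2 *: b.
  rewrite /a /b /D; apply/rowP => i; rewrite !mxE.
  by move: (D0); rewrite /D => D0'; field.
have fa : ip G f a = 0 by rewrite /a !ipE fu fv !mulr0 subr0 mulr0.
have fb : ip G f b = 0 by rewrite /b !ipE fu fv !mulr0 subr0 mulr0.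
have guu : ip G u u = (t1 ^+ 2 + s1 ^+ 2) / l by rewrite -uu mulrAC mulfV// mul1r.
have guv : ip G u v = (t1 * t2 + s1 * s2) / l by rewrite -uv mulrAC mulfV// mul1r.
have gvv : ip G v v = (t2 ^+ 2 + s2 ^+ 2) / l by rewrite -vv mulrAC mulfV// mul1r.
have D0' : t1 * s2 - t2 * s1 != 0 by [].
have aa : l * ip G a a = 1.
  rewrite /a !ipE (ipC hG v u) guu guv gvv /D; field; exact/andP.
have bb : l * ip G b b = 1.
  rewrite /b !ipE (ipC hG v u) guu guv gvv /D; field; exact/andP.
have ab : ip G a b = 0.
  rewrite /a /b !ipE (ipC hG v u) guu guv gvv /D; field; exact/andP.
have aaE : ip G a a = l^-1 by apply: (mulfI ln); rewrite aa mulfV.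
have bbE : ip G b b = l^-1 by apply: (mulfI ln); rewrite bb mulfV.
have ba : ip G b a = 0 by rewrite ipC.
have inT x y : x *: a + y *: b \in (<[f]> + <[u]> + <[v]>)%VS.
  apply/memv_sum3P; exists 0, (D^-1 * (x * s2 - y * t2)), (D^-1 * (y * t1 - x * s1)).
  by rewrite /a /b; apply/rowP => i; rewrite !mxE; ring.
clearbody a b D.
have prod s t x y : ip G (x *: a + y *: b) (l *: (s *: b - t *: a)) = y * s - x * t.
  rewrite !ipE ab ba aaE bbE; field; exact: ln.
have mem s t z : z \in (<[f]> + <[u]> + <[v]>)%VS ->
    ip G z u = s1 * s - t1 * t -> ip G z v = s2 * s - t2 * t ->
    z - l *: (s *: b - t *: a) \in <[f]>%VS.
  move=> zT zu zv; apply: (frame_line hG fr).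
  - apply: memvB => //; apply: memvZ; rewrite addrC -scaleNr; exact: inT.
  - by rewrite ipDr ipNr (ipC hG u z) zu uE prod subrr.
  - by rewrite ipDr ipNr (ipC hG v z) zv vE prod subrr.
split=> //; split=> //.
  by apply: mem; rewrite // ?z1u ?z1v; ring.
by apply: mem; rewrite // ?z2u ?z2v; ring.
Qed.

Section Coframe.
Variables (R : realType) (n : nat) (G : 'M[R]_n.+2) (S : smooth_surface R).
Hypothesis hG : lorentzian G.
Local Notation V := 'rV[R]_n.+2.
Variables (E hE : S -> {vspace V}) (eta : preform S 'M[R]_n.+2) (m : R).
Hypothesis hiso : isothermic G E eta.
Hypothesis hdar : darboux_transform G E eta m hE.
Variables (O : set S) (F H : S -> V) (c : chart R S).
Hypotheses (lF : lift E O F) (lH : lift hE O H) (Ac : atlas S c) (Oc : O `<=` dom c).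

Let Fu := dmap c F (du R).
Let Fv := dmap c F (dv R).
Let oO : open O. Proof. by have [[]] := lF. Qed.
Let sF : smooth_map O F. Proof. by have [[]] := lF. Qed.

Let sFu : smooth_map O Fu.
Proof. by apply: smooth_map_sub (smooth_map_dmap (du R) Ac oO sF) => y Oy; split=> //; exact: Oc. Qed.

Let sFv : smooth_map O Fv.
Proof. by apply: smooth_map_sub (smooth_map_dmap (dv R) Ac oO sF) => y Oy; split=> //; exact: Oc. Qed.

Let zu := zeta G eta F H c (du R).
Let zv := zeta G eta F H c (dv R).
Let szu : smooth_map O zu := smooth_zeta hG hiso hdar lF lH Ac Oc (du R).
Let szv : smooth_map O zv := smooth_zeta hG hiso hdar lF lH Ac Oc (dv R).

Let g11 y := ip G (Fu y) (Fu y).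
Let g12 y := ip G (Fu y) (Fv y).
Let g22 y := ip G (Fv y) (Fv y).
Let q11 y := - ip G (zu y) (Fu y).
Let q12 y := - ip G (zu y) (Fv y).
Let q22 y := - ip G (zv y) (Fv y).
Let l y := Num.sqrt ((q12 y ^+ 2 - q11 y * q22 y) / (g11 y * g22 y - g12 y ^+ 2)).

Let fr y : O y -> frame G (F y) (Fu y) (Fv y).
Proof. exact: (darboux_frame hG hiso lF Ac Oc). Qed.

Let tf y : O y -> g11 y * q22 y + q11 y * g22 y = g12 y * (q12 y + q12 y).
Proof.
move=> Oy; have := zeta_tracefree hG hiso hdar lF lH Ac Oc Oy.
rewrite (zeta_symmetric hG hiso hdar lF lH Ac Oc Oy).
have neg (a b d e k r : R) : a * b + d * e = k * (r + r) ->
    a * - b + - d * e = k * (- r + - r) by move=> H0; lra.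
exact: neg.
Qed.

Let q0 y : O y -> (q11 y != 0) || (q12 y != 0).
Proof.
move=> Oy; have or0 (a b : R) : (a = 0 -> b = 0 -> False) -> (- a != 0) || (- b != 0).
  move=> H0; rewrite -negb_and !oppr_eq0; apply/negP => /andP[/eqP h1 /eqP h2]; exact: H0.
apply: or0 => h1 h2.
have zT := zeta_first_derived hG hiso hdar lF lH Ac Oc Oy (or_introl erefl).
have /vlineP[k zk] : zu y \in <[F y]>%VS.
  exact: (frame_line hG (fr Oy) zT (etrans (ipC hG _ _) h1) (etrans (ipC hG _ _) h2)).
have [|/eqP] := zeta_free hG hiso hdar lF lH Ac Oc (a := 1) (b := 0) (k := k) Oy.
  by rewrite scale1r scale0r addr0.
by rewrite oner_eq0.
Qed.

Let split y (Oy : O y) := tracefree_split (frame_pos1 hG (fr Oy))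
  (frame_det hG (fr Oy)) (tf Oy) (q0 Oy).

(** With [g] the metric, [q] the quadratic differential of [zeta] and [l] as in
    [tracefree_split], the forms [l g + q] and [l g - q] are twice the squares of two
    1-forms [(t1, t2)] and [(s1, s2)]; [A], [B] is the dual frame, on which [eta] is
    diagonal. *)
Lemma coframe x : O x -> exists W (t1 t2 s1 s2 l : S -> R) (A B : S -> V),
  [/\ [/\ open W, W x & W `<=` O],
    [/\ smooth_map W t1, smooth_map W t2, smooth_map W s1 & smooth_map W s2],
    [/\ smooth_map W l, smooth_map W A & smooth_map W B] &
    forall y, W y -> [/\ 0 < l y, t1 y * s2 y - t2 y * s1 y != 0,
      Fu y = t1 y *: A y + s1 y *: B y /\ Fv y = t2 y *: A y + s2 y *: B y,
      [/\ l y * ip G (A y) (A y) = 1, l y * ip G (B y) (B y) = 1,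
        ip G (A y) (B y) = 0, ip G (F y) (A y) = 0 & ip G (F y) (B y) = 0] &
      [/\ forall w, w *m eta c y (du R) =
           ip G (F y) w *: (l y *: (s1 y *: B y - t1 y *: A y)) -
           ip G (l y *: (s1 y *: B y - t1 y *: A y)) w *: F y &
         forall w, w *m eta c y (dv R) =
           ip G (F y) w *: (l y *: (s2 y *: B y - t2 y *: A y)) -
           ip G (l y *: (s2 y *: B y - t2 y *: A y)) w *: F y]]].
Proof.
move=> Ox; have sg11 : smooth_map O g11 := smooth_map_ip G oO sFu sFu.
have sg12 : smooth_map O g12 := smooth_map_ip G oO sFu sFv.
have sg22 : smooth_map O g22 := smooth_map_ip G oO sFv sFv.
have sq11 : smooth_map O q11 := smooth_mapN oO (smooth_map_ip G oO szu sFu).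
have sq12 : smooth_map O q12 := smooth_mapN oO (smooth_map_ip G oO szu sFv).
have sq22 : smooth_map O q22 := smooth_mapN oO (smooth_map_ip G oO szv sFv).
have sB f g : smooth_map O f -> smooth_map O g -> smooth_map O (fun y => f y - g y).
  by move=> sf sg; apply: smooth_mapD => //; exact: smooth_mapN.
have sX (f : S -> R) : smooth_map O f -> smooth_map O (fun y => f y ^+ 2).
  by move=> sf; exact: smooth_mapM.
have sl : smooth_map O l.
  apply: smooth_map_sqrt => // [y Oy|]; first by have [] := split Oy.
  apply: smooth_mapM => //; first by apply: sB; [exact: sX | exact: smooth_mapM].
  apply: smooth_mapV => // [y Oy|]; first exact: lt0r_neq0 (frame_det hG (fr Oy)).
  by apply: sB; [exact: smooth_mapM | exact: sX].
have sc2 := @smooth_map_cst _ S R O 2^-1.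
have sh f g : smooth_map O f -> smooth_map O g ->
    smooth_map O (fun y => (l y * f y + g y) * 2^-1).
  by move=> sf sg; apply: smooth_mapM => //; apply: smooth_mapD => //; exact: smooth_mapM.
have sk f g : smooth_map O f -> smooth_map O g ->
    smooth_map O (fun y => (l y * f y - g y) * 2^-1).
  by move=> sf sg; apply: sh => //; exact: smooth_mapN.
have n2 : 0 <= 2^-1 :> R by [].
have p2 : 0 < 2^-1 :> R by [].
have det a b d : a * b = d ^+ 2 -> (a * 2^-1) * (b * 2^-1) = (d * 2^-1) ^+ 2 :> R.
  by move=> E'; rewrite exprMn -E'; ring.
have pos a b : (0 < a) || (0 < b) -> (0 < a * 2^-1) || (0 < b * 2^-1) :> bool.
  by rewrite !pmulr_lgt0.
have [W1 [t1 [t2 [[oW1 W1x W1O] st1 st2 tP]]]] :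
    exists W (t1 t2 : S -> R), [/\ [/\ open W, W x & W `<=` O],
    smooth_map W t1, smooth_map W t2 &
    forall y, W y -> [/\ (l y * g11 y + q11 y) * 2^-1 = t1 y ^+ 2,
      (l y * g12 y + q12 y) * 2^-1 = t1 y * t2 y &
      (l y * g22 y + q22 y) * 2^-1 = t2 y ^+ 2]].
  apply: (rank1_sqrt oO Ox (sh _ _ sg11 sq11) (sh _ _ sg12 sq12) (sh _ _ sg22 sq22)).
  - by move=> y Oy; have [_ [e1 _ _ _]] := split Oy; exact: det.
  - by move=> y Oy; have [_ [_ _ [p _ _] _]] := split Oy; rewrite pmulr_lge0.
  - by move=> y Oy; have [_ [_ _ [_ p _] _]] := split Oy; rewrite pmulr_lge0.
  - by have [_ [_ _ [_ _ p] _]] := split Ox; exact: pos.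
have [W2 [s1 [s2 [[oW2 W2x W2O] ss1 ss2 sP]]]] :
    exists W (t1 t2 : S -> R), [/\ [/\ open W, W x & W `<=` O],
    smooth_map W t1, smooth_map W t2 &
    forall y, W y -> [/\ (l y * g11 y - q11 y) * 2^-1 = t1 y ^+ 2,
      (l y * g12 y - q12 y) * 2^-1 = t1 y * t2 y &
      (l y * g22 y - q22 y) * 2^-1 = t2 y ^+ 2]].
  apply: (rank1_sqrt oO Ox (sk _ _ sg11 sq11) (sk _ _ sg12 sq12) (sk _ _ sg22 sq22)).
  - by move=> y Oy; have [_ [_ e2 _ _]] := split Oy; exact: det.
  - by move=> y Oy; have [_ [_ _ _ [p _ _]]] := split Oy; rewrite pmulr_lge0.
  - by move=> y Oy; have [_ [_ _ _ [_ p _]]] := split Oy; rewrite pmulr_lge0.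
  - by have [_ [_ _ _ [_ _ p]]] := split Ox; exact: pos.
pose W := W1 `&` W2; have oW : open W by exact: openI.
have WO : W `<=` O by move=> y [/W1O].
have WW1 : W `<=` W1 by move=> y [].
have WW2 : W `<=` W2 by move=> y [].
pose D y := t1 y * s2 y - t2 y * s1 y.
pose A y := (D y)^-1 *: (s2 y *: Fu y - s1 y *: Fv y).
pose B y := (D y)^-1 *: (t1 y *: Fv y - t2 y *: Fu y).
have half (a q t s : R) : (a + q) * 2^-1 = t -> (a - q) * 2^-1 = s -> a = t + s /\ q = t - s.
  by move=> <- <-; split; lra.
have neg (a b d : R) : - a = b - d -> a = d - b by lra.
have dual y : W y -> D y != 0 /\ [/\ Fu y = t1 y *: A y + s1 y *: B y,
    Fv y = t2 y *: A y + s2 y *: B y,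
    [/\ l y * ip G (A y) (A y) = 1, l y * ip G (B y) (B y) = 1,
      ip G (A y) (B y) = 0, ip G (F y) (A y) = 0 & ip G (F y) (B y) = 0],
    zu y - l y *: (s1 y *: B y - t1 y *: A y) \in <[F y]>%VS &
    zv y - l y *: (s2 y *: B y - t2 y *: A y) \in <[F y]>%VS].
  move=> Wy; have Oy := WO y Wy.
  have [e1 e2 e3] := tP y (WW1 y Wy); have [e4 e5 e6] := sP y (WW2 y Wy).
  have l0 : 0 < l y by have [+ _] := split Oy; rewrite sqrtr_gt0.
  have zs : q12 y = - ip G (zv y) (Fu y) :=
    esym (congr1 -%R (zeta_symmetric hG hiso hdar lF lH Ac Oc Oy)).
  have [e11 f11] := half _ _ _ _ e1 e4; have [e12 f12] := half _ _ _ _ e2 e5.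
  have [e22 f22] := half _ _ _ _ e3 e6.
  have zuT := zeta_first_derived hG hiso hdar lF lH Ac Oc Oy (or_introl erefl).
  have zvT := zeta_first_derived hG hiso hdar lF lH Ac Oc Oy (or_intror erefl).
  exact: (dual_frame hG (fr Oy) l0 e11 e12 e22 zuT zvT (neg _ _ _ f11)
    (neg _ _ _ f12) (neg _ _ _ (etrans (esym zs) f12)) (neg _ _ _ f22)).
have st1W := smooth_map_sub WW1 st1; have st2W := smooth_map_sub WW1 st2.
have ss1W := smooth_map_sub WW2 ss1; have ss2W := smooth_map_sub WW2 ss2.
have sFuW := smooth_map_sub WO sFu; have sFvW := smooth_map_sub WO sFv.
have sD : smooth_map W D.
  by apply: smooth_mapD => //; [|apply: smooth_mapN => //]; exact: smooth_mapM.
have sDV : smooth_map W (fun y => (D y)^-1).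
  by apply: smooth_mapV => // y /dual[].
have sA : smooth_map W A.
  apply: smooth_mapZ => //; apply: smooth_mapD => //; first exact: smooth_mapZ.
  by apply: smooth_mapN => //; exact: smooth_mapZ.
have sB' : smooth_map W B.
  apply: smooth_mapZ => //; apply: smooth_mapD => //; first exact: smooth_mapZ.
  by apply: smooth_mapN => //; exact: smooth_mapZ.
exists W, t1, t2, s1, s2, l, A, B; split=> //.
- by split=> //; exact: smooth_map_sub sl.
move=> y Wy; have Oy := WO y Wy; have [D0 [uE vE ips zuF zvF]] := dual y Wy.
have l0 : 0 < l y by have [+ _] := split Oy; rewrite sqrtr_gt0.
have shift z Z w : z - Z \in <[F y]>%VS ->
    ip G (F y) w *: z - ip G z w *: F y = ip G (F y) w *: Z - ip G Z w *: F y.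
  move=> /vlineP[k /eqP]; rewrite subr_eq => /eqP ->; rewrite ipDl ipZl.
  by move: (ip G (F y) w) (ip G Z w) => a b; apply/rowP => i; rewrite !mxE; ring.
split=> //; split=> w.
  rewrite (eta_zeta hG hiso hdar lF lH Ac Oc (du R) Oy w); exact: shift.
rewrite (eta_zeta hG hiso hdar lF lH Ac Oc (dv R) Oy w); exact: shift.
Qed.

End Coframe.

Lemma smooth_potential (R : realType) (Q : set 'rV[R]_2) (u a b : 'rV[R]_2 -> R) :
  open Q -> (forall p, Q p -> differentiable u p /\
    forall v, 'D_v u p = v 0 0 * a p + v 0 1 * b p) ->
  smooth_on Q a -> smooth_on Q b -> smooth_on Q u.
Proof.
move=> oQ uP sa sb; suff s1 k : Ck k.+1 Q u by move=> k; exact: CkW.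
split=> [p /uP[]//|v].
apply: (@Ck_eq _ _ _ _ _ (fun p => v 0 0 * a p + v 0 1 * b p)) => // [p /uP[_ ->]//|].
by apply: Ck_add => //; apply: Ck_mul => //; exact: Ck_cst.
Qed.

Section ChartChange.
Variables (R : realType) (S : smooth_surface R).
Local Notation P := 'rV[R]_2.
Variables (c : chart R S) (U : set P) (phi psi : P -> P).
Hypotheses (Ac : atlas S c) (oU : open U) (Uc : U `<=` fwd c @` dom c)
  (sphi : smooth_on U phi) (oI : open (phi @` U))
  (psiK : forall p, U p -> psi (phi p) = p) (spsi : smooth_on (phi @` U) psi).

(** The new chart belongs to the atlas because the atlas is maximal. *)
Lemma chart_after_diffeo : exists c', [/\ atlas S c',
  dom c' = dom c `&` [set y | U (fwd c y)], fwd c' = phi \o fwd c & bwd c' = bwd c \o psi].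
Proof.
pose D := dom c `&` [set y | U (fwd c y)]; pose f' := phi \o fwd c; pose b' := bwd c \o psi.
have oD : open D.
  rewrite openE => y [cy Uy]; apply: filterI; first exact: open_near (@dom_open _ _ c) cy.
  have cf : fwd c z @[z --> y] --> fwd c y := fwd_continuous cy.
  by have := cf U (open_near oU Uy).
have fD : f' @` D = phi @` U.
  apply/seteqP; split=> [_ [y [cy Uy] <-]|_ [p Up <-]]; first by exists (fwd c y).
  by have [y cy yp] := Uc Up; exists y; rewrite /f'/= ?yp//; split=> //=; rewrite yp.
have oI' : open (f' @` D) by rewrite fD.
have fK y : D y -> b' (f' y) = y by move=> [cy Uy]; rewrite /b' /f'/= psiK// fwdK.
have fc y : D y -> {for y, continuous f'}.
  move=> [cy Uy]; apply: (@continuous_comp _ _ _ (fwd c) phi); first exact: fwd_continuous.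
  exact: (sphi 0).
have bc z : (f' @` D) z -> {for z, continuous b'}.
  rewrite fD => Iz; apply: (@continuous_comp _ _ _ psi (bwd c)); first exact: (spsi 0).
  by apply: bwd_continuous; have [p Up <-] := Iz; rewrite psiK//; exact: Uc.
pose c' := Chart oD oI' fK fc bc.
exists c'; split=> //; apply/(atlasP S).2 => c2 Ac2.
have [tr1 tr2] := ((atlasP S).2 c).1 Ac c2 Ac2; split=> k.
  have o1 := open_chart_img (c := c') (@dom_open _ _ c2).
  have o2 := open_chart_img (c := c) (@dom_open _ _ c2).
  apply: (Ck_comp (g := psi) (f := fwd c2 \o bwd c) o1 o2 _ _ (tr1 k)).
    move=> _ [y [[cy Uy] c2y] <-]; exists y => //.
    by rewrite /= psiK.
  apply: Ck_sub (spsi k) => _ [y [[cy Uy] c2y] <-]; by exists (fwd c y).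
have o1 := open_chart_img (c := c2) (@dom_open _ _ c').
apply: (Ck_comp (g := fwd c \o bwd c2) (f := phi) o1 oU _ _ (sphi k)).
  by move=> _ [y [c2y [cy Uy]] <-]; rewrite /= fwdK.
by apply: Ck_sub (tr2 k) => _ [y [c2y [cy Uy]] <-]; exists y.
Qed.

Lemma diffeo_dmap_fwd c' y v : dom c' = dom c `&` [set y | U (fwd c y)] ->
  fwd c' = phi \o fwd c -> bwd c' = bwd c \o psi -> dom c' y ->
  'D_(dmap c' (fwd c) v y) phi (fwd c y) = v.
Proof.
move=> dE fE bE; rewrite dE => -[cy Uy].
have Iy : (phi @` U) (phi (fwd c y)) by exists (fwd c y).
have dpsi : differentiable psi (phi (fwd c y)) by have [+ _] := spsi 1; apply.
have dphi : differentiable phi (psi (phi (fwd c y))).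
  by rewrite psiK//; have [+ _] := sphi 1; apply.
have -> : dmap c' (fwd c) v y = 'D_v psi (phi (fwd c y)).
  rewrite /dmap fE bE; apply: near_eq_derive.
  apply: filterS (open_near oI Iy) => _ [p Up <-]; rewrite /= psiK//.
  by have [y' cy' <-] := Uc Up; rewrite fwdK.
have H := derive_comp v dpsi dphi; rewrite psiK// in H; rewrite -H.
rewrite -[RHS](derive_id (phi (fwd c y)) v); apply: near_eq_derive.
by apply: filterS (open_near oI Iy) => _ [p Up <-]; rewrite /= psiK.
Qed.

End ChartChange.

(** Applying [d eta = 0] to a vector not orthogonal to the lift leaves the exterior
    derivative of [zeta], which is thus a multiple of the lift. *)
Lemma closed_mixed (R : realType) (n : nat) (G : 'M[R]_n.+2)
  (f w a b p q : 'rV[R]_n.+2) (t1 t2 s1 s2 l : R)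
  (z1 := l *: (s1 *: b - t1 *: a)) (z2 := l *: (s2 *: b - t2 *: a)) :
  ip G f w != 0 ->
  ip G (t1 *: a + s1 *: b) w *: z2 + ip G f w *: p -
    (ip G p w *: f + ip G z2 w *: (t1 *: a + s1 *: b)) =
  ip G (t2 *: a + s2 *: b) w *: z1 + ip G f w *: q -
    (ip G q w *: f + ip G z1 w *: (t2 *: a + s2 *: b)) ->
  exists k, p - q = k *: f.
Proof.
move=> fw cl; exists ((ip G f w)^-1 * (ip G p w - ip G q w)); apply: (scalerI fw).
rewrite scalerA mulrA mulfV// mul1r; apply/eqP; rewrite -subr_eq0; apply/eqP.
move/eqP: cl; rewrite -subr_eq0 => /eqP <-; rewrite /z1 /z2 !ipE.
move: (ip G f w) (ip G a w) (ip G b w) (ip G p w) (ip G q w) => ? ? ? ? ?.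
by apply/rowP => i; rewrite !mxE; ring.
Qed.

Section CoframeChart.
Variables (R : realType) (n : nat) (G : 'M[R]_n.+2) (S : smooth_surface R).
Hypothesis hG : lorentzian G.
Local Notation V := 'rV[R]_n.+2.
Local Notation P := 'rV[R]_2.
Variables (E hE : S -> {vspace V}) (eta : preform S 'M[R]_n.+2) (m : R).
Hypothesis hiso : isothermic G E eta.
Hypothesis hdar : darboux_transform G E eta m hE.
Variables (W : set S) (F H : S -> V) (c : chart R S).
Hypotheses (lF : lift E W F) (lH : lift hE W H) (Ac : atlas S c) (Wc : W `<=` dom c).
Variables (t1 t2 s1 s2 l : S -> R) (A B : S -> V).
Hypotheses (st1 : smooth_map W t1) (st2 : smooth_map W t2)
  (ss1 : smooth_map W s1) (ss2 : smooth_map W s2) (sl : smooth_map W l)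
  (sA : smooth_map W A) (sB : smooth_map W B).
Local Notation Fu := (dmap c F (du R)).
Local Notation Fv := (dmap c F (dv R)).
Hypotheses (l0 : forall y, W y -> 0 < l y)
  (D0 : forall y, W y -> t1 y * s2 y - t2 y * s1 y != 0)
  (FuE : forall y, W y -> Fu y = t1 y *: A y + s1 y *: B y)
  (FvE : forall y, W y -> Fv y = t2 y *: A y + s2 y *: B y)
  (AA : forall y, W y -> l y * ip G (A y) (A y) = 1)
  (BB : forall y, W y -> l y * ip G (B y) (B y) = 1)
  (AB : forall y, W y -> ip G (A y) (B y) = 0)
  (FA : forall y, W y -> ip G (F y) (A y) = 0)
  (FB : forall y, W y -> ip G (F y) (B y) = 0).
Let Z1 y := l y *: (s1 y *: B y - t1 y *: A y).
Let Z2 y := l y *: (s2 y *: B y - t2 y *: A y).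
Hypotheses
  (eta1 : forall y, W y -> forall w,
     w *m eta c y (du R) = ip G (F y) w *: Z1 y - ip G (Z1 y) w *: F y)
  (eta2 : forall y, W y -> forall w,
     w *m eta c y (dv R) = ip G (F y) w *: Z2 y - ip G (Z2 y) w *: F y).

Let oW : open W. Proof. by have [[]] := lF. Qed.
Let sF : smooth_map W F. Proof. by have [[]] := lF. Qed.

Let sD (f g : S -> R) (X Y : S -> V) : smooth_map W f -> smooth_map W g -> smooth_map W X ->
  smooth_map W Y -> smooth_map W (fun y => f y *: X y + g y *: Y y).
Proof. by move=> sf sg sX sY; apply: (smooth_mapD oW); apply: (smooth_mapZ oW). Qed.

Let dD (f g : S -> R) (X Y : S -> V) y v : W y -> smooth_map W f -> smooth_map W g ->
  smooth_map W X -> smooth_map W Y ->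
  dmap c (fun y => f y *: X y + g y *: Y y) v y =
  dmap c f v y *: X y + f y *: dmap c X v y + (dmap c g v y *: Y y + g y *: dmap c Y v y).
Proof.
move=> Wy sf sg sX sY; have cy := Wc Wy.
rewrite (dmapD v (smooth_mapZ oW sf sX) (smooth_mapZ oW sg sY) Ac cy Wy).
by rewrite (dmapZ v sf sX Ac cy Wy) (dmapZ v sg sY Ac cy Wy).
Qed.

Let sN (f : S -> R) : smooth_map W f -> smooth_map W (fun y => - f y).
Proof. exact: smooth_mapN. Qed.

Let ZE (f g : S -> R) y : l y *: (g y *: B y - f y *: A y) =
  l y *: ((g y *: B y) + (- f y) *: A y).
Proof. by rewrite scaleNr. Qed.

Let sZ (f g : S -> R) : smooth_map W f -> smooth_map W g ->
  smooth_map W (fun y => l y *: (g y *: B y - f y *: A y)).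
Proof.
move=> sf sg; apply: (smooth_map_eq oW (fun y _ => esym (ZE f g y))).
by apply: (smooth_mapZ oW) => //; apply: sD => //; exact: sN.
Qed.

Let dZ (f g : S -> R) y v : W y -> smooth_map W f -> smooth_map W g ->
  dmap c (fun y => l y *: (g y *: B y - f y *: A y)) v y =
  dmap c l v y *: (g y *: B y - f y *: A y) + l y *: (
   (dmap c g v y *: B y + g y *: dmap c B v y) - (dmap c f v y *: A y + f y *: dmap c A v y)).
Proof.
move=> Wy sf sg; have cy := Wc Wy.
have sBA := sD sg (sN sf) sB sA.
rewrite (dmap_eq v oW Wy cy (fun y _ => ZE f g y)).
rewrite (dmapZ v sl sBA Ac cy Wy) (dD v Wy sg (sN sf) sB sA) (dmapN v sf Ac cy Wy).
by rewrite !scaleNr -opprD.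
Qed.

Let dnorm (X : S -> V) y v : W y -> smooth_map W X ->
  (forall y, W y -> l y * ip G (X y) (X y) = 1) ->
  dmap c l v y * ip G (X y) (X y) + 2 * l y * ip G (dmap c X v y) (X y) = 0.
Proof.
move=> Wy sX XX; have cy := Wc Wy; have sXX := smooth_map_ip G oW sX sX.
have := dmapM v sl sXX Ac cy Wy; rewrite (dmap_eq v oW Wy cy XX) dmap_cst.
rewrite (dmap_ip G v oW sX sX Ac cy Wy) (ipC hG (X y) (dmap c X v y)).
by move: (dmap c l v y) (ip G (dmap c X v y) (X y)) => a b ->; ring.
Qed.

Lemma coframe_exact y : W y ->
  [/\ dmap c t2 (du R) y = dmap c t1 (dv R) y,
      dmap c s2 (du R) y = dmap c s1 (dv R) y &
      exists a b d, s2 y *: dmap c B (du R) y - s1 y *: dmap c B (dv R) y =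
        a *: F y + b *: A y + d *: B y].
Proof.
move=> Wy; have cy := Wc Wy.
have H1 := dmapC (du R) (dv R) sF oW Ac cy Wy.
rewrite (dmap_eq _ oW Wy cy FuE) (dmap_eq _ oW Wy cy FvE) in H1.
rewrite (dD _ Wy st1 ss1 sA sB) (dD _ Wy st2 ss2 sA sB) in H1.
have cl := eta_closed hiso lF Wy Ac Wc (sZ st1 ss1) (sZ st2 ss2) eta1 eta2 (H y).
have Fw := darboux_ip hG hiso hdar lF lH Wy.
have [k H2] : exists k, dmap c Z2 (du R) y - dmap c Z1 (dv R) y = k *: F y.
  by move: cl; rewrite (FuE Wy) (FvE Wy); exact: closed_mixed.
rewrite (dZ _ Wy st1 ss1) (dZ _ Wy st2 ss2) in H2.
exact: (coframe_closed hG (l0 Wy) (FA Wy) (FB Wy) (AB Wy) (AA Wy) (BB Wy)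
  (dnorm _ Wy sA AA) (dnorm _ Wy sA AA) (dnorm _ Wy sB BB) (dnorm _ Wy sB BB) (esym H1) H2).
Qed.

(** The closed forms [(t1, t2)] and [(s1, s2)] have local primitives; they are the
    coordinates of a chart in which the partial derivatives of [F] are [A] and [B]. *)
Lemma coframe_chart x : W x -> exists c' (theta : S -> R),
  isothermic_coordinates G E eta c' F theta /\ dom c' x.
Proof.
move=> Wx; have oI : open (fwd c @` W) by rewrite -(chart_img_sub Wc); exact: open_chart_img.
have Ix : (fwd c @` W) (fwd c x) by exists x.
have sI (f : S -> R) : smooth_map W f -> smooth_on (fwd c @` W) (f \o bwd c).
  by move=> sf; rewrite -(chart_img_sub Wc); exact: sf.
have ct p : (fwd c @` W) p -> 'D_(dv R) (t1 \o bwd c) p = 'D_(du R) (t2 \o bwd c) p.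
  by move=> [y Wy <-]; have [+ _ _] := coframe_exact Wy; exact: esym.
have cs p : (fwd c @` W) p -> 'D_(dv R) (s1 \o bwd c) p = 'D_(du R) (s2 \o bwd c) p.
  by move=> [y Wy <-]; have [_ + _] := coframe_exact Wy; exact: esym.
have [r1 r10 [rW1 [u1 u1P]]] := poincare oI Ix (sI _ st1) (sI _ st2) ct.
have [r2 r20 [rW2 [u2 u2P]]] := poincare oI Ix (sI _ ss1) (sI _ ss2) cs.
pose r := Num.min r1 r2; have r0 : 0 < r by rewrite lt_min r10.
have B1 p : ball (fwd c x) r p -> ball (fwd c x) r1 p.
  by apply: le_ball; rewrite ge_min lexx.
have B2 p : ball (fwd c x) r p -> ball (fwd c x) r2 p.
  by apply: le_ball; rewrite ge_min lexx orbT.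
pose Q := ball (fwd c x) r; have oQ : open Q by exact: ball_open.
have QW : Q `<=` fwd c @` W by move=> p /B1/rW1.
pose phi p := pt (u1 p) (u2 p).
have Qx : Q (fwd c x) by exact: ballxx.
have su1 : smooth_on Q u1.
  apply: (smooth_potential oQ (fun p Qp => u1P p (B1 p Qp))) => k;
    by apply: Ck_sub QW _; exact: sI.
have su2 : smooth_on Q u2.
  apply: (smooth_potential oQ (fun p Qp => u2P p (B2 p Qp))) => k;
    by apply: Ck_sub QW _; exact: sI.
have sphi : smooth_on Q phi.
  by move=> k; apply: Ck_add => //; apply: Ck_scale => //; exact: Ck_cst.
have Dphi y (v : P) : W y -> Q (fwd c y) -> 'D_v phi (fwd c y) =
    pt (v 0 0 * t1 y + v 0 1 * t2 y) (v 0 0 * s1 y + v 0 1 * s2 y).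
  move=> Wy Qy; have cy := Wc Wy; have dphi : differentiable phi (fwd c y).
    by have [+ _] := sphi 1; apply.
  have [_ d1] := u1P _ (B1 _ Qy); have [_ d2] := u2P _ (B2 _ Qy).
  apply: rV2_eq; rewrite derive_entry// ?ptE0 ?ptE1.
    by under eq_fun do rewrite ptE0; rewrite d1 /= fwdK.
  by under eq_fun do rewrite ptE1; rewrite d2 /= fwdK.
have solve y (v : P) : W y -> v 0 0 * t1 y + v 0 1 * t2 y = 0 ->
    v 0 0 * s1 y + v 0 1 * s2 y = 0 -> v = 0.
  move=> Wy e1 e2; apply: rV2_eq; rewrite [RHS]mxE; apply: (mulfI (D0 Wy)); rewrite mulr0.
    transitivity (s2 y * (v 0 0 * t1 y + v 0 1 * t2 y) - t2 y * (v 0 0 * s1 y + v 0 1 * s2 y)).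
      by ring.
    by rewrite e1 e2 !mulr0 subr0.
  transitivity (t1 y * (v 0 0 * s1 y + v 0 1 * s2 y) - s1 y * (v 0 0 * t1 y + v 0 1 * t2 y)).
    by ring.
  by rewrite e1 e2 !mulr0 subr0.
have inj v : 'D_v phi (fwd c x) = 0 -> v = 0.
  rewrite Dphi// => /rowP H0; apply: (solve x) => //.
    by have := H0 0; rewrite ptE0 mxE.
  by have := H0 1; rewrite ptE1 mxE.
have [U [psi [[oU Ux UQ] oIU psiK spsi]]] := inverse_function oQ Qx sphi inj.
have sphiU : smooth_on U phi by move=> k; exact: Ck_sub UQ (sphi k).
have Uc : U `<=` fwd c @` dom c.
  by move=> p /UQ/QW[y Wy <-]; exists y => //; exact: Wc.
have [c' [Ac' dE fE bE]] := chart_after_diffeo Ac oU Uc sphiU oIU psiK spsi.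
have inW y : dom c' y -> W y /\ Q (fwd c y).
  rewrite dE => -[cy /UQ Qy]; split=> //; have [y' Wy' E'] := QW _ Qy.
  by rewrite -(fwdK cy) -E' fwdK//; exact: Wc.
pose w v y := dmap c' (fwd c) v y.
have wE v y : dom c' y -> w v y 0 0 * t1 y + w v y 0 1 * t2 y = v 0 0 /\
    w v y 0 0 * s1 y + w v y 0 1 * s2 y = v 0 1.
  move=> cy'; have [Wy Qy] := inW y cy'.
  have := etrans (esym (Dphi y (w v y) Wy Qy))
    (diffeo_dmap_fwd Uc sphiU oIU psiK spsi v dE fE bE cy').
  by move: (w v y) => w' <-; rewrite ptE0 ptE1.
have dW (f : S -> V) v y : smooth_map W f -> dom c' y ->
    dmap c' f v y = w v y 0 0 *: dmap c f (du R) y + w v y 0 1 *: dmap c f (dv R) y.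
  move=> sf cy'; have [Wy _] := inW y cy'; have cy := Wc Wy.
  by rewrite (dmap_change v sf oW Ac Ac' cy cy' Wy) (dmap_linear sf Ac cy Wy).
have dF v y : dom c' y -> dmap c' F v y = v 0 0 *: A y + v 0 1 *: B y.
  move=> cy'; have [Wy _] := inW y cy'; have [<- <-] := wE v y cy'.
  rewrite (dW F v y sF cy') FuE// FvE//.
  move: (w v y 0 0) (w v y 0 1) => a b; by apply/rowP => i; rewrite !mxE; ring.
have du0 : du R 0 0 = 1 by rewrite mxE !eqxx.
have du1 : du R 0 1 = 0 by rewrite mxE.
have dv0 : dv R 0 0 = 0 by rewrite mxE.
have dv1 : dv R 0 1 = 1 by rewrite mxE !eqxx.
have dFu y : dom c' y -> dmap c' F (du R) y = A y.
  by move=> cy'; rewrite dF// du0 du1 scale1r scale0r addr0.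
have dFv y : dom c' y -> dmap c' F (dv R) y = B y.
  by move=> cy'; rewrite dF// dv0 dv1 scale1r scale0r add0r.
have cx' : dom c' x by rewrite dE; split=> //; exact: Wc.
have oc' := @dom_open _ _ c'.
have lF' : lift E (dom c') F by apply: lift_sub lF oc' _ => y /inW[].
exists c', (fun y => - ln (l y) / 2); split=> //; split=> // y cy' /=.
have [Wy _] := inW y cy'; have ly := l0 Wy; have lyn := lt0r_neq0 ly.
have [[nE _] one _ _ _] := hiso.
have e2 : expR (2 * (- ln (l y) / 2)) = (l y)^-1.
  by rewrite mulrC divfK ?pnatr_eq0// expRN lnK.
have e2' : expR (- 2 * (- ln (l y) / 2)) = l y.
  rewrite (_ : - 2 * _ = ln (l y)) ?lnK//; by field.
rewrite (first_derivedE nE lF' cy' Ac' cy') dFu// dFv//; split.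
- by rewrite e2; apply: (mulfI lyn); rewrite AA// mulfV.
- by rewrite e2; apply: (mulfI lyn); rewrite BB// mulfV.
- exact: AB.
- rewrite (dmap_eq (du R) oc' cy' cy' dFv) (dW B (du R) y sB cy').
  have [w1 w2] := wE (du R) y cy'; rewrite du0 du1 in w1 w2.
  have [_ _ [a [b [d abd]]]] := coframe_exact Wy.
  pose D := t1 y * s2 y - t2 y * s1 y; have Dn : D != 0 by exact: D0.
  apply/memv_sum3P; exists (D^-1 * a), (D^-1 * b), (D^-1 * d).
  rewrite -!scalerA -!scalerDr -abd; move: (dmap c B _ y) (dmap c B _ y) => q p.
  have solved (k1 k2 j1 j2 : R) : D * k1 = j1 -> D * k2 = - j2 ->
      k1 *: p + k2 *: q = D^-1 *: (j1 *: p - j2 *: q).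
    move=> d1 d2; apply: (scalerI Dn); rewrite (scalerA D D^-1) mulfV// scale1r.
    by rewrite scalerDr !scalerA d1 d2 scaleNr.
  apply: solved.
    transitivity (s2 y * 1 - t2 y * 0); last by rewrite mulr1 mulr0 subr0.
    by rewrite -[X in _ = _ * X - _]w1 -[X in _ = _ - _ * X]w2 /D; ring.
  transitivity (t1 y * 0 - s1 y * 1); last by rewrite mulr1 mulr0 sub0r.
  by rewrite -[X in _ = _ * X - _]w2 -[X in _ = _ - _ * X]w1 /D; ring.
move=> a; rewrite e2'; apply/row_matrixP => i; rewrite !rowE.
have cy := Wc Wy; have [_ H2 _] := one.
rewrite (H2 c' c y a Ac' Ac cy' cy) -/(w a y) (eta_linear (w a y) hiso Ac cy).
rewrite mulmxDr -!scalemxAr eta1// eta2// wedge_act//.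
have [w1 w2] := wE a y cy'; rewrite -w1 -w2 /Z1 /Z2 !ipE.
move: (delta_mx 0 i) (A y) (B y) (F y) (w a y 0 0) (w a y 0 1) (l y) (t1 y) (t2 y) (s1 y) (s2 y).
move=> e p q f k1 k2 ll ? ? ? ?; move: (ip G f e) (ip G p e) (ip G q e) => ? ? ?.
by apply/rowP => j; rewrite !mxE; ring.
Qed.

End CoframeChart.

(** * Spherical systems and sphere-planes *)

Section DarbouxGeometry.
Variables (R : realType) (n : nat) (G : 'M[R]_n.+2) (S : smooth_surface R).
Hypothesis hG : lorentzian G.
Local Notation V := 'rV[R]_n.+2.
Variables (E hE : S -> {vspace V}) (eta : preform S 'M[R]_n.+2) (m : R).
Hypothesis hiso : isothermic G E eta.
Hypothesis hdar : darboux_transform G E eta m hE.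

Lemma common_lifts (c : chart R S) x : dom c x -> exists (W : set S) (F H : S -> V),
  [/\ W x, W `<=` dom c, lift E W F & lift hE W H].
Proof.
move=> cx; have [[nE _] _ _ _ _] := hiso; have [_ [nH _] _ _] := hdar.
have [W1 [F [lF W1x]]] := line_lift nE x; have [W2 [H [lH W2x]]] := line_lift nH x.
have o1 : open W1 by have [[]] := lF.
have o2 : open W2 by have [[]] := lH.
have oW : open (W1 `&` W2 `&` dom c) by do 2?apply: openI => //; exact: dom_open.
exists (W1 `&` W2 `&` dom c), F, H; split=> //.
- by apply: (lift_sub lF oW) => y [[]].
- by apply: (lift_sub lH oW) => y [[]].
Qed.

(** No point has to be excluded: a Darboux transform exists, so [eta] has no zeros. *)
Lemma isothermic_chart x : exists c (F : S -> V) (theta : S -> R),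
  isothermic_coordinates G E eta c F theta /\ dom c x.
Proof.
have [c Ac cx] := (atlasP S).1 x; have [W0 [F [H [Ox Oc lF lH]]]] := common_lifts cx.
have [W [t1 [t2 [s1 [s2 [l [A [B [[oW Wx WO] [st1 st2 ss1 ss2] [sl sA sB] HW]]]]]]]]] :=
  coframe hG hiso hdar lF lH Ac Oc Ox.
have lF' := lift_sub lF oW WO; have lH' := lift_sub lH oW WO.
have Wc : W `<=` dom c := subset_trans WO Oc.
have [|||||||||||c' [theta ?]] := coframe_chart hG hiso hdar lF' lH' Ac Wc st1 st2 ss1 ss2
  sl sA sB _ _ _ _ _ _ _ _ _ _ _ Wx; last by exists c', F, theta.
all: by move=> y /HW[? ? [? ?] [? ? ? ? ?] []].
Qed.

Lemma ker_eta_at (c : chart R S) x : atlas S c -> dom c x -> forall z : V,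
  z \in perp G (first_derived E x) <-> forall v, z *m eta c x v = 0.
Proof.
move=> Ac cx z; have [W0 [F [H [Ox Oc lF lH]]]] := common_lifts cx.
exact: (ker_eta hG hiso hdar lF lH Ac Oc Ox).
Qed.

(** A vector orthogonal to the first derived bundle becomes orthogonal to the transform as
    well when a multiple of [F] is subtracted. *)
Lemma spherical_systemE x :
  spherical_system G E hE x = (perp G (first_derived E x) + hE x)%VS.
Proof.
have [c Ac cx] := (atlasP S).1 x; have [W0 [F [H [Ox Oc lF lH]]]] := common_lifts cx.
have [[nE _] _ _ _ _] := hiso; have [_ [nH _] _ _] := hdar.
have FH := darboux_ip hG hiso hdar lF lH Ox.
have fr := darboux_frame hG hiso lF Ac Oc Ox.
have fdE := darboux_first_derived hiso lF Ac Oc Ox.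
have Fperp : F x \in perp G (first_derived E x).
  rewrite fdE; apply/frame_perpP; have [FF Fa Fb _] := fr.
  by split; [exact: FF|rewrite -[RHS]Fa; exact: (ipC hG)|rewrite -[RHS]Fb; exact: (ipC hG)].
apply/eqP; rewrite /spherical_system eqEsubv; apply/andP; split.
  rewrite !subv_add addvSr andbT; apply/andP; split; last first.
    apply: subv_trans (addvSl _ _); apply/subvP => z /memv_perp H0.
    by apply/memv_perp => u uE; apply: H0; exact: subvP (addvSl _ _) _ uE.
  by rewrite (lift_span nE lF Ox) -memvE (subvP (addvSl _ _)).
rewrite subv_add; apply/andP; split; last first.
  by apply: subv_trans (addvSl _ _); exact: addvSr.
apply/subvP => z /memv_perp zp; pose k := ip G (H x) z / ip G (F x) (H x).
rewrite (_ : z = k *: F x + (z - k *: F x)); last by rewrite addrC subrK.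
apply: memv_add.
  apply: (subvP (addvSl _ _)); apply: memvZ.
  by rewrite (lift_span nE lF Ox) memv_line.
rewrite /VR (lift_span nH lH Ox); apply/memv_perp => _ /memv_addP[a aE [_ /vlineP[d ->] ->]].
rewrite !ipE (zp a aE) (ipC hG a); move/memv_perp: Fperp => /(_ a aE); rewrite (ipC hG a) => ->.
rewrite (ipC hG (H x) (F x)) /k divfK// ?mulr0; ring.
Qed.

Lemma sphere_planesE w x :
  sphere_planes G E hE w x = (perp G (first_derived E x) + hE x + <[w]>)%VS.
Proof. by rewrite /sphere_planes spherical_systemE. Qed.

End DarbouxGeometry.

(** This is the coefficient of [t ^ 3] in [(d + t eta) p(t) = 0], extracted from four
    values of [t]. *)
Lemma conserved_top (R : realType) (n : nat) (S : smooth_surface R)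
  (eta : preform S 'M[R]_n.+2) (p : nat -> S -> 'rV[R]_n.+2) (c : chart R S) x v :
  conserved_quantity eta p 2 -> atlas S c -> dom c x -> p 2 x *m eta c x v = 0.
Proof.
move=> [_ sp cq] Ac cx.
have pE t : peval p 2 t = fun y => p 0%N y + (t *: p 1%N y + t ^+ 2 *: p 2 y).
  by apply/funext => y; rewrite /peval !big_ord_recl big_ord0/= expr0 scale1r expr1 addr0.
have oT := @openT S; pose T := [set: S].
have st t k : smooth_map T (fun y => t *: p k y).
  by apply: (smooth_mapZ oT (smooth_map_cst T t)); exact: sp.
have dZ t k : dmap c (fun y => t *: p k y) v x = t *: dmap c (p k) v x.
  rewrite (dmapZ v (smooth_map_cst T t) (sp k) Ac cx I) dmap_cst scale0r add0r//.
have Q t : dmap c (p 0%N) v x + (t *: dmap c (p 1%N) v x + t ^+ 2 *: dmap c (p 2) v x) +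
    t *: ((p 0%N x + (t *: p 1%N x + t ^+ 2 *: p 2 x)) *m eta c x v) = 0.
  have := cq t c x v Ac cx; rewrite /nabla pE.
  rewrite (dmapD v (sp 0%N) (smooth_mapD oT (st t 1%N) (st (t ^+ 2) 2)) Ac cx I).
  by rewrite (dmapD v (st t 1%N) (st (t ^+ 2) 2) Ac cx I) !dZ.
move: Q; move: (dmap c (p 0%N) v x) (dmap c (p 1%N) v x) (dmap c (p 2) v x) => d0 d1 d2.
move=> Q; apply/rowP => i; have Qi t := congr1 (fun u : 'rV[R]_n.+2 => u 0 i) (Q t).
move: (Qi 0) (Qi 1) (Qi (-1)) (Qi 2).
rewrite !mulmxDl -!scalemxAl.
move: (p 0%N x *m eta c x v) (p 1%N x *m eta c x v) (p 2 x *m eta c x v) => e0 e1 e2.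
rewrite !mxE; lra.
Qed.

Lemma span_shift (K : fieldType) (vT : vectType K) (U : {vspace vT}) (v v' u w : vT) (k a : K) :
  a != 0 -> u \in U -> v = k *: w + a *: v' + u ->
  (U + <[v]> + <[w]> = U + <[v']> + <[w]>)%VS.
Proof.
move=> a0 uU vE; have inl z t d : z \in U -> z + t *: v + d *: w \in (U + <[v]> + <[w]>)%VS.
  by move=> zU; rewrite !memv_add ?memvZ ?memv_line.
have inr z t d : z \in U -> z + t *: v' + d *: w \in (U + <[v']> + <[w]>)%VS.
  by move=> zU; rewrite !memv_add ?memvZ ?memv_line.
have Usub t : (U <= U + <[t]> + <[w]>)%VS := subv_trans (addvSl _ _) (addvSl _ _).
have wsub t : w \in (U + <[t]> + <[w]>)%VS by exact: (subvP (addvSr _ _) _ (memv_line w)).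
apply/eqP; rewrite eqEsubv !subv_add !Usub -!memvE !wsub !andbT /=; apply/andP; split.
  by rewrite vE addrC [k *: w + _]addrC addrA; exact: inr.
have -> : v' = - a^-1 *: u + a^-1 *: v + - (a^-1 * k) *: w.
  apply: (scalerI a0); rewrite !scalerDr !scalerA !mulrN mulrA mulfV// mul1r.
  by rewrite scaleN1r scale1r scaleNr vE [X in - u + X]addrC addKr addrAC subrr add0r.
by apply: inl; rewrite memvZ.
Qed.

Section PartB.
Variables (R : realType) (n : nat) (G : 'M[R]_n.+2) (S : smooth_surface R).
Hypothesis hG : lorentzian G.
Local Notation V := 'rV[R]_n.+2.

(** Modulo [w] and the orthogonal of the first derived bundle, both complementary
    surfaces are spanned by the linear coefficient of the conserved quantity. *)
Lemma complementary_sphere_planes (E hE : S -> {vspace V}) (eta : preform S 'M[R]_n.+2)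
  (p : nat -> S -> V) w x :
  special_isothermic_in G E eta 2 p w -> complementary G E eta 2 p hE ->
  sphere_planes G E hE w x = (perp G (first_derived E x) + <[p 1%N x]> + <[w]>)%VS.
Proof.
move=> [w0 [hiso cq] p0] [m [m0 pp hdar hEp]].
have [c Ac cx] := (atlasP S).1 x.
have p2 : p 2 x \in perp G (first_derived E x).
  by apply/(ker_eta_at hG hiso hdar Ac cx) => v; exact: conserved_top cq Ac cx.
rewrite (sphere_planesE hG hiso hdar) hEp; have /vlineP[k p0E] := p0 x.
apply: (span_shift (u := m ^+ 2 *: p 2 x) (k := k) m0); first exact: memvZ.
rewrite /peval !big_ord_recl big_ord0/= expr0 scale1r expr1 addr0 p0E.
by rewrite addrA.
Qed.

End PartB.

(** * Linear differential equations on a connected surface *)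

Section Local.
Variables (R : realType) (S : smooth_surface R).

Lemma connected_locally_constant (T : topologicalType) (P : T -> Prop) x0 :
  connected [set: T] ->
  (forall x, exists2 O : set T, open O /\ O x & forall y, O y -> P y <-> P x) ->
  P x0 -> forall x, P x.
Proof.
move=> cT loc P0 x.
have oP : open [set y | P y].
  rewrite openE => y Py; have [U [oU Uy] UP] := loc y.
  by apply: filterS (open_near oU Uy) => z /UP[_]; apply.
have cP : closed [set y | P y].
  rewrite -openC openE => y nPy; have [U [oU Uy] UP] := loc y.
  by apply: filterS (open_near oU Uy) => z /UP[H _] /H.
suff E : [set y | P y] = [set: T] by have : [set y | P y] x by rewrite E.
apply: cT; first by exists x0.
- by exists [set y | P y] => //; rewrite setTI.
- by exists [set y | P y] => //; rewrite setTI.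
Qed.

(** At a maximum of [|g|] the mean value theorem bounds [|g|] by half of itself. *)
Lemma small_ode (g g' : R -> R) : g 0 = 0 ->
  (forall t : R, t \in `[0, 1] -> is_derive t 1 g (g' t)) ->
  (forall t : R, t \in `[0, 1] -> `|g' t| <= `|g t| / 2) -> g 1 = 0.
Proof.
move=> g0 dg bg; have ag : {within `[0, 1], continuous (fun t => `|g t|)}.
  have cg : {within `[0, 1], continuous g}.
    by apply: derivable_within_continuous => t t01; have [] := dg t t01.
  by move=> t; apply: (continuous_comp (cg t)); exact: norm_continuous.
have [c c01 cmax] := EVT_max ler01 ag.
have gc : `|g c| <= `|g c| / 2.
  have [c0|c0] := eqVneq c 0; first by rewrite c0 g0 normr0 mul0r.
  have cp : 0 < c by move: c01; rewrite in_itv/= lt_neqAle eq_sym c0 => /andP[->].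
  have sub t : t \in `[0, c] -> t \in `[0, 1].
    by move: c01; rewrite !in_itv/= => /andP[_ c1] /andP[-> tc]; rewrite (le_trans tc).
  have d1 t : t \in `]0, c[ -> is_derive t 1 g (g' t).
    by move=> tc; apply/dg/sub; exact: subset_itv_oo_cc tc.
  have cg : {within `[0, c], continuous g}.
    by apply: derivable_within_continuous => t /sub t01; have [] := dg t t01.
  have [t tc] := MVT cp d1 cg; rewrite g0 !subr0 => gcE; rewrite {1}gcE.
  have t01 := sub t (subset_itv_oo_cc tc).
  rewrite normrM (gtr0_norm cp) -[leRHS]mulr1.
  apply: ler_pM => //; first exact: ltW.
    by apply: le_trans (bg t t01) _; apply: ler_pM => //; exact: cmax.
  by move: c01; rewrite in_itv/= => /andP[].
have gc0 : `|g c| = 0 by apply/eqP; rewrite eq_le normr_ge0 andbT; lra.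
apply/eqP; rewrite -normr_le0 -gc0; apply: cmax.
by rewrite in_itv/= lexx ler01.
Qed.

(** On a segment short with respect to the coefficients the derivative of [f] is at most half
    of [f], so that [small_ode] propagates the zeros of [f]. *)
Lemma ode_zero (O : set S) (f a b : S -> R) (c : chart R S) x :
  open O -> O x -> atlas S c -> O `<=` dom c ->
  smooth_map O f -> smooth_map O a -> smooth_map O b ->
  (forall y v, O y -> dmap c f v y = (v 0 0 * a y + v 0 1 * b y) * f y) ->
  exists2 W : set S, open W /\ W x & forall y, W y -> O y /\ (f y = 0 <-> f x = 0).
Proof.
move=> oO Ox Ac Oc sf sa sb df.
have oI : open (fwd c @` O) by rewrite -(chart_img_sub Oc); exact: open_chart_img.
have Ix : (fwd c @` O) (fwd c x) by exists x.
have sI (g : S -> R) k : smooth_map O g -> Ck k (fwd c @` O) (g \o bwd c).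
  by move=> sg; rewrite -(chart_img_sub Oc); exact: sg.
pose p0 := fwd c x; pose fa := a \o bwd c; pose fb := b \o bwd c.
have e1 : 0 < (1 : R) by [].
have ca : fa p @[p --> p0] --> fa p0 := sI a 0%N sa p0 Ix.
have cb : fb p @[p --> p0] --> fb p0 := sI b 0%N sb p0 Ix.
move/cvgrPdistC_le : ca => /(_ _ e1) Ha; move/cvgrPdistC_le : cb => /(_ _ e1) Hb.
have HO : nbhs p0 (fwd c @` O) := open_near oI Ix.
have [d /= d0 dP] := (nbhs_ballP _ _).1 (filterI (filterI HO Ha) Hb).
pose M := (`|fa p0| + 1) + (`|fb p0| + 1); have M0 : 0 < M.
  by rewrite addr_gt0// ltr_wpDl.
pose r := Num.min d (M^-1 / 4); have r0 : 0 < r by rewrite lt_min d0 !divr_gt0// invr_gt0.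
have rd p : ball p0 r p -> ball p0 d p by apply: le_ball; rewrite ge_min lexx.
have coef p : ball p0 r p -> [/\ (fwd c @` O) p, `|fa p| <= `|fa p0| + 1 & `|fb p| <= `|fb p0| + 1].
  move=> /rd/dP[[Op Ap] Bp]; split=> //.
    by rewrite -[fa p](subrK (fa p0)) (le_trans (ler_normD _ _))// addrC lerD2l.
  by rewrite -[fb p](subrK (fb p0)) (le_trans (ler_normD _ _))// addrC lerD2l.
pose W := O `&` [set y | ball p0 r (fwd c y)].
have oW : open W.
  rewrite openE => y [Oy By]; apply: filterI; first exact: open_near.
  have cf : fwd c z @[z --> y] --> fwd c y := fwd_continuous (Oc y Oy).
  by have := cf (ball p0 r) (open_near (@ball_open _ _ p0 r) By).
have seg y z : W y -> W z -> f y = 0 -> f z = 0.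
  move=> [Oy By] [Oz Bz] fy; pose p := fwd c y; pose v := fwd c z - p.
  pose g t := (f \o bwd c) (p + t *: v).
  suff : g 1 = 0 by rewrite /g scale1r /v addrC subrK/= fwdK//; exact: Oc.
  have By' : `|p0 - p| < r by move: By; rewrite /= -ball_normE.
  have Bz' : `|p0 - fwd c z| < r by move: Bz; rewrite /= -ball_normE.
  have vr : `|v| <= M^-1 / 2.
    rewrite (_ : v = (p0 - p) - (p0 - fwd c z)); last first.
      by rewrite /v; apply/rowP => i; rewrite !mxE; ring.
    rewrite (le_trans (ler_normB _ _))// (_ : M^-1 / 2 = M^-1 / 4 + M^-1 / 4); last by field; exact: lt0r_neq0.
    apply: lerD; apply: ltW; [apply: lt_le_trans By' _|apply: lt_le_trans Bz' _];
      by rewrite ge_min lexx orbT.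
  have inB t : t \in `[0, 1] -> ball p0 r (p + t *: v).
    rewrite in_itv/= -ball_normE/= => /andP[t0 t1].
    rewrite (_ : p0 - _ = (1 - t) *: (p0 - p) + t *: (p0 - fwd c z)); last first.
      by rewrite /v; apply/rowP => i; rewrite !mxE; ring.
    apply: le_lt_trans (ler_normD _ _) _; rewrite !normrZ !ger0_norm ?subr_ge0//.
    have [->|tn0] := eqVneq t 0; first by rewrite subr0 mul0r addr0 mul1r.
    have tp : 0 < t by rewrite lt_neqAle eq_sym tn0.
    rewrite (_ : r = (1 - t) * r + t * r); last by ring.
    by apply: ler_ltD; [rewrite ler_wpM2l ?subr_ge0// ltW | rewrite ltr_pM2l].
  have fd q : (fwd c @` O) q -> differentiable (f \o bwd c) q.
    by move=> Oq; have [+ _] := sI f 1%N sf; apply.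
  apply: (@small_ode g (fun t => 'D_v (f \o bwd c) (p + t *: v))).
  - by rewrite /g scale0r addr0/= fwdK//; exact: Oc.
  - by move=> t /inB/coef[Ot _ _]; apply: is_derive_line; exact: fd.
  - move=> t /inB/coef[[u Ou uE] At Bt]; rewrite /g -uE/= fwdK; last exact: Oc.
    have := df u v Ou; rewrite /dmap => ->; rewrite normrM mulrC ler_wpM2l//.
    move: At Bt; rewrite -uE /fa /fb /= fwdK => [At Bt|]; last exact: Oc.
    have [v0 v1] : `|v 0 0| <= `|v| /\ `|v 0 1| <= `|v| by split; exact: rV2_entry_le.
    rewrite (le_trans (ler_normD _ _))// !normrM.
    apply: (@le_trans _ _ (M^-1 / 2 * M)); last by rewrite mulrAC mulVf ?mul1r// lt0r_neq0.
    rewrite /M mulrDr; apply: lerD; apply: ler_pM => //; exact: le_trans vr.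
exists W; first by split=> //; split=> //; exact: ballxx.
have Wx : W x by split=> //; exact: ballxx.
by move=> y Wy; split; [by have [] := Wy | split; exact: seg].
Qed.

End Local.

(** * The relation between two Darboux transforms *)

(** Cramer's rule for three consistent equations in two unknowns: dividing by the squared
    norm [N] of the cross product of the two columns gives formulas that do not depend on
    the choice of a non-zero minor. *)
Lemma relation_cramer (R : realType) (a1 a2 a3 b1 b2 b3 c1 c2 c3 x y : R)
  (N := (b2 * c3 - b3 * c2) ^+ 2 + (b3 * c1 - b1 * c3) ^+ 2 + (b1 * c2 - b2 * c1) ^+ 2) :
  (forall s t, s * b1 + t * c1 = 0 -> s * b2 + t * c2 = 0 -> s * b3 + t * c3 = 0 ->
    s = 0 /\ t = 0) ->
  a1 + x * b1 + y * c1 = 0 -> a2 + x * b2 + y * c2 = 0 -> a3 + x * b3 + y * c3 = 0 ->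
  [/\ N != 0,
   x = - ((a2 * c3 - a3 * c2) * (b2 * c3 - b3 * c2) + (a3 * c1 - a1 * c3) * (b3 * c1 - b1 * c3) +
          (a1 * c2 - a2 * c1) * (b1 * c2 - b2 * c1)) * N^-1 &
   y = ((a2 * b3 - a3 * b2) * (b2 * c3 - b3 * c2) + (a3 * b1 - a1 * b3) * (b3 * c1 - b1 * c3) +
          (a1 * b2 - a2 * b1) * (b1 * c2 - b2 * c1)) * N^-1].
Proof.
move=> ind e1 e2 e3.
have N0 : N != 0.
  apply/eqP => N0.
  have p1 := sqr_ge0 (b2 * c3 - b3 * c2); have p2 := sqr_ge0 (b3 * c1 - b1 * c3).
  have p3 := sqr_ge0 (b1 * c2 - b2 * c1).
  have /eqP : (b2 * c3 - b3 * c2) ^+ 2 = 0 by move: N0; rewrite /N; lra.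
  have /eqP : (b3 * c1 - b1 * c3) ^+ 2 = 0 by move: N0; rewrite /N; lra.
  have /eqP : (b1 * c2 - b2 * c1) ^+ 2 = 0 by move: N0; rewrite /N; lra.
  rewrite !sqrf_eq0 => /eqP q3 /eqP q2 /eqP q1.
  have [|||h1 _] := ind c1 (- b1); [lra|lra|lra|].
  have [|||h2 _] := ind c2 (- b2); [lra|lra|lra|].
  have [|||h3 _] := ind c3 (- b3); [lra|lra|lra|].
  have [|||_ /eqP] := ind 0 1; [by rewrite h1; ring|by rewrite h2; ring|by rewrite h3; ring|].
  by rewrite oner_eq0.
have a1E : a1 = - (x * b1 + y * c1) by lra.
have a2E : a2 = - (x * b2 + y * c2) by lra.
have a3E : a3 = - (x * b3 + y * c3) by lra.
by split=> //; apply: (mulIf N0); rewrite -[RHS]mulrA mulVf// mulr1 a1E a2E a3E /N; ring.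
Qed.

Lemma open_nonzero (R : realType) (S : smooth_surface R) (O : set S) (f : S -> R) :
  open O -> smooth_map O f -> open (O `&` [set y | f y != 0]).
Proof.
move=> oO sf; rewrite openE => y [Oy fy]; apply: filterI; first exact: open_near.
have cf : f z @[z --> y] --> f y := smooth_map_cont sf oO Oy.
have [fp|fn] := ltrP 0 (f y).
  by apply: filterS (cvgr_gt _ cf _ fp) => z fz; exact: lt0r_neq0.
have {}fn : f y < 0 by rewrite lt_neqAle fy.
by apply: filterS (cvgr_lt _ cf _ fn) => z fz; rewrite /= lt_eqF.
Qed.

Section DarbouxIndep.
Variables (R : realType) (n : nat) (G : 'M[R]_n.+2) (S : smooth_surface R).
Hypothesis hG : lorentzian G.
Local Notation V := 'rV[R]_n.+2.
Variables (E hE : S -> {vspace V}) (eta : preform S 'M[R]_n.+2) (m : R).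
Hypothesis hiso : isothermic G E eta.
Hypothesis hdar : darboux_transform G E eta m hE.

Lemma darboux_not_perp y h : h \in hE y -> h \in perp G (first_derived E y) -> h = 0.
Proof.
have [c Ac cy] := (atlasP S).1 y; have [W0 [F [H [Wy Wc lF lH]]]] := common_lifts hiso hdar cy.
have [_ [nH _] _ _] := hdar; rewrite (lift_span nH lH Wy) => /vlineP[k ->].
rewrite (darboux_first_derived hiso lF Ac Wc Wy) => /frame_perpP[+ _ _].
rewrite ipZr => /eqP; rewrite mulf_eq0 (negPf (darboux_ip hG hiso hdar lF lH Wy)) orbF.
by move=> /eqP ->; rewrite scale0r.
Qed.

(** The spherical system, which does not contain [w], is the sum of [hE] and of the
    orthogonal of the first derived bundle. *)
Lemma darboux_indep w y h a b : w \notin spherical_system G E hE y -> h \in hE y ->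
  h != 0 -> a *: h + b *: w \in perp G (first_derived E y) -> a = 0 /\ b = 0.
Proof.
rewrite (spherical_systemE hG hiso hdar) => wC hh h0 abw.
have b0 : b = 0.
  apply/eqP; apply: contraNT wC => b0.
  have -> : w = b^-1 *: (a *: h + b *: w) + (- (b^-1 * a)) *: h.
    by apply/rowP => i; rewrite !mxE; field.
  by apply: memv_add; exact: memvZ.
split=> //; move: abw; rewrite b0 scale0r addr0 => ah.
have /eqP := darboux_not_perp (memvZ a hh) ah.
by rewrite scaler_eq0 (negPf h0) orbF => /eqP.
Qed.

End DarbouxIndep.

Section SphereRelation.
Variables (R : realType) (n : nat) (G : 'M[R]_n.+2) (S : smooth_surface R).
Hypothesis hG : lorentzian G.
Local Notation V := 'rV[R]_n.+2.
Variables (E hE1 hE2 : S -> {vspace V}) (eta : preform S 'M[R]_n.+2) (m1 m2 : R) (w : V).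
Hypothesis hiso : isothermic G E eta.
Hypothesis hd1 : darboux_transform G E eta m1 hE1.
Hypothesis hd2 : darboux_transform G E eta m2 hE2.
Hypothesis m12 : m1 != m2.
Hypothesis hw1 : forall x, w \notin spherical_system G E hE1 x.
Hypothesis hw2 : forall x, w \notin spherical_system G E hE2 x.
Hypothesis hP : forall x, sphere_planes G E hE1 w x = sphere_planes G E hE2 w x.
Hypothesis hnp : no_principal_direction G E eta (sphere_planes G E hE1 w).
Local Notation perpfd x := (perp G (first_derived E x)).
Local Notation P := (sphere_planes G E hE1 w).

Let nE : null_line_bundle G E. Proof. by have [[]] := hiso. Qed.
Let nE1 : null_line_bundle G hE1. Proof. by have [_ []] := hd1. Qed.
Let nE2 : null_line_bundle G hE2. Proof. by have [_ []] := hd2. Qed.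

Let PE x : P x = (perpfd x + hE1 x + <[w]>)%VS.
Proof. exact: (sphere_planesE hG hiso hd1). Qed.

Let perpP x z : z \in perpfd x -> z \in P x.
Proof. by move=> zp; rewrite PE; do 2!apply: (subvP (addvSl _ _)). Qed.

Let hE1P x z : z \in hE1 x -> z \in P x.
Proof. by move=> zp; rewrite PE; apply: (subvP (addvSl _ _)); apply: (subvP (addvSr _ _)). Qed.

Let hE2P x z : z \in hE2 x -> z \in P x.
Proof.
move=> zp; rewrite hP (sphere_planesE hG hiso hd2).
by apply: (subvP (addvSl _ _)); apply: (subvP (addvSr _ _)).
Qed.

Let wP x : w \in P x.
Proof. by rewrite PE; apply: (subvP (addvSr _ _)); exact: memv_line. Qed.

(** Decompose [h1] in the sphere-plane of the second transform; its component along [h2] is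
    not zero because [w] avoids the spherical system of the first transform. *)
Lemma pointwise_relation y h1 h2 : h1 \in hE1 y -> h1 != 0 -> h2 \in hE2 y -> h2 != 0 ->
  exists a b, a != 0 /\ h1 + a *: h2 + b *: w \in perpfd y.
Proof.
move=> h1E h10 h2E h20; have := hE1P h1E; rewrite hP (sphere_planesE hG hiso hd2).
move=> /memv_addP[_ /memv_addP[u up [h h2' ->]] [_ /vlineP[b ->] h1E']].
have [k hk] : exists k, h = k *: h2.
  have [c Ac cy] := (atlasP S).1 y; have [W0 [F [H [Wy _ _ lH]]]] := common_lifts hiso hd2 cy.
  move: h2' h2E h20; rewrite (lift_span nE2 lH Wy) => /vlineP[k1 ->] /vlineP[k2 ->].
  rewrite scaler_eq0 negb_or => /andP[k20 _]; exists (k1 / k2).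
  by rewrite scalerA divfK.
have rel : h1 + (- k) *: h2 + (- b) *: w \in perpfd y.
  by rewrite h1E' hk (_ : _ + _ = u)//; apply/rowP => i; rewrite !mxE; ring.
exists (- k), (- b); split=> //; apply/eqP => k0; move: rel.
rewrite k0 scale0r addr0 -[h1]scale1r => /(darboux_indep hG hiso hd1 (hw1 y) h1E h10)[/eqP].
by rewrite oner_eq0.
Qed.

Section IsothermicChart.
Variables (c : chart R S) (F : S -> V) (theta : S -> R).
Hypothesis hc : isothermic_coordinates G E eta c F theta.
Local Notation Fu := (dmap c F (du R)).
Local Notation Fv := (dmap c F (dv R)).

Let Ac : atlas S c. Proof. by have [] := hc. Qed.
Let lF : lift E (dom c) F. Proof. by have [] := hc. Qed.

Let fr y : dom c y -> frame G (F y) (Fu y) (Fv y).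
Proof.
by move=> cy; have [iE _ _ _ _] := hiso; exact: (immersion_frame hG iE lF cy Ac cy).
Qed.

Let fdE y : dom c y -> first_derived E y = (<[F y]> + <[Fu y]> + <[Fv y]>)%VS.
Proof. by move=> cy; exact: (first_derivedE nE lF cy Ac cy). Qed.

Lemma principal_notin y : dom c y -> Fu y \notin P y /\ Fv y \notin P y.
Proof.
move=> cy; have [_ _ _ free] := fr cy; have [nu nv] := hnp hc cy.
have EF := lift_span nE lF cy.
split; apply/negP => FP.
  have : Fu y \in E y.
    rewrite -nu memv_cap FP andbT.
    by apply: (subvP (addvSr _ _)); exact: memv_line.
  rewrite EF => /vlineP[k kE]; have [|_ /eqP] := free (- k) 1 0; last by rewrite oner_eq0.
  by rewrite scale0r addr0 scale1r kE scaleNr addNr.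
have : Fv y \in E y.
  rewrite -nv memv_cap FP andbT.
  by apply: (subvP (addvSr _ _)); exact: memv_line.
rewrite EF => /vlineP[k kE]; have [|_ _ /eqP] := free (- k) 0 1; last by rewrite oner_eq0.
by rewrite scale0r addr0 scale1r kE scaleNr addNr.
Qed.

(** A vector of the sphere-plane orthogonal to [F] and to one principal direction is
    orthogonal to the other one, for otherwise the sphere-plane would contain it. *)
Lemma sphere_plane_perp y z a b : dom c y ->
  (a = Fu y /\ b = Fv y) \/ (a = Fv y /\ b = Fu y) ->
  z \in P y -> ip G (F y) z = 0 -> ip G b z = 0 -> z \in perpfd y.
Proof.
move=> cy ab zP Fz bz; have [_ _ Hc] := hc; have [guu gvv guv _ _] := Hc y cy.
have [FF FFu FFv _] := fr cy; have e0 := expR_gt0 (2 * theta y).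
have [aP aa Fa ba] : [/\ a \notin P y, ip G a a != 0, ip G (F y) a = 0 & ip G b a = 0].
  have [uP vP] := principal_notin cy.
  have guu0 : ip G (Fu y) (Fu y) != 0 by rewrite guu; exact: lt0r_neq0.
  have gvv0 : ip G (Fv y) (Fv y) != 0 by rewrite gvv; exact: lt0r_neq0.
  have gvu : ip G (Fv y) (Fu y) = 0 by rewrite -[RHS]guv; exact: (ipC hG).
  by case: ab => -[-> ->]; split; assumption.
pose k := ip G a z / ip G a a.
have zk : z - k *: a \in perpfd y.
  have az : ip G a (z - k *: a) = 0 by rewrite !ipE /k divfK// subrr.
  have bz' : ip G b (z - k *: a) = 0 by rewrite !ipE bz ba mulr0 subrr.
  have Fz' : ip G (F y) (z - k *: a) = 0 by rewrite !ipE Fz Fa mulr0 subrr.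
  rewrite (fdE cy); apply/frame_perpP; move: (z - k *: a) az bz' Fz' => z' az bz' Fz'.
  by case: ab => -[aE bE]; split=> //; rewrite -?aE -?bE.
have [k0|k0] := eqVneq k 0; first by move: zk; rewrite k0 scale0r subr0.
case/negP: aP; have -> : a = k^-1 *: (z - (z - k *: a)).
  by rewrite subKr scalerA mulVf// scale1r.
by apply: memvZ; apply: memvB => //; exact: perpP.
Qed.

Lemma eta_principal y h : dom c y ->
  ip G (Fv y) (h *m eta c y (du R)) = 0 /\ ip G (Fu y) (h *m eta c y (dv R)) = 0.
Proof.
move=> cy; have [_ _ Hc] := hc; have [_ _ guv _ etaE] := Hc y cy.
have [_ FFu FFv _] := fr cy; rewrite !etaE -!scalemxAr !wedge_act//.
move: (h) (F y) (Fu y) (Fv y) guv FFu FFv => {}h f a b ab fa fb.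
have -> : du R 0 0 = 1 by rewrite mxE !eqxx.
have -> : du R 0 1 = 0 by rewrite mxE.
have -> : dv R 0 0 = 0 by rewrite mxE.
have -> : dv R 0 1 = 1 by rewrite mxE !eqxx.
rewrite !ipE (ipC hG b a) (ipC hG b f) (ipC hG a f) ab fa fb; split; ring.
Qed.

(** Pairing with [F], [F_u] and [F_v] turns the relation into linear equations with smooth
    coefficients, solved by [relation_cramer]. *)
Lemma local_relation x : dom c x -> exists (W : set S) (H1 H2 : S -> V) (be : S -> R),
  [/\ [/\ W x, W `<=` dom c, lift hE1 W H1 & lift hE2 W H2], smooth_map W be &
    forall y, W y -> H1 y + H2 y + be y *: w \in perpfd y].
Proof.
move=> cx; have [W1 [H1 [lH1 W1x]]] := line_lift nE1 x.
have [W2 [H2 [lH2 W2x]]] := line_lift nE2 x.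
pose W := W1 `&` W2 `&` dom c.
have o1 : open W1 by have [[]] := lH1.
have o2 : open W2 by have [[]] := lH2.
have oc := @dom_open _ _ c.
have oW : open W by do 2?apply: openI.
have {}lH1 : lift hE1 W H1 by apply: (lift_sub lH1 oW) => y [[]].
have {}lH2 : lift hE2 W H2 by apply: (lift_sub lH2 oW) => y [[]].
have Wc : W `<=` dom c by move=> y [].
have [[_ sH1 H1E] H10] := lH1; have [[_ sH2 H2E] H20] := lH2.
have [[_ sF' _] _] := lF; have sF := smooth_map_sub Wc sF'.
have sD v : smooth_map W (dmap c F v).
  apply: smooth_map_sub (smooth_map_dmap v Ac oc sF') => y [_ cy]; by split.
have si a b : smooth_map W a -> smooth_map W b -> smooth_map W (fun y => ip G (a y) (b y)).
  exact: smooth_map_ip.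
have sw := smooth_map_cst W w.
pose A (X : S -> V) y := ip G (F y) (X y).
pose B (X : S -> V) y := ip G (Fu y) (X y).
pose C (X : S -> V) y := ip G (Fv y) (X y).
pose w' (y : S) := w.
have sA X : smooth_map W X -> smooth_map W (A X) by move=> sX; exact: si.
have sB X : smooth_map W X -> smooth_map W (B X) by move=> sX; exact: si.
have sC X : smooth_map W X -> smooth_map W (C X) by move=> sX; exact: si.
pose cr (f1 f2 g1 g2 : S -> R) (y : S) := f1 y * g2 y - f2 y * g1 y.
have scr f1 f2 g1 g2 : smooth_map W f1 -> smooth_map W f2 -> smooth_map W g1 ->
    smooth_map W g2 -> smooth_map W (cr f1 f2 g1 g2).
  move=> s1 s2 s3 s4; apply: smooth_mapD => //; first exact: smooth_mapM.
  by apply: smooth_mapN => //; exact: smooth_mapM.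
pose dot (f1 f2 f3 g1 g2 g3 : S -> R) (y : S) := f1 y * g1 y + f2 y * g2 y + f3 y * g3 y.
have sdot f1 f2 f3 g1 g2 g3 : smooth_map W f1 -> smooth_map W f2 -> smooth_map W f3 ->
    smooth_map W g1 -> smooth_map W g2 -> smooth_map W g3 ->
    smooth_map W (dot f1 f2 f3 g1 g2 g3).
  by move=> *; do 2?[apply: smooth_mapD => //]; exact: smooth_mapM.
pose b1 := A H2; pose b2 := B H2; pose b3 := C H2.
pose a1 := A H1; pose a2 := B H1; pose a3 := C H1.
pose c1 := A w'; pose c2 := B w'; pose c3 := C w'.
pose n1 := cr b2 b3 c2 c3; pose n2 := cr b3 b1 c3 c1; pose n3 := cr b1 b2 c1 c2.
pose N := dot n1 n2 n3 n1 n2 n3.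
pose X := dot (cr a2 a3 c2 c3) (cr a3 a1 c3 c1) (cr a1 a2 c1 c2) n1 n2 n3.
pose Y := dot (cr a2 a3 b2 b3) (cr a3 a1 b3 b1) (cr a1 a2 b1 b2) n1 n2 n3.
have sb1 : smooth_map W b1 := sA H2 sH2.
have sb2 : smooth_map W b2 := sB H2 sH2.
have sb3 : smooth_map W b3 := sC H2 sH2.
have sa1 : smooth_map W a1 := sA H1 sH1.
have sa2 : smooth_map W a2 := sB H1 sH1.
have sa3 : smooth_map W a3 := sC H1 sH1.
have sc1 : smooth_map W c1 := sA w' sw.
have sc2 : smooth_map W c2 := sB w' sw.
have sc3 : smooth_map W c3 := sC w' sw.
have sn1 : smooth_map W n1 := scr _ _ _ _ sb2 sb3 sc2 sc3.
have sn2 : smooth_map W n2 := scr _ _ _ _ sb3 sb1 sc3 sc1.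
have sn3 : smooth_map W n3 := scr _ _ _ _ sb1 sb2 sc1 sc2.
have sN : smooth_map W N := sdot _ _ _ _ _ _ sn1 sn2 sn3 sn1 sn2 sn3.
have sX : smooth_map W X := sdot _ _ _ _ _ _ (scr _ _ _ _ sa2 sa3 sc2 sc3)
  (scr _ _ _ _ sa3 sa1 sc3 sc1) (scr _ _ _ _ sa1 sa2 sc1 sc2) sn1 sn2 sn3.
have sY : smooth_map W Y := sdot _ _ _ _ _ _ (scr _ _ _ _ sa2 sa3 sb2 sb3)
  (scr _ _ _ _ sa3 sa1 sb3 sb1) (scr _ _ _ _ sa1 sa2 sb1 sb2) sn1 sn2 sn3.
have ip2 (f h2 : V) s t : ip G f (s *: h2 + t *: w) = s * ip G f h2 + t * ip G f w.
  by rewrite !ipE.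
have ip3 (f h1 h2 : V) s t :
    ip G f (h1 + s *: h2 + t *: w) = ip G f h1 + s * ip G f h2 + t * ip G f w.
  by rewrite !ipE.
have rel y : W y -> [/\ N y != 0, - X y * (N y)^-1 != 0 &
    H1 y + (- X y * (N y)^-1) *: H2 y + (Y y * (N y)^-1) *: w \in perpfd y].
  move=> Wy; have [al [be [al0 abP]]] :=
    pointwise_relation (H1E y Wy) (H10 y Wy) (H2E y Wy) (H20 y Wy).
  have perpE z : z \in perpfd y <->
      [/\ ip G (F y) z = 0, ip G (Fu y) z = 0 & ip G (Fv y) z = 0].
    by rewrite (fdE (Wc _ Wy)); exact: frame_perpP.
  have ind s t : s * b1 y + t * c1 y = 0 -> s * b2 y + t * c2 y = 0 ->
      s * b3 y + t * c3 y = 0 -> s = 0 /\ t = 0.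
    move=> e1 e2 e3.
    apply: (darboux_indep hG hiso hd2 (hw2 y) (H2E y Wy) (H20 y Wy)).
    by apply/perpE; split; [rewrite -[RHS]e1|rewrite -[RHS]e2|rewrite -[RHS]e3]; exact: ip2.
  have [f1 f2 f3] := (perpE _).1 abP.
  have e1 : a1 y + al * b1 y + be * c1 y = 0 by rewrite -[RHS]f1 (ip3 (F y)).
  have e2 : a2 y + al * b2 y + be * c2 y = 0 by rewrite -[RHS]f2 (ip3 (Fu y)).
  have e3 : a3 y + al * b3 y + be * c3 y = 0 by rewrite -[RHS]f3 (ip3 (Fv y)).
  have [N0 alE beE] := relation_cramer ind e1 e2 e3.
  split; first exact: N0.
    by apply: contra al0 => /eqP X0; rewrite alE; apply/eqP; rewrite -X0.
  rewrite (_ : - X y * (N y)^-1 = al) 1?(_ : Y y * (N y)^-1 = be)//.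
pose al y := - X y * (N y)^-1.
have sV : smooth_map W (fun y => (N y)^-1).
  by apply: smooth_mapV => // y /rel[].
have sal : smooth_map W al by apply: smooth_mapM => //; exact: smooth_mapN.
exists W, H1, (fun y => al y *: H2 y), (fun y => Y y * (N y)^-1).
split; last 2 first.
- exact: smooth_mapM.
- by move=> y /rel[].
split=> //; split; first split=> //.
- exact: smooth_mapZ.
- by move=> y Wy; apply: memvZ; exact: H2E.
- by move=> y Wy; rewrite scaler_eq0 negb_or; have [_ -> _] := rel y Wy; exact: H20.
Qed.

Section Gauge.
Variables (W : set S) (H1 H2 : S -> V) (be : S -> R).
Hypotheses (Wc : W `<=` dom c) (lH1 : lift hE1 W H1) (lH2 : lift hE2 W H2)
  (sbe : smooth_map W be)
  (rel : forall y, W y -> H1 y + H2 y + be y *: w \in perpfd y).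

Let oW : open W. Proof. by have [[]] := lH1. Qed.
Let sH1 : smooth_map W H1. Proof. by have [[]] := lH1. Qed.
Let sH2 : smooth_map W H2. Proof. by have [[]] := lH2. Qed.
Let lFW : lift E W F. Proof. exact: (lift_sub lF oW Wc). Qed.
Let sF : smooth_map W F. Proof. by have [[]] := lFW. Qed.

Let relation_dmap y v : W y ->
  dmap c (fun z => H1 z + H2 z + be z *: w) v y =
  dmap c H1 v y + dmap c H2 v y + dmap c be v y *: w.
Proof.
move=> Wy; have cy := Wc Wy.
have s12 : smooth_map W (fun z => H1 z + H2 z) by exact: smooth_mapD.
have sw := smooth_map_cst W w.
have sbw : smooth_map W (fun z => be z *: w) by exact: smooth_mapZ.
rewrite (dmapD v s12 sbw Ac cy Wy) (dmapD v sH1 sH2 Ac cy Wy) (dmapZ v sbe sw Ac cy Wy).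
by rewrite dmap_cst scaler0 addr0.
Qed.

Let mixed y v v' : W y -> (v = du R /\ v' = dv R) \/ (v = dv R /\ v' = du R) ->
  dmap c (dmap c F v') v y \in first_derived E y.
Proof.
move=> Wy vv; have cy := Wc Wy; have [_ _ Hc] := hc; have [_ _ _ Fuv _] := Hc y cy.
case: vv => -[-> ->]; first exact: Fuv.
by rewrite (dmapC (du R) (dv R) sF oW Ac cy Wy).
Qed.

(** Differentiate the relation in a principal direction: modulo the orthogonal of the
    first derived bundle the result is a combination of the two Darboux transforms and
    of [w], and it is orthogonal to the lift and to the other principal direction
    because the second fundamental form has no mixed term.  It thus vanishes modulo
    that orthogonal, so the two connection coefficients agree. *)
Lemma common_coefficient y v v' : W y ->
  (v = du R /\ v' = dv R) \/ (v = dv R /\ v' = du R) -> exists k,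
  [/\ dmap c H1 v y = k *: H1 y - m1 *: (H1 y *m eta c y v),
      dmap c H2 v y = k *: H2 y - m2 *: (H2 y *m eta c y v) &
      dmap c be v y = k * be y].
Proof.
move=> Wy vv; have cy := Wc Wy.
have [k1 D1] := darboux_dmap hd1 lH1 Ac Wc v Wy.
have [k2 D2] := darboux_dmap hd2 lH2 Ac Wc v Wy.
pose q z := H1 z + H2 z + be z *: w.
have sq : smooth_map W q.
  by apply: smooth_mapD => //; [exact: smooth_mapD|apply: smooth_mapZ => //; exact: smooth_map_cst].
have DE := relation_dmap v Wy; rewrite -/q in DE.
have qfd z g : W z -> g \in first_derived E z -> ip G g (q z) = 0.
  by move=> Wz gz; exact: (memv_perp _ _ _).1 (rel Wz) _ gz.
have sFv : smooth_map W (dmap c F v').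
  by apply: smooth_map_sub (smooth_map_dmap v' Ac oW sF) => z Wz; split=> //; exact: Wc.
have Ffd z : W z -> F z \in first_derived E z.
  move=> Wz; rewrite (fdE (Wc Wz)); do 2!apply: (subvP (addvSl _ _)); exact: memv_line.
have Fufd z : W z -> Fu z \in first_derived E z.
  move=> Wz; rewrite (fdE (Wc Wz)); apply: (subvP (addvSl _ _)); apply: (subvP (addvSr _ _)).
  exact: memv_line.
have Fvfd z : W z -> Fv z \in first_derived E z.
  by move=> Wz; rewrite (fdE (Wc Wz)); apply: (subvP (addvSr _ _)); exact: memv_line.
have vfd z : W z -> dmap c F v z \in first_derived E z.
  by move=> Wz; case: vv => -[-> _]; [exact: Fufd|exact: Fvfd].
have v'fd z : W z -> dmap c F v' z \in first_derived E z.
  by move=> Wz; case: vv => -[_ ->]; [exact: Fvfd|exact: Fufd].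
have FD : ip G (F y) (dmap c q v y) = 0.
  have := dmap_ip G v oW sF sq Ac cy Wy; rewrite (qfd _ _ Wy (vfd _ Wy)) add0r => <-.
  by rewrite (dmap_eq (g := fun=> 0) v oW Wy cy) ?dmap_cst// => z Wz; exact: qfd (Ffd _ Wz).
have bD : ip G (dmap c F v' y) (dmap c q v y) = 0.
  have := dmap_ip G v oW sFv sq Ac cy Wy; rewrite (qfd _ _ Wy (mixed Wy vv)) add0r => <-.
  by rewrite (dmap_eq (g := fun=> 0) v oW Wy cy) ?dmap_cst// => z Wz; exact: qfd (v'fd _ Wz).
have Fe h : ip G (F y) (h *m eta c y v) = 0 by exact: (eta_lift_perp hG hiso lFW Wy Ac cy).
have be' h : ip G (dmap c F v' y) (h *m eta c y v) = 0.
  by have [eu ev] := eta_principal h cy; case: vv => -[-> ->].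
have h1E : H1 y \in hE1 y by have [[_ _ H]] := lH1; move=> _; exact: H.
have h2E : H2 y \in hE2 y by have [[_ _ H]] := lH2; move=> _; exact: H.
have h20 : H2 y != 0 by have [_ H] := lH2; exact: H.
have qy := rel Wy.
pose z := k1 *: H1 y + k2 *: H2 y + dmap c be v y *: w.
have zE : z = dmap c q v y + m1 *: (H1 y *m eta c y v) + m2 *: (H2 y *m eta c y v).
  rewrite DE D1 D2 /z; move: (dmap c be v y) (H1 y *m _) (H2 y *m _) => s X Y.
  by apply/rowP => i; rewrite !mxE; ring.
have Fz : ip G (F y) z = 0.
  rewrite zE; move: FD (Fe (H1 y)) (Fe (H2 y)).
  move: (F y) (dmap c q v y) (H1 y *m _) (H2 y *m _) => f D X Y e0 e1 e2.
  by rewrite !ipE e0 e1 e2; ring.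
have bz : ip G (dmap c F v' y) z = 0.
  rewrite zE; move: bD (be' (H1 y)) (be' (H2 y)).
  move: (dmap c F v' y) (dmap c q v y) (H1 y *m _) (H2 y *m _) => f D X Y e0 e1 e2.
  by rewrite !ipE e0 e1 e2; ring.
have zP : z \in P y.
  by rewrite /z; do 2?[apply: memvD]; apply: memvZ; [exact: hE1P|exact: hE2P|exact: wP].
have zp : z \in perpfd y.
  apply: (sphere_plane_perp (a := dmap c F v y) cy _ zP Fz bz).
  by case: vv => -[-> ->]; [left|right].
have : (k2 - k1) *: H2 y + (dmap c be v y - k1 * be y) *: w \in perpfd y.
  rewrite (_ : _ + _ = z - k1 *: (H1 y + H2 y + be y *: w)); last first.
    rewrite /z; move: (dmap c be v y) (be y) (H1 y) (H2 y) => s t X Y.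
    by apply/rowP => i; rewrite !mxE; ring.
  by apply: memvB => //; exact: memvZ.
move=> /(darboux_indep hG hiso hd2 (hw2 y) h2E h20)[/eqP + /eqP].
rewrite !subr_eq0 => /eqP k21 /eqP bE.
by exists k1; split=> //; rewrite -[in RHS]k21.
Qed.

End Gauge.
End IsothermicChart.
End SphereRelation.

(** * Parallel sections *)

Section Rescaling.
Variables (R : realType) (n : nat) (G : 'M[R]_n.+2) (S : smooth_surface R).
Local Notation V := 'rV[R]_n.+2.
Variables (E : S -> {vspace V}) (eta : preform S 'M[R]_n.+2) (m : R).
Hypothesis hiso : isothermic G E eta.
Variables (W : set S) (c : chart R S) (H s : S -> V) (a b phi : S -> R) (C : R).
Hypotheses (oW : open W) (Ac : atlas S c) (Wc : W `<=` dom c)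
  (sH : smooth_map W H) (sphi : smooth_map W phi) (phi0 : forall y, W y -> phi y != 0)
  (dphi : forall y v, W y -> dmap c phi v y = (v 0 0 * a y + v 0 1 * b y) * phi y)
  (dH : forall y v, W y -> dmap c H v y =
    (v 0 0 * a y + v 0 1 * b y) *: H y - m *: (H y *m eta c y v))
  (sE : forall y, W y -> s y = (C * (phi y)^-1) *: H y).

(** Dividing a section by a function with the same logarithmic derivative makes it
    parallel. *)
Lemma rescaled_parallel : smooth_map W s /\
  forall y, W y -> forall c' v, atlas S c' -> dom c' y ->
    dmap c' s v y = - m *: (s y *m eta c' y v).
Proof.
have sk : smooth_map W (fun y => C * (phi y)^-1).
  apply: smooth_mapM => //; first exact: smooth_map_cst.
  exact: smooth_mapV.
have ss : smooth_map W s.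
  apply: (smooth_map_eq oW (f := fun y => (C * (phi y)^-1) *: H y)).
    by move=> y Wy; rewrite sE.
  exact: smooth_mapZ.
split=> // y Wy c' v Ac' c'y; have cy := Wc Wy.
rewrite (dmap_change v ss oW Ac Ac' cy c'y Wy).
have [_ [_ eta_change _] _ _ _] := hiso.
rewrite (eta_change c' c y v Ac' Ac c'y cy).
move: (dmap c' (fwd c) v y) => {}v.
rewrite (dmap_eq (g := fun y => (C * (phi y)^-1) *: H y) v oW Wy cy)//.
rewrite (dmapZ v sk sH Ac cy Wy) (dH v Wy) (sE Wy).
have := dmapM v sphi sk Ac cy Wy; rewrite (dphi v Wy).
rewrite (dmap_eq (g := fun=> C) v oW Wy cy); last first.
  by move=> z Wz; rewrite mulrCA mulfV ?mulr1// phi0.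
rewrite dmap_cst; move: (dmap c _ v y) (H y) (eta c y v) (v 0 0 * _ + _) (phi0 Wy).
move=> k h e om p0 e0.
have -> : k = - om * (C * (phi y)^-1).
  by apply: (mulfI p0); apply/eqP; rewrite -subr_eq0; apply/eqP; rewrite [RHS]e0; ring.
rewrite -scalemxAl; move: (h *m e) => x.
by apply/rowP => i; rewrite !mxE; ring.
Qed.

End Rescaling.

Section ParallelSections.
Variables (R : realType) (n : nat) (G : 'M[R]_n.+2) (S : smooth_surface R).
Hypothesis hG : lorentzian G.
Local Notation V := 'rV[R]_n.+2.
Variables (E hE1 hE2 : S -> {vspace V}) (eta : preform S 'M[R]_n.+2) (m1 m2 : R) (w : V).
Hypothesis hiso : isothermic G E eta.
Hypothesis hd1 : darboux_transform G E eta m1 hE1.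
Hypothesis hd2 : darboux_transform G E eta m2 hE2.
Hypothesis m12 : m1 != m2.
Hypothesis hw1 : forall x, w \notin spherical_system G E hE1 x.
Hypothesis hw2 : forall x, w \notin spherical_system G E hE2 x.
Hypothesis hP : forall x, sphere_planes G E hE1 w x = sphere_planes G E hE2 w x.
Hypothesis hnp : no_principal_direction G E eta (sphere_planes G E hE1 w).
Local Notation perpfd x := (perp G (first_derived E x)).

Let nE1 : null_line_bundle G hE1. Proof. by have [_ []] := hd1. Qed.
Let nE2 : null_line_bundle G hE2. Proof. by have [_ []] := hd2. Qed.

(** Lifts of the two Darboux transforms normalised by their relation with [w]: they and
    the coefficient of [w] share the connection form [a du + b dv]. *)
Definition adapted (c : chart R S) (W : set S) (H1 H2 : S -> V) (be a b : S -> R) : Prop :=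
  [/\ [/\ atlas S c, open W & W `<=` dom c],
      lift hE1 W H1, lift hE2 W H2,
      [/\ smooth_map W be, smooth_map W a & smooth_map W b] &
      forall y, W y -> H1 y + H2 y + be y *: w \in perpfd y /\
        forall v : 'rV[R]_2, let om := v 0 0 * a y + v 0 1 * b y in
        [/\ dmap c H1 v y = om *: H1 y - m1 *: (H1 y *m eta c y v),
            dmap c H2 v y = om *: H2 y - m2 *: (H2 y *m eta c y v) &
            dmap c be v y = om * be y]].

Lemma adapted_sub c W W' H1 H2 be a b : adapted c W H1 H2 be a b -> open W' -> W' `<=` W ->
  adapted c W' H1 H2 be a b.
Proof.
move=> [[Ac oW Wc] l1 l2 [s1 s2 s3] Hy] oW' WW; split.
- by split=> // y /WW/Wc.
- exact: lift_sub WW.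
- exact: lift_sub WW.
- by split; apply: smooth_map_sub WW _.
- by move=> y /WW/Hy.
Qed.

(** The connection form is read off an entry of [H1] that does not vanish, which shows that
    it is smooth. *)
Lemma adapted_exists x : exists c W H1 H2 be a b, adapted c W H1 H2 be a b /\ W x.
Proof.
have [c [F [theta [hc cx]]]] := isothermic_chart hG hiso hd1 x.
have [Ac _ _] := hc.
have [W0 [H1 [H2 [be [[W0x W0c l1 l2] s0 rel]]]]] :=
  local_relation hG hiso hd1 hd2 hw1 hw2 hP hc cx.
have [[oW0 sH1 _] H10] := l1.
have [i Hi] : exists i, H1 x 0 i != 0 by apply/rV0Pn; exact: H10.
have sHi : smooth_map W0 (fun y => H1 y 0 i) by exact: smooth_map_entry.
pose W := W0 `&` [set y | H1 y 0 i != 0].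
have oW : open W := open_nonzero oW0 sHi.
have WW0 : W `<=` W0 by move=> y [].
have Wc : W `<=` dom c by move=> y /WW0/W0c.
pose f v y := (dmap c H1 v y + m1 *: (H1 y *m eta c y v)) 0 i * (H1 y 0 i)^-1.
have sf v : smooth_map W (f v).
  have sV : smooth_map W (fun y => (H1 y 0 i)^-1).
    apply: smooth_mapV => //; first by move=> y [].
    exact: smooth_map_sub WW0 sHi.
  apply: smooth_mapM => //; apply: smooth_map_entry => //; apply: smooth_mapD => //.
    apply: smooth_map_sub (smooth_map_dmap v Ac oW0 sH1) => y Wy; split; first exact: Wc.
    exact: WW0.
  apply: smooth_mapZ => //; first exact: smooth_map_cst.
  apply: smooth_map_mulmx => //; first exact: smooth_map_sub sH1.
  exact: smooth_map_sub Wc (smooth_eta v hiso Ac).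
have fE v y k : W y -> dmap c H1 v y = k *: H1 y - m1 *: (H1 y *m eta c y v) -> f v y = k.
  move=> [_ /= Hy0] e; rewrite /f e; move: (H1 y *m _) => X.
  by rewrite subrK mxE mulfK.
exists c, W, H1, H2, be, (f (du R)), (f (dv R)); split=> //.
have l1' : lift hE1 W H1 := lift_sub l1 oW WW0.
have l2' : lift hE2 W H2 := lift_sub l2 oW WW0.
have s0' : smooth_map W be := smooth_map_sub WW0 s0.
split=> // y Wy; have W0y := WW0 _ Wy; split=> [|v]; first exact: rel.
have cy := Wc _ Wy.
have [k1 [u1 u2 u3]] :=
  common_coefficient hG hiso hd1 hd2 hw2 hP hnp hc W0c l1 l2 s0 rel W0y
    (or_introl (conj erefl erefl)).
have [k2 [v1 v2 v3]] :=
  common_coefficient hG hiso hd1 hd2 hw2 hP hnp hc W0c l1 l2 s0 rel W0y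
    (or_intror (conj erefl erefl)).
rewrite (fE _ _ _ Wy u1) (fE _ _ _ Wy v1) /=.
have [[_ sH2 _] _] := l2.
rewrite (dmap_linear sH1 Ac cy W0y) (dmap_linear sH2 Ac cy W0y) (dmap_linear s0 Ac cy W0y).
rewrite u1 u2 u3 v1 v2 v3 (eta_linear v hiso Ac cy).
move: (eta c y _) (eta c y _) (v 0 0) (v 0 1) (H1 y) (H2 y) => e2 e1 s t X1 X2.
have E0 (X : V) (m k k' : R) : s *: (k *: X - m *: (X *m e1)) + t *: (k' *: X - m *: (X *m e2)) =
    (s * k + t * k') *: X - m *: (X *m (s *: e1 + t *: e2)).
  rewrite mulmxDr -!scalemxAr; move: (X *m e1) (X *m e2) => Y Z.
  by apply/rowP => j; rewrite !mxE; ring.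
split; [exact: E0|exact: E0|].
by rewrite -[s *: _]/(s * _) -[t *: _]/(t * _); ring.
Qed.

Lemma relation_unique c W H1 H2 be a b y h1 h2 d : adapted c W H1 H2 be a b -> W y ->
  h1 \in hE1 y -> h2 \in hE2 y -> h1 + h2 + d *: w \in perpfd y ->
  exists k, [/\ h1 = k *: H1 y, h2 = k *: H2 y & d = k * be y].
Proof.
move=> [_ l1 l2 _ /(_ y) Hy] Wy; have {Hy}[qy _] := Hy Wy.
have [[_ _ H2E] /(_ _ Wy) H20] := l2.
rewrite (lift_span nE1 l1 Wy) {1}(lift_span nE2 l2 Wy) => /vlineP[k ->] /vlineP[k' ->] rel.
have : (k' - k) *: H2 y + (d - k * be y) *: w \in perpfd y.
  rewrite (_ : _ + _ = (k *: H1 y + k' *: H2 y + d *: w) -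
    k *: (H1 y + H2 y + be y *: w)); last by apply/rowP => i; rewrite !mxE; ring.
  by apply: memvB => //; exact: memvZ.
move=> /(darboux_indep hG hiso hd2 (hw2 y) (H2E _ Wy) H20)[/eqP + /eqP].
by rewrite !subr_eq0 => /eqP -> /eqP ->; exists k.
Qed.

(** Otherwise [h1] itself, a combination of this vector and of [h1 + h2], would be
    orthogonal to the first derived bundle. *)
Lemma relation_neq0 y h1 h2 : h1 \in hE1 y -> h1 != 0 -> h1 + h2 \in perpfd y ->
  m2 *: h1 + m1 *: h2 != 0.
Proof.
move=> h1E h10 rel; apply: contra h10 => /eqP u0; apply/eqP.
apply: (darboux_not_perp hG hiso hd1 h1E).
have m0 : m2 - m1 != 0 by rewrite subr_eq0 eq_sym.
rewrite -[h1]scale1r -(mulVf m0) -scalerA.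
have -> : (m2 - m1) *: h1 = (m2 *: h1 + m1 *: h2) - m1 *: (h1 + h2).
  by apply/rowP => i; rewrite !mxE; ring.
by rewrite u0 sub0r; apply: memvZ; rewrite memvN; exact: memvZ.
Qed.

Lemma adapted_rescale c W H1 H2 be a b phi C s1 s2 : adapted c W H1 H2 be a b ->
  smooth_map W phi -> (forall y, W y -> phi y != 0) ->
  (forall y (v : 'rV[R]_2), W y -> dmap c phi v y = (v 0 0 * a y + v 0 1 * b y) * phi y) ->
  (forall y, W y -> s1 y = (C * (phi y)^-1) *: H1 y) ->
  (forall y, W y -> s2 y = (C * (phi y)^-1) *: H2 y) ->
  (smooth_map W s1 /\ forall y, W y -> forall c' v, atlas S c' -> dom c' y ->
    dmap c' s1 v y = - m1 *: (s1 y *m eta c' y v)) /\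
  (smooth_map W s2 /\ forall y, W y -> forall c' v, atlas S c' -> dom c' y ->
    dmap c' s2 v y = - m2 *: (s2 y *m eta c' y v)).
Proof.
move=> [[Ac oW Wc] [[_ sH1 _] _] [[_ sH2 _] _] _ Hy] sphi phi0 dphi s1E s2E; split.
  apply: (rescaled_parallel (H := H1) hiso oW Ac Wc sH1 sphi phi0 dphi _ s1E) => y v Wy.
  by have [_ /(_ v)[]] := Hy y Wy.
apply: (rescaled_parallel (H := H2) hiso oW Ac Wc sH2 sphi phi0 dphi _ s2E) => y v Wy.
by have [_ /(_ v)[]] := Hy y Wy.
Qed.

(** The normal form of the relation with [w]: global parallel sections, and a constant
    coefficient. *)
Definition parallel_relation (d : R) (s1 s2 : S -> V) : Prop :=
  [/\ smooth_map setT s1, smooth_map setT s2,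
      forall x, [/\ s1 x \in hE1 x, s1 x != 0, s2 x \in hE2 x & s2 x != 0],
      forall x, s1 x + s2 x + d *: w \in perpfd x &
      forall c x v, atlas S c -> dom c x ->
        dmap c s1 v x = - m1 *: (s1 x *m eta c x v) /\
        dmap c s2 v x = - m2 *: (s2 x *m eta c x v)].

(** It suffices to find, near each point, a function with the logarithmic derivative of
    the adapted lifts and whose product with the scaling factor is constant. *)
Lemma parallel_relation_local d (s1 s2 : S -> V) :
  (forall x, s1 x + s2 x + d *: w \in perpfd x) ->
  (forall x, exists c W H1 H2 be a b phi C, [/\ adapted c W H1 H2 be a b, W x, C != 0 &
    [/\ smooth_map W phi, forall y, W y -> phi y != 0,
      forall y (v : 'rV[R]_2), W y -> dmap c phi v y = (v 0 0 * a y + v 0 1 * b y) * phi y &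
      forall y, W y -> s1 y = (C * (phi y)^-1) *: H1 y /\ s2 y = (C * (phi y)^-1) *: H2 y]]) ->
  parallel_relation d s1 s2.
Proof.
move=> rel loc; split=> //.
- apply: smooth_map_local => x _.
  have [c [W [H1 [H2 [be [a [b [phi [C [ad Wx C0 [sp p0 dp sE]]]]]]]]]]] := loc x.
  exists W => //.
  by have [[? _] _] := adapted_rescale ad sp p0 dp (fun y Wy => (sE y Wy).1)
    (fun y Wy => (sE y Wy).2).
- apply: smooth_map_local => x _.
  have [c [W [H1 [H2 [be [a [b [phi [C [ad Wx C0 [sp p0 dp sE]]]]]]]]]]] := loc x.
  exists W => //.
  by have [_ [? _]] := adapted_rescale ad sp p0 dp (fun y Wy => (sE y Wy).1)
    (fun y Wy => (sE y Wy).2).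
- move=> x; have [c [W [H1 [H2 [be [a [b [phi [C [ad Wx C0 [sp p0 dp sE]]]]]]]]]]] := loc x.
  have [_ [[_ _ H1E] H10] [[_ _ H2E] H20] _ _] := ad.
  have k0 : C * (phi x)^-1 != 0 by rewrite mulf_neq0// invr_eq0 p0.
  have [-> ->] := sE x Wx.
  move: (C * _) k0 => k k0; split; [|by rewrite scaler_eq0 negb_or k0 H10| |
    by rewrite scaler_eq0 negb_or k0 H20]; by apply: memvZ; [exact: H1E || exact: H2E].
- move=> c' x v Ac' c'x.
  have [c [W [H1 [H2 [be [a [b [phi [C [ad Wx C0 [sp p0 dp sE]]]]]]]]]]] := loc x.
  have [[_ d1] [_ d2]] := adapted_rescale ad sp p0 dp (fun y Wy => (sE y Wy).1)
    (fun y Wy => (sE y Wy).2).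
  by split; [exact: d1|exact: d2].
Qed.

(** The case in which the relation does not involve [w]. *)
Definition degenerate (x : S) : Prop := exists h1 h2,
  [/\ h1 \in hE1 x, h1 != 0, h2 \in hE2 x & h1 + h2 \in perpfd x].

Lemma degenerateE c W H1 H2 be a b y : adapted c W H1 H2 be a b -> W y ->
  degenerate y <-> be y = 0.
Proof.
move=> ad Wy; split=> [[h1 [h2 [h1E h10 h2E rel]]]|be0]; last first.
  have [_ [[_ _ H1E] H10] [[_ _ H2E] _] _ Hy] := ad.
  exists (H1 y), (H2 y); split; [exact: H1E|exact: H10|exact: H2E|].
  by have [+ _] := Hy y Wy; rewrite be0 scale0r addr0.
have rel' : h1 + h2 + 0 *: w \in perpfd y by rewrite scale0r addr0.
have [k [h1k _ /eqP]] := relation_unique ad Wy h1E h2E rel'.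
rewrite eq_sym mulf_eq0 => /orP[/eqP k0|/eqP//].
by move: h10; rewrite h1k k0 scale0r eqxx.
Qed.

(** The coefficient of [w] in an adapted relation solves a linear differential equation. *)
Lemma degenerate_everywhere x0 : connected [set: S] -> degenerate x0 -> forall x, degenerate x.
Proof.
move=> hS; apply: connected_locally_constant => // x.
have [c [W [H1 [H2 [be [a [b [ad Wx]]]]]]]] := adapted_exists x.
have [[Ac oW Wc] _ _ [sbe sa sb] Hy] := ad.
have dbe y (v : 'rV[R]_2) : W y -> dmap c be v y = (v 0 0 * a y + v 0 1 * b y) * be y.
  by move=> Wy; have [_ /(_ v)[]] := Hy y Wy.
have [W' oW' W'P] := ode_zero oW Wx Ac Wc sbe sa sb dbe.
exists W'; [exact: oW'|move=> y /W'P[Wy be0]].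
split=> e.
  exact: (degenerateE ad Wx).2 (be0.1 ((degenerateE ad Wy).1 e)).
exact: (degenerateE ad Wy).2 (be0.2 ((degenerateE ad Wx).1 e)).
Qed.

(** Normalise the relation by giving [w] the coefficient [1]. *)
Lemma nondegenerate_sections : (forall x, ~ degenerate x) ->
  exists s1 s2, parallel_relation 1 s1 s2.
Proof.
move=> ndeg.
have ex x : exists h : V * V, [/\ h.1 \in hE1 x, h.2 \in hE2 x &
    h.1 + h.2 + 1 *: w \in perpfd x].
  have [c [W [H1 [H2 [be [a [b [ad Wx]]]]]]]] := adapted_exists x.
  have be0 : be x != 0 by apply/eqP => /(degenerateE ad Wx); exact: ndeg.
  have [_ [[_ _ H1E] _] [[_ _ H2E] _] _ Hy] := ad.
  exists ((be x)^-1 *: H1 x, (be x)^-1 *: H2 x); split=> /=.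
  - by apply: memvZ; exact: H1E.
  - by apply: memvZ; exact: H2E.
  - by rewrite -(mulVf be0) -scalerA -!scalerDr; apply: memvZ; have [] := Hy x Wx.
have [s sP] := choice ex.
exists (fun x => (s x).1), (fun x => (s x).2); apply: parallel_relation_local.
  by move=> x; have [] := sP x.
move=> x; have [c [W [H1 [H2 [be [a [b [ad Wx]]]]]]]] := adapted_exists x.
exists c, W, H1, H2, be, a, b, be, 1; split; rewrite ?oner_neq0//.
have [_ _ _ [sbe _ _] Hy] := ad.
split=> //.
- by move=> y Wy; apply/eqP => /(degenerateE ad Wy); exact: ndeg.
- by move=> y v Wy; have [_ /(_ v)[]] := Hy y Wy.
- move=> y Wy; have [h1E h2E rel] := sP y.
  have [k [-> -> kb]] := relation_unique ad Wy h1E h2E rel.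
  have be0 : be y != 0 by apply/eqP => /(degenerateE ad Wy); exact: ndeg.
  by rewrite kb mulfK.
Qed.

(** The terms in [eta] add up to a multiple of [(H1 + H2) eta], which vanishes. *)
Lemma degenerate_dmap c W H1 H2 be a b y (v : 'rV[R]_2) : adapted c W H1 H2 be a b ->
  (forall x, degenerate x) -> W y ->
  dmap c (fun z => m2 *: H1 z + m1 *: H2 z) v y =
  (v 0 0 * a y + v 0 1 * b y) *: (m2 *: H1 y + m1 *: H2 y).
Proof.
move=> ad deg Wy; have [[Ac oW Wc] [[_ sH1 _] _] [[_ sH2 _] _] _ Hy] := ad.
have cy := Wc _ Wy; have [q /(_ v)[d1 d2 _]] := Hy y Wy.
have sm m X : smooth_map W X -> smooth_map W (fun z => m *: X z : V).
  by move=> sX; apply: smooth_mapZ => //; exact: smooth_map_cst.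
have dm m X : smooth_map W X -> dmap c (fun z => m *: X z : V) v y = m *: dmap c X v y.
  move=> sX; rewrite (dmapZ v (smooth_map_cst W m) sX Ac cy Wy) dmap_cst scale0r.
  by rewrite add0r.
rewrite (dmapD v (sm _ _ sH1) (sm _ _ sH2) Ac cy Wy) (dm _ _ sH1) (dm _ _ sH2) d1 d2.
have := (ker_eta_at hG hiso hd1 Ac cy _).1 q v.
rewrite ((degenerateE ad Wy).1 (deg y)) scale0r addr0 mulmxDl.
move: (v 0 0 * _ + _) (H1 y) (H2 y) (H1 y *m _) (H2 y *m _) => om h1 h2 X Y /eqP.
rewrite addr_eq0 => /eqP ->; by apply/rowP => i; rewrite !mxE; ring.
Qed.

(** By [degenerate_dmap] the vector [m2 h1 + m1 h2] spans a fixed line, so the relation can be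
    normalised by giving this vector the constant value [w0]. *)
Lemma degenerate_sections : connected [set: S] -> (exists x : S, True) ->
  (forall x, degenerate x) -> exists s1 s2, parallel_relation 0 s1 s2.
Proof.
move=> hS [x0 _] deg.
have adE c W H1 H2 be a b y : adapted c W H1 H2 be a b -> W y ->
    [/\ H1 y \in hE1 y, H2 y \in hE2 y, H1 y + H2 y \in perpfd y &
        m2 *: H1 y + m1 *: H2 y != 0].
  move=> ad Wy; have [_ [[_ _ H1E] H10] [[_ _ H2E] _] _ Hy] := ad.
  have [q _] := Hy y Wy; rewrite ((degenerateE ad Wy).1 (deg y)) scale0r addr0 in q.
  split=> //; [exact: H1E|exact: H2E|].
  by apply: relation_neq0 q; [exact: H1E|exact: H10].
have [w0 w00 w0P] : exists2 w0 : V, w0 != 0 & exists h1 h2, [/\ h1 \in hE1 x0,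
    h2 \in hE2 x0, h1 + h2 \in perpfd x0 & m2 *: h1 + m1 *: h2 = w0].
  have [c [W [H1 [H2 [be [a [b [ad Wx]]]]]]]] := adapted_exists x0.
  have [h1E h2E q u0] := adE _ _ _ _ _ _ _ _ ad Wx.
  by exists (m2 *: H1 x0 + m1 *: H2 x0) => //; exists (H1 x0), (H2 x0).
pose A x := exists h1 h2, [/\ h1 \in hE1 x, h2 \in hE2 x, h1 + h2 \in perpfd x &
  m2 *: h1 + m1 *: h2 = w0].
have AE c W H1 H2 be a b y : adapted c W H1 H2 be a b -> W y ->
    A y <-> exists k, k *: (m2 *: H1 y + m1 *: H2 y) = w0.
  move=> ad Wy; split=> [[h1 [h2 [h1E h2E rel hw0]]]|[k kw]].
    have rel' : h1 + h2 + 0 *: w \in perpfd y by rewrite scale0r addr0.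
    have [k [h1k h2k _]] := relation_unique ad Wy h1E h2E rel'.
    by exists k; rewrite -hw0 h1k h2k; apply/rowP => i; rewrite !mxE; ring.
  have [h1E h2E q u0] := adE _ _ _ _ _ _ _ _ ad Wy.
  exists (k *: H1 y), (k *: H2 y); split; [exact: memvZ|exact: memvZ| |].
    by rewrite -scalerDr; exact: memvZ.
  by rewrite -kw; apply/rowP => i; rewrite !mxE; ring.
(* an entry of the spanning vector that does not vanish near x *)
have coord x : exists c W H1 H2 be a b i, [/\ adapted c W H1 H2 be a b, W x &
    forall y, W y -> (m2 *: H1 y + m1 *: H2 y) 0 i != 0].
  have [c [W [H1 [H2 [be [a [b [ad Wx]]]]]]]] := adapted_exists x.
  have [_ _ _ /rV0Pn[i ui]] := adE _ _ _ _ _ _ _ _ ad Wx.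
  have [[Ac oW Wc] [[_ sH1 _] _] [[_ sH2 _] _] _ _] := ad.
  have su : smooth_map W (fun y => (m2 *: H1 y + m1 *: H2 y) 0 i).
    apply: smooth_map_entry => //; apply: smooth_mapD => //; apply: smooth_mapZ => //;
      exact: smooth_map_cst.
  exists c, (W `&` [set y | (m2 *: H1 y + m1 *: H2 y) 0 i != 0]), H1, H2, be, a, b, i.
  split=> [||y []//]; last by split.
  by apply: adapted_sub ad (open_nonzero oW su) _ => y [].
have su c W H1 H2 be a b j : adapted c W H1 H2 be a b ->
    smooth_map W (fun y => (m2 *: H1 y + m1 *: H2 y) 0 j).
  move=> [[Ac oW Wc] [[_ sH1 _] _] [[_ sH2 _] _] _ _].
  apply: smooth_map_entry => //; apply: smooth_mapD => //; apply: smooth_mapZ => //;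
    exact: smooth_map_cst.
have du c W H1 H2 be a b j y (v : 'rV[R]_2) : adapted c W H1 H2 be a b -> W y ->
    dmap c (fun y => (m2 *: H1 y + m1 *: H2 y) 0 j) v y =
    (v 0 0 * a y + v 0 1 * b y) * (m2 *: H1 y + m1 *: H2 y) 0 j.
  move=> ad Wy; have [[Ac oW Wc] [[_ sH1 _] _] [[_ sH2 _] _] _ _] := ad.
  have sU : smooth_map W (fun z => m2 *: H1 z + m1 *: H2 z).
    apply: smooth_mapD => //; apply: smooth_mapZ => //; exact: smooth_map_cst.
  rewrite (dmap_entry v 0 j sU Ac (Wc _ Wy) Wy) (degenerate_dmap v ad deg Wy).
  by rewrite [LHS]mxE.
have AT x : A x.
  move: x; apply: (connected_locally_constant hS) w0P => x.
  have [c [W [H1 [H2 [be [a [b [i [ad Wx ui]]]]]]]]] := coord x.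
  have [[Ac oW Wc] _ _ [_ sa sb] _] := ad.
  pose u y := m2 *: H1 y + m1 *: H2 y.
  (* [u y] is proportional to [w0] when these functions vanish, and each of them solves the
     equation of [u] *)
  pose f j y := w0 0 j * u y 0 i - w0 0 i * u y 0 j.
  have sui j : smooth_map W (fun y => u y 0 j) := su _ _ _ _ _ _ _ j ad.
  have sc r j : smooth_map W (fun y => r * u y 0 j).
    by apply: smooth_mapM => //; exact: smooth_map_cst.
  have sf j : smooth_map W (f j).
    by apply: smooth_mapD => //; apply: smooth_mapN.
  have df j y (v : 'rV[R]_2) : W y ->
      dmap c (f j) v y = (v 0 0 * a y + v 0 1 * b y) * f j y.
    move=> Wy; have cy := Wc _ Wy.
    have dc r l : dmap c (fun y => r * u y 0 l) v y = r * ((v 0 0 * a y + v 0 1 * b y) * u y 0 l).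
      rewrite (dmapM v (smooth_map_cst W r) (sui l) Ac cy Wy) dmap_cst mul0r add0r.
      by rewrite (du _ _ _ _ _ _ _ l y v ad Wy).
    rewrite /f (dmapD v (sc _ i) (smooth_mapN oW (sc _ j)) Ac cy Wy).
    rewrite (dmapN v (sc _ j) Ac cy Wy) !dc.
    by move: (v 0 0 * _ + _) (u y 0 i) (u y 0 j) => om r r'; ring.
  have fP y : W y -> A y <-> forall j, f j y = 0.
    move=> Wy; rewrite (AE _ _ _ _ _ _ _ _ ad Wy) /f -/(u y).
    have uiy := ui y Wy; rewrite -/(u y) in uiy.
    split=> [[k <-] j|fz]; first by rewrite !mxE; ring.
    exists (w0 0 i / u y 0 i); apply/rowP => j; rewrite mxE mulrAC.
    have -> : w0 0 i * u y 0 j = w0 0 j * u y 0 i.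
      by have := fz j; move: (u y 0 i) (u y 0 j) => r r'; lra.
    by rewrite mulfK.
  have loc j : \forall y \near x, W y /\ (f j y = 0 <-> f j x = 0).
    have [W' [oW' W'x] W'P] := ode_zero oW Wx Ac Wc (sf j) sa sb (df j).
    by apply: filterS (open_near oW' W'x).
  have near_all : \forall y \near x, forall j, W y /\ (f j y = 0 <-> f j x = 0).
    exact: filter_forall.
  have := nbhs_interior near_all; rewrite nbhsE => -[W' [oW' W'x] sub].
  exists W'; [by split|move=> y /sub/interior_subset Hy].
  have [Wy _] := Hy 0; rewrite (fP _ Wy) (fP _ Wx).
  by split=> H j; have [_ [g1 g2]] := Hy j; [exact: g1|exact: g2].
have ex x : exists h : V * V, [/\ h.1 \in hE1 x, h.2 \in hE2 x,
    h.1 + h.2 \in perpfd x & m2 *: h.1 + m1 *: h.2 = w0].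
  by have [h1 [h2 H]] := AT x; exists (h1, h2).
have [s sP] := choice ex.
exists (fun x => (s x).1), (fun x => (s x).2); apply: parallel_relation_local.
  by move=> x; have [_ _ + _] := sP x; rewrite scale0r addr0.
move=> x; have [c [W [H1 [H2 [be [a [b [i [ad Wx ui]]]]]]]]] := coord x.
have kP y : W y -> exists k, [/\ (s y).1 = k *: H1 y, (s y).2 = k *: H2 y &
    k = w0 0 i * ((m2 *: H1 y + m1 *: H2 y) 0 i)^-1].
  move=> Wy; have [h1E h2E rel hw0] := sP y.
  have rel' : (s y).1 + (s y).2 + 0 *: w \in perpfd y by rewrite scale0r addr0.
  have [k [h1k h2k _]] := relation_unique ad Wy h1E h2E rel'.
  exists k; split=> //; rewrite -hw0 h1k h2k.
  have -> : m2 *: (k *: H1 y) + m1 *: (k *: H2 y) = k *: (m2 *: H1 y + m1 *: H2 y).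
    by apply/rowP => j; rewrite !mxE; ring.
  by move: (ui y Wy); move: (m2 *: H1 y + _) => X Xi; rewrite mxE mulfK.
exists c, W, H1, H2, be, a, b, (fun y => (m2 *: H1 y + m1 *: H2 y) 0 i), (w0 0 i).
split=> //.
- have [k [h1k h2k kE]] := kP x Wx; apply: contra w00 => /eqP wi.
  have [_ _ _ <-] := sP x; rewrite h1k h2k kE wi mul0r !scale0r !scaler0 addr0 //.
- split.
  + exact: su ad.
  + exact: ui.
  + by move=> y v Wy; exact: du ad Wy.
  + by move=> y Wy; have [k [-> -> ->]] := kP y Wy.
Qed.

End ParallelSections.

(** * The conserved quantity *)

Section Interpolation.
Variables (R : realType) (n : nat) (G : 'M[R]_n.+2) (S : smooth_surface R).
Hypothesis hG : lorentzian G.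
Local Notation V := 'rV[R]_n.+2.
Variables (E hE1 hE2 : S -> {vspace V}) (eta : preform S 'M[R]_n.+2) (m1 m2 : R) (w : V).
Hypothesis hiso : isothermic G E eta.
Hypothesis hd1 : darboux_transform G E eta m1 hE1.
Hypothesis hd2 : darboux_transform G E eta m2 hE2.
Hypothesis m12 : m1 != m2.
Hypothesis hw1 : forall x, w \notin spherical_system G E hE1 x.
Variables (d : R) (s1 s2 : S -> V).
Hypothesis hs : parallel_relation G E hE1 hE2 eta m1 m2 w d s1 s2.

(** The Lagrange interpolation of the parallel sections: its value at [m1], resp. [m2],
    is proportional to [s1], resp. [s2], and its value at [0] to [w]. *)
Definition interpolation (k : nat) (x : S) : V :=
  match k with
  | 0%N => (d * m1 * m2) *: w
  | 1%N => - (d * (m1 + m2)) *: w - m2 *: s1 x - m1 *: s2 x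
  | 2%N => s1 x + s2 x + d *: w
  | _ => 0
  end.
Local Notation p := interpolation.

Lemma interpolation_eval t x : peval p 2 t x =
  (d * (t - m1) * (t - m2)) *: w + (t * (t - m2)) *: s1 x + (t * (t - m1)) *: s2 x.
Proof.
rewrite /peval !big_ord_recl big_ord0 /= /bump /= expr0 expr1.
by apply/rowP => i; rewrite !mxE; ring.
Qed.

Let oT : open [set: S]. Proof. exact: openT. Qed.
Let sS1 : smooth_map setT s1. Proof. by have [] := hs. Qed.
Let sS2 : smooth_map setT s2. Proof. by have [] := hs. Qed.
Let sZ (r : R) (X : S -> V) : smooth_map setT X -> smooth_map setT (fun x => r *: X x).
Proof. by move=> sX; apply: smooth_mapZ => //; exact: smooth_map_cst. Qed.

Let dZ (r : R) (X : S -> V) c x v : smooth_map setT X -> atlas S c -> dom c x ->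
  dmap c (fun x => r *: X x) v x = r *: dmap c X v x.
Proof.
move=> sX Ac cx; have Tx : [set: S] x by [].
by rewrite (dmapZ v (smooth_map_cst setT r) sX Ac cx Tx) dmap_cst scale0r add0r.
Qed.

Lemma smooth_interpolation k : smooth_map setT (p k).
Proof.
case: k => [|[|[|k]]]; try exact: smooth_map_cst.
  rewrite /interpolation; apply: smooth_mapD => //; last by apply: smooth_mapN => //; exact: sZ.
  apply: smooth_mapD => //; first exact: smooth_map_cst.
  by apply: smooth_mapN => //; exact: sZ.
rewrite /interpolation; apply: smooth_mapD => //; last exact: smooth_map_cst.
exact: smooth_mapD.
Qed.

Let top_eta c x v : atlas S c -> dom c x ->
  s1 x *m eta c x v + s2 x *m eta c x v + d *: (w *m eta c x v) = 0.
Proof.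
move=> Ac cx; have [_ _ _ /(_ x) rel _] := hs.
have := (ker_eta_at hG hiso hd1 Ac cx _).1 rel v.
by rewrite !mulmxDl -scalemxAl.
Qed.

(** The terms in [w eta] are eliminated with the help of [(s1 + s2 + d w) eta = 0]. *)
Lemma interpolation_parallel t c x v : atlas S c -> dom c x ->
  nabla eta t c (peval p 2 t) v x = 0.
Proof.
move=> Ac cx; have Tx : [set: S] x by [].
have [_ _ _ _ /(_ c x v Ac cx)[d1 d2]] := hs.
rewrite /nabla interpolation_eval.
rewrite (dmap_eq (g := fun x => ((d * (t - m1) * (t - m2)) *: w + (t * (t - m2)) *: s1 x) +
  (t * (t - m1)) *: s2 x) v oT Tx cx); last by move=> y _; exact: interpolation_eval.
have sw := smooth_map_cst [set: S] ((d * (t - m1) * (t - m2)) *: w).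
rewrite (dmapD v (smooth_mapD oT sw (sZ _ sS1)) (sZ _ sS2) Ac cx Tx).
rewrite (dmapD v sw (sZ _ sS1) Ac cx Tx) dmap_cst !dZ// d1 d2 add0r.
rewrite !mulmxDl -!scalemxAl; have := top_eta v Ac cx.
move: (w *m _) (s1 x *m _) (s2 x *m _) => X Y Z /eqP; rewrite addrC addr_eq0 => /eqP dX.
have -> : (d * (t - m1) * (t - m2)) *: X = ((t - m1) * (t - m2)) *: (d *: X).
  by rewrite scalerA; congr (_ *: _); ring.
by rewrite dX; apply/rowP => i; rewrite !mxE; ring.
Qed.

(** The degree is 2: if [s1 + s2 + d w] vanished identically, differentiating it would show
    that [eta] kills the linear coefficient, which is a combination of [s1] and [w] with the
    non-zero coefficient [m1 - m2] of [s1]; this contradicts [darboux_indep]. *)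
Lemma interpolation_conserved : conserved_quantity eta p 2.
Proof.
split; [split|exact: smooth_interpolation|move=> *; exact: interpolation_parallel]; last first.
  by case=> [|[|[|k]]].
apply: contrapT => /forallNP p2.
have p20 x : s1 x + s2 x + d *: w = 0 by have /negP/negbNE/eqP := p2 x.
have [_ _ [c [x [_ [Ac cx _]]]] _ _] := hiso.
have Tx : [set: S] x by [].
have [_ _ /(_ x)[s1E s10 _ _] _ /(_ c x _ Ac cx) ds] := hs.
have m12E v : m1 *: (s1 x *m eta c x v) + m2 *: (s2 x *m eta c x v) = 0.
  have := dmapD v (smooth_mapD oT sS1 sS2) (smooth_map_cst [set: S] (d *: w)) Ac cx Tx.
  rewrite (dmap_eq (g := fun=> 0) v oT Tx cx); last by move=> y _; exact: p20.
  rewrite dmap_cst dmap_cst addr0 (dmapD v sS1 sS2 Ac cx Tx); have [-> ->] := ds v.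
  by move/esym/eqP; rewrite !scaleNr -opprD oppr_eq0 => /eqP.
have : (m1 - m2) *: s1 x + (- (d * m2)) *: w \in perp G (first_derived E x).
  have -> : (m1 - m2) *: s1 x + (- (d * m2)) *: w = - (m2 *: s1 x + m1 *: s2 x) - (d * (m1 + m2)) *: w.
    have -> : s2 x = - (s1 x + d *: w).
      by apply/eqP; rewrite -addr_eq0 addrA [s2 x + _]addrC p20.
    by apply/rowP => i; rewrite !mxE; ring.
  apply/(ker_eta_at hG hiso hd1 Ac cx) => v.
  rewrite mulmxBl mulNmx mulmxDl -!scalemxAl; have := top_eta v Ac cx; have := m12E v.
  move: (w *m _) (s1 x *m _) (s2 x *m _) => X Y Z e1 /eqP; rewrite addrC addr_eq0 => /eqP dX.
  have -> : (d * (m1 + m2)) *: X = (m1 + m2) *: (d *: X).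
    by rewrite scalerA; congr (_ *: _); ring.
  by rewrite dX -[RHS]e1; apply/rowP => i; rewrite !mxE; ring.
move=> /(darboux_indep hG hiso hd1 (hw1 x) s1E s10)[/eqP + _].
by rewrite subr_eq0 (negPf m12).
Qed.

Let complementary_of (hE : S -> {vspace V}) m (s : S -> V) r :
  darboux_transform G E eta m hE -> smooth_map setT s ->
  (forall x, s x \in hE x /\ s x != 0) -> r != 0 ->
  (forall x, peval p 2 m x = r *: s x) -> complementary G E eta 2 p hE.
Proof.
move=> hdar ss sP r0 pE; have [m0 [nul _] _ _] := hdar.
have lp : lift hE setT (peval p 2 m).
  split=> [|x _]; last by have [_ s0] := sP x; rewrite pE scaler_eq0 negb_or r0.
  split=> // [|x _]; last by rewrite pE; apply: memvZ; have [] := sP x.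
  apply: (smooth_map_eq oT (f := fun x => r *: s x)) => [x _|]; first by rewrite pE.
  exact: sZ.
exists m; split=> // x.
- exact: (lift_null nul lp).
- exact: (lift_span nul lp).
Qed.

Lemma interpolation_complementary :
  complementary G E eta 2 p hE1 /\ complementary G E eta 2 p hE2.
Proof.
have [m10 _ _ _] := hd1; have [m20 _ _ _] := hd2.
have [_ _ sP _ _] := hs; split.
  apply: (complementary_of (r := m1 * (m1 - m2)) hd1 sS1).
  - by move=> x; have [] := sP x.
  - by rewrite mulf_neq0// subr_eq0.
  - move=> x; rewrite interpolation_eval; apply/rowP => i; rewrite !mxE; ring.
apply: (complementary_of (r := m2 * (m2 - m1)) hd2 sS2).
- by move=> x; have [] := sP x.
- by rewrite mulf_neq0// subr_eq0 eq_sym.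
- move=> x; rewrite interpolation_eval; apply/rowP => i; rewrite !mxE; ring.
Qed.

End Interpolation.

Theorem theorem4p1 (R : realType) (n : nat) (hn : (3 <= n)%N)
    (G : 'M[R]_n.+2) (hG : lorentzian G)
    (S : smooth_surface R) (hS : connected [set: S])
    (Lam : S -> {vspace 'rV[R]_n.+2}) (eta : preform S 'M[R]_n.+2)
    (hiso : isothermic G Lam eta) (hfull : full G Lam) :
  (forall (hLam1 hLam2 : S -> {vspace 'rV[R]_n.+2}) (m1 m2 : R)
      (w : 'rV[R]_n.+2),
    darboux_transform G Lam eta m1 hLam1 ->
    darboux_transform G Lam eta m2 hLam2 ->
    m1 != m2 ->
    (forall x, w \notin perp G (Lam x)) ->
    (forall x, w \notin spherical_system G Lam hLam1 x) ->
    (forall x, w \notin spherical_system G Lam hLam2 x) ->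
    (forall x, sphere_planes G Lam hLam1 w x = sphere_planes G Lam hLam2 w x) ->
    no_principal_direction G Lam eta (sphere_planes G Lam hLam1 w) ->
    exists p : nat -> S -> 'rV[R]_n.+2,
      [/\ special_isothermic G Lam eta 2 p,
          forall x, p 0%N x \in <[w]>%VS,
          complementary G Lam eta 2 p hLam1 &
          complementary G Lam eta 2 p hLam2])
  /\
  (forall (w : 'rV[R]_n.+2) (p : nat -> S -> 'rV[R]_n.+2)
      (hLam1 hLam2 : S -> {vspace 'rV[R]_n.+2}),
    special_isothermic_in G Lam eta 2 p w ->
    complementary G Lam eta 2 p hLam1 ->
    complementary G Lam eta 2 p hLam2 ->
    forall x, sphere_planes G Lam hLam1 w x = sphere_planes G Lam hLam2 w x).
Proof.
split=> [E1 E2 m1 m2 w hd1 hd2 m12 _ hw1 hw2 hP hnp|w p E1 E2 hp hc1 hc2 x]; last first.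
  by rewrite (complementary_sphere_planes hG x hp hc1) (complementary_sphere_planes hG x hp hc2).
have [d [s1 [s2 hs]]] : exists d s1 s2, parallel_relation G Lam E1 E2 eta m1 m2 w d s1 s2.
  have [[x0 deg]|ndeg] := pselect (exists x, degenerate G Lam E1 E2 x).
    have deg' := degenerate_everywhere hG hiso hd1 hd2 hw1 hw2 hP hnp hS deg.
    exists 0; apply: (degenerate_sections hG hiso hd1 hd2 m12 hw1 hw2 hP hnp hS _ deg').
    by exists x0.
  exists 1; apply: (nondegenerate_sections hG hiso hd1 hd2 hw1 hw2 hP hnp) => x xdeg.
  by apply: ndeg; exists x.
have [c1 c2] := interpolation_complementary hd1 hd2 m12 hs.
exists (interpolation m1 m2 w d s1 s2); split=> //.
- by split=> //; exact: (interpolation_conserved hG hiso hd1 m12 hw1 hs).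
- by move=> x; exact: memvZ (memv_line w).
Qed.
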